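(* Let $\overline M$ be an orientable, connected $n$-dimensional manifold with boundary $\partial M$ and interior $M$, equipped with a scalar-flat pseudo-Riemannian metric $g$ on $M$, such that its Levi-Civita connection $\nabla^g$ does not extend to any neighborhood of a boundary point, but the projective structure $\boldsymbol p:=[\nabla^g]$ does extend to the boundary. Let $\tau:=\operatorname{vol}(g)^{-\frac{2}{n+1}}$. Then $\zeta^{ab}:=\tau^{-1}g^{ab}$ extends to the boundary. If $L(\zeta^{ab})$ has rank $n$ on $\overline M$, then $(M,g)$ is projectively compact of order $1$.
   Context: Everything is smooth, $n\ge2$, affine connections are torsion free, indices are abstract, and ''extends'' means extends smoothly. A projective structure is an equivalence class of torsion-free affine connections with the same unparametrized geodesics; projectively related connections satisfy $\bar\nabla_aY^b=\nabla_aY^b+\Upsilon_aY^b+\Upsilon_cY^c\delta^b_a$ for some 1-form $\Upsilon$. $\mathcal E(1)$ is the positive $(2n+2)$-th root of the oriented line bundle $(\Lambda^nTM)^2$, $\mathcal E(w)=\mathcal E(1)^w$, $\mathcal E^a=TM$, $\mathcal E_a=T^*M$, $\mathcal B(w)=\mathcal B\otimes\mathcal E(w)$; the volume density $\operatorname{vol}(g)$ is a positive section of $\mathcal E(-n-1)$, so $\tau\in\Gamma(\mathcal E(2))$ and $\zeta^{ab}\in\Gamma(\mathcal E^{(ab)}(-2))$ on $M$. The standard cotractor bundle is $\mathcal T^*=J^1\mathcal E(1)$; a connection $\nabla$ in the projective class gives a splitting $\mathcal T^*\cong\mathcal E(1)\oplus\mathcal E_a(1)$. $L(\zeta)$ is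 the projectively invariant section of $S^2\mathcal T$ (symmetric bilinear form on $\mathcal T^*$) given, for a connection $\nabla$ in the class preserving a volume density, by $L(\zeta)\big((\xi,\mu),(\xi',\mu')\big)=\zeta^{ab}\mu_a\mu'_b+\lambda^a(\mu_a\xi'+\mu'_a\xi)+\rho\,\xi\xi'$, with $\lambda^a=-\frac1{n+1}\nabla_b\zeta^{ab}$, $\rho=\frac1nP_{ab}\zeta^{ab}+\frac1{n(n+1)}\nabla_a\nabla_b\zeta^{ab}$, where $P_{ab}=\frac1{n-1}\mathrm{Ric}_{ab}$, $\mathrm{Ric}_{bd}=R_{ab}{}^a{}_d$, $(\nabla_a\nabla_b-\nabla_b\nabla_a)v^c=R_{ab}{}^c{}_dv^d$. On $\overline M$, $L(\zeta)$ is formed with the extended $\zeta$ and the extended projective structure. A connection $\nabla$ on $M$ is projectively compact of order $\alpha>0$ if near each boundary point there is a local defining function $r\ge0$ for $\partial M$ (zero set $\partial M$, $dr\neq0$ there) such that $\hat\nabla_\mu\xi=\nabla_\mu\xi+\frac{dr(\mu)}{\alpha r}\xi+\frac{dr(\xi)}{\alpha r}\mu$ is smooth up to the boundary for all vector fields $\mu,\xi$ smooth up to the boundary; $(M,g)$ is projectively compact of order $\alpha$ if $\nabla^g$ is. *)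

(* Defs.v *)
From HB Require Import structures.
From mathcomp Require Import all_boot all_order all_algebra.
From mathcomp Require Import mathcomp_extra boolp classical_sets functions.
From mathcomp Require Import reals topology normedtype derive exp.

Set Implicit Arguments.
Unset Strict Implicit.
Unset Printing Implicit Defensive.

Import Order.TTheory GRing.Theory Num.Theory.
Import numFieldNormedType.Exports.

Local Open Scope classical_set_scope.
Local Open Scope ring_scope.

(* Geometric objects on a smooth manifold with boundary are families of
   component functions, one for each chart of a fixed smooth atlas, subject to
   the usual transformation laws.  Only the values at points of the domain of
   the chart (and of the open set on which the object lives) are meaningful.  *)

Section HalfSpace.
Variables (R : realType) (n : nat).

(* Only the index of value 0 is constrained: {x | x_0 >= 0}.                  *)
Definition halfspace : set 'rV[R]_n :=
  [set x | forall i : 'I_n, val i = 0%N -> 0 <= x 0 i].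

Fixpoint Ck (k : nat) (W : set 'rV[R]_n) (F : 'rV[R]_n -> R) : Prop :=
  (forall x, W x -> {for x, continuous F}) /\
  if k is k'.+1 then
    forall i : 'I_n, (forall x, W x -> derivable F x (delta_mx 0 i)) /\
      Ck k' W (fun x => 'D_(delta_mx 0 i) F x)
  else True.

(* Smoothness on a possibly non-open set: local extendability to a smooth
   function on an open subset of R^n.                                         *)
Definition smooth_on (A : set 'rV[R]_n) (f : 'rV[R]_n -> R) : Prop :=
  forall x, A x -> exists W F,
    [/\ open W, W x, forall k, Ck k W F & forall y, W y -> A y -> F y = f y].

(* Partial derivative within the half-space; one-sided at boundary points in
   the direction of the first coordinate.                                     *)
Definition pd (i : 'I_n) (f : 'rV[R]_n -> R) (x : 'rV[R]_n) : R :=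
  lim ((fun h : R => h^-1 * (f (x + h *: delta_mx 0 i) - f x)) @
       within [set h : R | halfspace (x + h *: delta_mx 0 i)] 0^').

Record chart (T : topologicalType) := Chart {
  dom : set T;
  coord : T -> 'rV[R]_n;
  point : 'rV[R]_n -> T }.

Definition is_chart (T : topologicalType) (c : chart T) : Prop :=
  [/\ open (dom c),
      exists2 W, open W & coord c @` dom c = W `&` halfspace,
      forall p, dom c p -> point c (coord c p) = p,
      {within dom c, continuous (coord c)} &
      {within coord c @` dom c, continuous (point c)}].

Definition smoothly_compatible (T : topologicalType) (c d : chart T) : Prop :=
  forall i : 'I_n, smooth_on (coord c @` (dom c `&` dom d))
                             (fun x => coord d (point c x) 0 i).

Record bmanifold := BManifold {
  carrier :> topologicalType;
  atlas : set (chart carrier);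
  bm_hausdorff : hausdorff_space carrier;
  bm_countable : @second_countable carrier;
  bm_chart : forall c, atlas c -> is_chart c;
  bm_cover : forall p, exists2 c, atlas c & dom c p;
  bm_smooth : forall c d, atlas c -> atlas d -> smoothly_compatible c d }.

End HalfSpace.

Arguments halfspace {R n}.

Section Fields.
Variables (R : realType) (n : nat) (M : bmanifold R n).

Local Notation chartM := (chart R n M).
Implicit Types (U : set M) (c d : chartM) (p q : M).

Definition bm_boundary : set M :=
  [set p | exists c, [/\ atlas c, dom c p &
                         exists i : 'I_n, val i = 0%N /\ coord c p 0 i = 0]].

Definition bm_interior : set M := ~` bm_boundary.

Definition dc c (i : 'I_n) (f : M -> R) p : R :=
  pd i (f \o point c) (coord c p).

(* jac c d p a i = d(x_d^a) / d(x_c^i) *)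
Definition jac c d p : 'M[R]_n :=
  \matrix_(a, i) dc c i (fun q => coord d q 0 a) p.

Definition at_pt U c p : Prop := [/\ atlas c, dom c p & U p].
Definition at_overlap U c d p : Prop := at_pt U c p /\ at_pt U d p.

Definition smooth_in U c (f : M -> R) : Prop :=
  smooth_on (coord c @` (U `&` dom c)) (f \o point c).

Definition smooth_fun U (f : M -> R) : Prop :=
  forall c, atlas c -> smooth_in U c f.

Definition orientable : Prop :=
  exists o : chartM -> M -> bool,
    (forall c p, atlas c -> dom c p -> \forall q \near p, o c q = o c p) /\
    (forall c d p, at_overlap setT c d p ->
       (o d p == o c p) = (0 < \det (jac c d p))).

Definition vector_field U (X : chartM -> M -> 'rV[R]_n) : Prop :=
  (forall c a, atlas c -> smooth_in U c (fun q => X c q 0 a)) /\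
  (forall c d p, at_overlap U c d p -> X d p = X c p *m (jac c d p)^T).

Definition one_form U (Y : chartM -> M -> 'rV[R]_n) : Prop :=
  (forall c a, atlas c -> smooth_in U c (fun q => Y c q 0 a)) /\
  (forall c d p, at_overlap U c d p -> Y c p = Y d p *m jac c d p).

(* A section v of Lambda^n TM transforms by v_d = \det (jac c d) * v_c, hence
   sections of E(1), the positive (2n+2)-th root of its square, transform by
   |\det (jac c d)| `^ (1 / (n + 1)).                                         *)
Definition wfactor (w : R) c d p : R :=
  `|\det (jac c d p)| `^ (w / n.+1%:R).

Definition density (w : R) U (s : chartM -> M -> R) : Prop :=
  (forall c, atlas c -> smooth_in U c (s c)) /\
  (forall c d p, at_overlap U c d p -> s d p = wfactor w c d p * s c p).

Definition sym_bivector (w : R) U (z : chartM -> M -> 'M[R]_n) : Prop :=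
  [/\ forall c a b, atlas c -> smooth_in U c (fun q => z c q a b),
      forall c p, at_pt U c p -> (z c p)^T = z c p &
      forall c d p, at_overlap U c d p ->
        z d p = wfactor w c d p *: (jac c d p *m z c p *m (jac c d p)^T)].

Definition pseudo_metric U (g : chartM -> M -> 'M[R]_n) : Prop :=
  [/\ forall c i j, atlas c -> smooth_in U c (fun q => g c q i j),
      forall c p, at_pt U c p -> (g c p)^T = g c p,
      forall c p, at_pt U c p -> g c p \in unitmx &
      forall c d p, at_overlap U c d p ->
        g c p = (jac c d p)^T *m g d p *m jac c d p].

(* Christoffel symbols: nabla_{e_i} e_j = \sum_k G c p k i j e_k. *)
Definition connection := chartM -> M -> 'I_n -> 'I_n -> 'I_n -> R.
Implicit Types (G D : connection).

Definition affine U G : Prop :=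
  [/\ forall c k i j, atlas c -> smooth_in U c (fun q => G c q k i j),
      forall c p k i j, at_pt U c p -> G c p k i j = G c p k j i &
      forall c d p, at_overlap U c d p -> forall l i j,
        \sum_k jac c d p l k * G c p k i j =
        \sum_a \sum_b G d p l a b * jac c d p a i * jac c d p b j +
        dc c i (dc c j (fun q => coord d q 0 l)) p].

Definition levi_civita U (g : chartM -> M -> 'M[R]_n) G : Prop :=
  affine U G /\
  forall c p, at_pt U c p -> forall i j k,
    dc c i (fun q => g c q j k) p -
      \sum_l (G c p l i j * g c p l k + G c p l i k * g c p j l) = 0.

(* R_{ab}^k_d *)
Definition curvature G c p (a b k d : 'I_n) : R :=
  dc c a (fun q => G c q k b d) p - dc c b (fun q => G c q k a d) p +
  \sum_e (G c p k a e * G c p e b d - G c p k b e * G c p e a d).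

Definition ricci G c p (b d : 'I_n) : R := \sum_a curvature G c p a b a d.

Definition schouten G c p (a b : 'I_n) : R :=
  (n%:R - 1)^-1 * ricci G c p a b.

Definition scalar_flat U (g : chartM -> M -> 'M[R]_n) G : Prop :=
  forall c p, at_pt U c p ->
    \sum_b \sum_d invmx (g c p) b d * ricci G c p b d = 0.

(* On a density of weight w, nabla_i s = d_i s + w * wconn G c p i * s; for
   w = - (n + 1) this is the induced connection on volume densities.          *)
Definition wconn G c p (i : 'I_n) : R := n.+1%:R^-1 * \sum_e G c p e i e.

Definition nabla_density (w : R) G (s : chartM -> M -> R) c p (i : 'I_n) : R :=
  dc c i (s c) p + w * wconn G c p i * s c p.

Definition nabla_vector (w : R) G (v : chartM -> M -> 'rV[R]_n) c p
    (i a : 'I_n) : R :=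
  dc c i (fun q => v c q 0 a) p + \sum_e G c p a i e * v c p 0 e +
  w * wconn G c p i * v c p 0 a.

Definition nabla_bivector (w : R) G (z : chartM -> M -> 'M[R]_n) c p
    (i a b : 'I_n) : R :=
  dc c i (fun q => z c q a b) p +
  \sum_e (G c p a i e * z c p e b + G c p b i e * z c p a e) +
  w * wconn G c p i * z c p a b.

Definition preserves_volume U G : Prop :=
  exists nu, [/\ density (- n.+1%:R) U nu,
    forall c p, at_pt U c p -> 0 < nu c p &
    forall c p, at_pt U c p -> forall i,
      nabla_density (- n.+1%:R) G nu c p i = 0].

Definition proj_class U G : set connection :=
  [set D | affine U D /\ exists2 Y, one_form U Y &
     forall c p, at_pt U c p -> forall k i j,
       D c p k i j = G c p k i j + Y c p 0 i * (k == j)%:R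
                                 + Y c p 0 j * (k == i)%:R].

Definition proj_structure U (P : set connection) : Prop :=
  exists2 G, affine U G & P = proj_class U G.

(* Restricting to a smaller open set does not change component families, so
   that a projective structure on the whole manifold restricts to [G] on the
   interior when all its members lie in [G].                                  *)
Definition proj_extension G (P : set connection) : Prop :=
  proj_structure setT P /\ P `<=` proj_class bm_interior G.

Definition connection_extends_near G p : Prop :=
  exists U D, [/\ open U, U p, affine U D &
    forall c q, at_pt (U `&` bm_interior) c q -> D c q = G c q].

Definition vol (g : chartM -> M -> 'M[R]_n) c p : R :=
  Num.sqrt `|\det (g c p)|.

Definition tau (g : chartM -> M -> 'M[R]_n) c p : R :=
  vol g c p `^ (- (2 / n.+1%:R)).

Definition zeta (g : chartM -> M -> 'M[R]_n) c p : 'M[R]_n :=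
  (tau g c p)^-1 *: invmx (g c p).

Definition zeta_extension (g z : chartM -> M -> 'M[R]_n) : Prop :=
  sym_bivector (- 2) setT z /\
  forall c p, at_pt bm_interior c p -> z c p = zeta g c p.

(* In a chart c, the fibre at p of T^* = J^1 E(1) is 'rV_(1 + n): the value of
   a section of E(1) at p followed by its partial derivatives.                *)
Definition split_xi (j : 'rV[R]_(1 + n)) : R := lsubmx j 0 0.

Definition split_mu G c p (j : 'rV[R]_(1 + n)) (a : 'I_n) : R :=
  rsubmx j 0 a + wconn G c p a * lsubmx j 0 0.

Definition div_zeta G (z : chartM -> M -> 'M[R]_n) c p : 'rV[R]_n :=
  \row_a \sum_b nabla_bivector (- 2) G z c p b a b.

Definition lambda G (z : chartM -> M -> 'M[R]_n) c p (a : 'I_n) : R :=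
  - (n.+1%:R^-1 * div_zeta G z c p 0 a).

Definition rho G (z : chartM -> M -> 'M[R]_n) c p : R :=
  n%:R^-1 * (\sum_a \sum_b schouten G c p a b * z c p a b) +
  (n%:R * n.+1%:R)^-1 * \sum_a nabla_vector (- 2) G (div_zeta G z) c p a a.

Definition L_formula G (z : chartM -> M -> 'M[R]_n) c p
    (j j' : 'rV[R]_(1 + n)) : R :=
  \sum_a \sum_b z c p a b * split_mu G c p j a * split_mu G c p j' b +
  \sum_a lambda G z c p a *
    (split_mu G c p j a * split_xi j' + split_mu G c p j' a * split_xi j) +
  rho G z c p * split_xi j * split_xi j'.

Definition cotractor_form := chartM -> M ->
  'rV[R]_(1 + n) -> 'rV[R]_(1 + n) -> R.

(* L is given by the formula for every locally defined connection that belongs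
   to the projective structure P and preserves a volume density.              *)
Definition is_L (P : set connection) (z : chartM -> M -> 'M[R]_n)
    (L : cotractor_form) : Prop :=
  forall U G G0, open U -> P G0 -> proj_class U G0 G -> preserves_volume U G ->
    forall c p, at_pt U c p -> L c p = L_formula G z c p.

Definition form_rank (L : cotractor_form) c p : nat :=
  \rank (\matrix_(i < 1 + n, j < 1 + n)
           L c p (delta_mx 0 i) (delta_mx 0 j)).

Definition dir_deriv c (f : M -> R) p (v : 'rV[R]_n) : R :=
  \sum_i dc c i f p * v 0 i.

Definition cov_deriv G (X Y : chartM -> M -> 'rV[R]_n) c p : 'rV[R]_n :=
  \row_k (dir_deriv c (fun q => Y c q 0 k) p (X c p) +
          \sum_i \sum_j G c p k i j * X c p 0 i * Y c p 0 j).

Definition defining_function U (r : M -> R) : Prop :=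
  [/\ smooth_fun U r,
      forall q, U q -> 0 <= r q,
      forall q, U q -> (r q = 0 <-> bm_boundary q) &
      forall c q, at_pt (U `&` bm_boundary) c q -> exists i, dc c i r q <> 0].

Definition projectively_compact (alpha : R) G : Prop :=
  forall p, bm_boundary p -> exists U r,
    [/\ open U, U p, defining_function U r &
      forall mu xi, vector_field U mu -> vector_field U xi ->
        exists2 eta, vector_field U eta &
          forall c q, at_pt (U `&` bm_interior) c q ->
            eta c q = cov_deriv G mu xi c q
              + (dir_deriv c r q (mu c q) / (alpha * r q)) *: xi c q
              + (dir_deriv c r q (xi c q) / (alpha * r q)) *: mu c q].

End Fields.

Arguments bm_boundary {R n M}.
Arguments bm_interior {R n M}.
Arguments orientable {R n} M.

(* Main.v *)
(* Let G be a connection of the extended projective structure, G = nabla + Y on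
   the interior.  Since zeta is parallel for nabla, D_i zeta^jk is linear in zeta
   up to delta_ij mu^k + delta_ik mu^j with mu = zeta Y, and commuting second
   derivatives first gives D mu = delta rho + (linear terms) and then D rho, so
   that (zeta, mu, rho) solves a closed linear system with coefficients smooth up
   to the boundary.  By Gronwall's inequality the solution and all its
   derivatives are bounded on half boxes, and Seeley's reflection extends it.

   As g is scalar flat, L(zeta) computed with nabla is zeta pulled back along
   (xi, mu) |-> mu + w xi, where w is the density connection form of nabla.
   Hence the adjugate of its matrix in a chart is det zeta * v v^T with
   v = (1, -w), and |det zeta| = tau.  If tau were nonzero at a boundary point,
   w would extend smoothly and so would nabla; hence tau vanishes there, while
   the rank condition keeps the rank one adjugate A nonzero.  So some diagonal
   entry A_aa is nonzero and s = A_0a / |A_aa|^(1/2) is a smooth square root of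
   tau with s = 0 and ds <> 0 on the boundary.  Finally ds / s = d tau / (2 tau)
   = -w, so nabla + ds / s is the member of the projective class that is
   trace free in the chart. *)
From HB Require Import structures.
From mathcomp Require Import all_boot all_order all_algebra.
From mathcomp Require Import mathcomp_extra boolp classical_sets functions.
From mathcomp Require Import reals topology normedtype landau derive exp sequences.
From mathcomp Require Import realfun perm ring lra.
Require Import Defs.

Set Implicit Arguments.
Unset Strict Implicit.
Unset Printing Implicit Defensive.

Import Order.TTheory GRing.Theory Num.Theory.
Import numFieldNormedType.Exports.

Local Open Scope classical_set_scope.
Local Open Scope ring_scope.

(** * Differential calculus in coordinates *)

(** The form Y that relates nabla to a representative smooth up to the boundary does not itself
    extend there, so the proof looks for expressions from which Y has disappeared. For zeta, the
    weight -2 makes the terms Y_i zeta^jk cancel; what is left of Y enters only through the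
    contraction mu, which is therefore made an unknown of the linear system. For L(zeta), one and
    the same form is evaluated with two representatives: nabla, on the interior, shows that it is
    degenerate, and a representative preserving the coordinate volume of a chart shows that it is
    smooth up to the boundary. Identities then pass to the boundary because the interior is dense.
    Smoothness at a boundary point means extendability across it, so bounds on derivatives have to
    be followed by an explicit extension operator. The adjugate A is used because its entries are
    polynomials in those of L(zeta): A_00 tends to 0 at the boundary, but A_aa = A_00 w_a^2 can keep
    a nonzero limit, and this records the rate at which w blows up. *)

Section Line.
Variable R : realType.

Lemma line_derive (V : normedModType R) (F : V -> R) (x v : V) (s : R) :
  derivable F (x + s *: v) v ->
  is_derive s 1 (fun t : R => F (x + t *: v)) ('D_v F (x + s *: v)).
Proof.
move=> dF.
have E : (fun h => h^-1 *: (((fun t : R => F (x + t *: v)) \o shift s) (h *: 1) -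
            F (x + s *: v))) =
         (fun h => h^-1 *: ((F \o shift (x + s *: v)) (h *: v) - F (x + s *: v))).
  apply/funext => h /=; congr (_ *: (F _ - _)).
  by rewrite scalerDl addrCA; congr (_ + _); rewrite [h *: 1]mulr1.
by split; rewrite /derivable /derive E.
Qed.

(** The segment is parametrised by [0, 1] and scaled by [h], so that steps of either sign, and the
    zero step, are treated alike. *)
Lemma line_MVT (V : normedModType R) (F : V -> R) (x v : V) (h : R) :
  (forall s : R, 0 <= s <= 1 -> derivable F (x + (s * h) *: v) v) ->
  exists s : R, 0 <= s <= 1 /\ F (x + h *: v) - F x = h * 'D_v F (x + (s * h) *: v).
Proof.
move=> dF.
pose g (s : R) := F (x + s *: (h *: v)).
have dg (s : R) : 0 <= s <= 1 -> is_derive s 1 g (h * 'D_v F (x + (s * h) *: v)).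
  move=> s01.
  have := line_derive (dF s s01).
  set G := fun t : R => F (x + t *: v) => dG.
  have -> : g = G \o (fun s => s * h).
    by apply/funext => t; rewrite /g /G /= scalerA.
  have dm : is_derive s (1:R) (fun s : R => s * h) h.
    have -> : (fun s : R => s * h) = (@id R) * cst h by [].
    by apply: is_derive_eq; rewrite scaler0 add0r /GRing.scale /= mulr1.
  split.
    apply/derivable1_diffP/differentiable_comp; apply/derivable1_diffP.
      exact: ex_derive.
    exact: ex_derive.
  rewrite -derive1E derive1_comp; [|exact: ex_derive|exact: ex_derive].
  by rewrite !derive1E !derive_val mulrC.
have [||c] := @MVT_segment R g (fun s => h * 'D_v F (x + (s * h) *: v)) 0 1 ler01.
- by move=> s /[!in_itv] /= /andP[s0 s1]; apply: dg; rewrite !ltW.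
- apply: derivable_within_continuous => s /[!in_itv] /= s01.
  by have [] := dg s s01.
rewrite in_itv /= => c01; rewrite subr0 mulr1 /g scale0r addr0 scale1r => E.
by exists c.
Qed.

End Line.

Section Dk.
Variables (R : realType) (n : nat).
Local Notation rV := 'rV[R]_n.
Local Notation e i := (delta_mx 0 i : rV).

(* [Ck] is the case where [P0] is continuity on [W]; the other instance adds
   boundedness on [W]. *)
Fixpoint Dk (P0 : (rV -> R) -> Prop) (k : nat) (W : set rV) (F : rV -> R) : Prop :=
  P0 F /\
  if k is k'.+1 then
    forall i : 'I_n, (forall x, W x -> derivable F x (e i)) /\
      Dk P0 k' W (fun x => 'D_(e i) F x)
  else True.

(** What a condition of order zero must satisfy for its C^k version to be closed under sums and
    products. Invariance under changes off [W] is included because derivatives are identified on [W]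
    only. *)
Definition function_algebra (W : set rV) (P0 : (rV -> R) -> Prop) :=
  [/\ forall F G, (forall x, W x -> F x = G x) -> P0 F -> P0 G,
      forall a, P0 (cst a),
      forall F G, P0 F -> P0 G -> P0 (fun x => F x + G x) &
      forall F G, P0 F -> P0 G -> P0 (fun x => F x * G x)].

Definition contin (W : set rV) (F : rV -> R) := forall x, W x -> F @ x --> F x.

Lemma CkE k W F : Ck k W F <-> Dk (contin W) k W F.
Proof.
elim: k F => [|k IH] F //=; split=> -[c H]; split=> // i; have [d /IH] := H i; by split.
Qed.

Lemma near_open (W : set rV) x : open W -> W x -> \forall y \near x, W y.
Proof. by move=> oW Wx; apply: open_nbhs_nbhs. Qed.

Lemma eq_derivable (W : set rV) F G x v : open W -> W x ->
  (forall y, W y -> F y = G y) -> derivable (F : rV -> R) x v -> derivable (G : rV -> R) x v.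
Proof.
move=> oW Wx FG; apply: near_eq_derivable.
by apply: filterS (near_open oW Wx) => y Wy; apply: FG.
Qed.

Lemma eq_derive (W : set rV) F G x v : open W -> W x ->
  (forall y, W y -> F y = G y) -> 'D_v (F : rV -> R) x = 'D_v (G : rV -> R) x.
Proof.
move=> oW Wx FG; apply: near_eq_derive.
by apply: filterS (near_open oW Wx) => y Wy; apply: FG.
Qed.

Lemma contin_algebra W : open W -> function_algebra W (contin W).
Proof.
move=> oW; split=> [F G FG cF x Wx|a x _|F G cF cG x Wx|F G cF cG x Wx].
- have E : {near x, F =1 G}.
    by apply: filterS (near_open oW Wx) => y Wy; apply: FG.
  rewrite -(FG _ Wx); apply: cvg_trans (cF x Wx).
  exact: (near_eq_cvg E).
- exact: (@cst_continuous _ _ a x).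
- exact: (cvgD (cF x Wx) (cG x Wx)).
- exact: (cvgM (cF x Wx) (cG x Wx)).
Qed.

Section Algebra.
Variables (W : set rV) (P0 : (rV -> R) -> Prop).
Hypothesis (oW : open W) (alg : function_algebra W P0).

Lemma Dk_ext k F G : (forall x, W x -> F x = G x) -> Dk P0 k W F -> Dk P0 k W G.
Proof.
have [ext _ _ _] := alg.
elim: k F G => [|k IH] F G FG /= [P d]; split; rewrite ?(ext _ _ FG) //; try exact: ext P.
move=> i; have [dF D] := d i; split.
  by move=> x Wx; exact: (eq_derivable oW Wx FG (dF x Wx)).
apply: IH D => x Wx; exact: (eq_derive _ oW Wx FG).
Qed.

Lemma Dk_ext' k F G : (forall x, W x -> G x = F x) -> Dk P0 k W F -> Dk P0 k W G.
Proof. by move=> FG; apply: Dk_ext => x Wx; rewrite FG. Qed.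

Lemma Dk_cst k a : Dk P0 k W (cst a).
Proof.
have [_ c _ _] := alg.
elim: k a => [|k IH] a /=; split=> // i; split=> [x _|]; first exact: derivable_cst.
by apply: Dk_ext (IH 0) => x _; rewrite derive_cst.
Qed.

Lemma DkS k F : Dk P0 k.+1 W F -> Dk P0 k W F.
Proof.
elim: k F => [|k IH] F; first by case.
by move=> [P d]; split=> // i; have [dF D] := d i; split=> //; apply: IH.
Qed.

Lemma Dk_le k l F : (k <= l)%N -> Dk P0 l W F -> Dk P0 k W F.
Proof.
move=> kl; rewrite -(subnK kl); elim: (l - k)%N => // m IH.
by rewrite addSn => /DkS.
Qed.

Lemma Dk_base k F : Dk P0 k W F -> P0 F.
Proof. by case: k => [[]|k []]. Qed.

Lemma Dk_add k F G : Dk P0 k W F -> Dk P0 k W G -> Dk P0 k W (fun x => F x + G x).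
Proof.
have [_ _ add _] := alg.
elim: k F G => [|k IH] F G /= [PF dF] [PG dG]; split; try exact: add; first by [].
move=> i; have [dFi DF] := dF i; have [dGi DG] := dG i; split.
  by move=> x Wx; apply: derivableD; [exact: dFi|exact: dGi].
apply: Dk_ext (IH _ _ DF DG) => x Wx.
by rewrite deriveD //; [exact: dFi|exact: dGi].
Qed.

Lemma Dk_mul k F G : Dk P0 k W F -> Dk P0 k W G -> Dk P0 k W (fun x => F x * G x).
Proof.
have [_ _ _ mul] := alg.
elim: k F G => [|k IH] F G; first by case=> PF _ [PG _]; split=> //; exact: mul.
move=> DF' DG'; have := DkS DF'; have := DkS DG'.
case: DF' DG' => [PF dF] [PG dG] G' F'; split; first exact: mul.
move=> i; have [dFi DF] := dF i; have [dGi DG] := dG i; split.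
  by move=> x Wx; apply: derivableM; [exact: dFi|exact: dGi].
apply: Dk_ext (Dk_add (IH _ _ F' DG) (IH _ _ G' DF)) => x Wx.
by rewrite deriveM //; [exact: dFi|exact: dGi].
Qed.

Lemma Dk_scale k a F : Dk P0 k W F -> Dk P0 k W (fun x => a * F x).
Proof. by move=> DF; apply: Dk_mul => //; exact: Dk_cst. Qed.

Lemma Dk_opp k F : Dk P0 k W F -> Dk P0 k W (fun x => - F x).
Proof. by move=> /(Dk_scale (-1)); apply: Dk_ext => x _; rewrite mulN1r. Qed.

Lemma Dk_sum k (I : Type) (r : seq I) (P : pred I) (F : I -> rV -> R) :
  (forall i, P i -> Dk P0 k W (F i)) -> Dk P0 k W (fun x => \sum_(i <- r | P i) F i x).
Proof.
move=> DF; elim: r => [|i r IH].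
  by apply: Dk_ext (Dk_cst k 0) => x _; rewrite big_nil.
have [Pi|nPi] := boolP (P i).
  by apply: Dk_ext (Dk_add (DF i Pi) IH) => x _; rewrite big_cons Pi.
by apply: Dk_ext IH => x _; rewrite big_cons (negbTE nPi).
Qed.

Lemma Dk_der k F i : Dk P0 k.+1 W F -> Dk P0 k W (fun x => 'D_(e i) F x).
Proof. by case=> _ /(_ i)[]. Qed.

Lemma Dk_derivable k F i x : Dk P0 k.+1 W F -> W x -> derivable F x (e i).
Proof. by case=> _ /(_ i)[] + _ Wx; apply. Qed.

End Algebra.

Lemma Dk_sub_set (P0 P1 : (rV -> R) -> Prop) (V W : set rV) k F :
  V `<=` W -> (forall F, P0 F -> P1 F) -> Dk P0 k W F -> Dk P1 k V F.
Proof.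
move=> VW P01; elim: k F => [|k IH] F [P d]; split; auto => i.
by have [dF D] := d i; split; [move=> x /VW; apply: dF|apply: IH].
Qed.

End Dk.

Lemma near_and (T : topologicalType) (x : T) (P Q : T -> Prop) :
  (\forall y \near x, P y) -> (\forall y \near x, Q y) -> \forall y \near x, P y /\ Q y.
Proof. exact: filterI. Qed.

Lemma near_all (T : topologicalType) (x : T) (P : T -> Prop) :
  (forall y, P y) -> \forall y \near x, P y.
Proof. exact: nearW. Qed.

Lemma near_imp (T : topologicalType) (x : T) (P Q : T -> Prop) :
  (forall y, P y -> Q y) -> (\forall y \near x, P y) -> \forall y \near x, Q y.
Proof. by move=> PQ; apply: filterS. Qed.

Lemma near_forall (T : topologicalType) (x : T) (I : finType) (P : I -> T -> Prop) :
  (forall i, \forall y \near x, P i y) -> \forall y \near x, forall i, P i y.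
Proof. exact: filter_forall. Qed.

Lemma cvg_sumr (R : realType) (T : Type) (F : set_system T) {FF : Filter F} (I : Type)
    (r : seq I) (P : pred I) (f : I -> T -> R) (l : I -> R) :
  (forall i, P i -> f i @ F --> l i) ->
  (fun t => \sum_(i <- r | P i) f i t) @ F --> \sum_(i <- r | P i) l i.
Proof.
move=> fl; elim: r => [|i r IH].
  rewrite big_nil; under eq_fun do rewrite big_nil; exact: cvg_cst.
rewrite big_cons; under eq_fun do rewrite big_cons.
by case: ifP => // Pi; exact: (cvgD (fl i Pi) IH).
Qed.

(** * Continuous partial derivatives imply differentiability *)

Section RowNorm.
Variables (R : realType) (n : nat).
Local Notation rV := 'rV[R]_n.

Lemma coord_le_norm (v : rV) i : `|v 0 i| <= `|v|.
Proof.
rewrite [leRHS]/Num.Def.normr /= mx_normrE.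
by apply: (le_trans _ (le_bigmax _ _ (ord0, i))) => //=.
Qed.

Lemma norm_lt_coord (v : rV) r : 0 < r -> (forall i, `|v 0 i| < r) -> `|v| < r.
Proof.
move=> r0 H; rewrite [ltLHS]/Num.Def.normr /= mx_normrE.
by apply/bigmax_ltP; split=> // -[a i] _ /=; rewrite (ord1 a).
Qed.

Lemma norm_le_coord (v : rV) r : 0 <= r -> (forall i, `|v 0 i| <= r) -> `|v| <= r.
Proof.
move=> r0 H; rewrite [leLHS]/Num.Def.normr /= mx_normrE.
by apply: bigmax_le => // -[a i] _ /=; rewrite (ord1 a).
Qed.

Lemma ball_coordP (x y : rV) r : 0 < r ->
  ball x r y <-> forall i, `|x 0 i - y 0 i| < r.
Proof.
move=> r0; rewrite -ball_normE /ball_ /=; split=> [H i|H].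
  by apply: le_lt_trans H; have := coord_le_norm (x - y) i; rewrite !mxE.
by apply: norm_lt_coord => // i; rewrite !mxE.
Qed.

Lemma coord_cvg (x : rV) i : (fun y : rV => y 0 i) @ x --> x 0 i.
Proof. exact: coord_continuous. Qed.

Lemma nbhs_row_ball (x : rV) (A : set rV) :
  nbhs x A <-> exists2 r, 0 < r & ball x r `<=` A.
Proof. by split=> [/nbhs_ballP|H]; [|apply/nbhs_ballP]. Qed.

Lemma row_cvg (T : Type) (F : set_system T) {FF : Filter F} (f : T -> rV) (l : rV) :
  (forall i, (fun t => f t 0 i) @ F --> l 0 i) -> f @ F --> l.
Proof.
move=> fl; apply/cvg_ballP => r r0.
have H : \forall t \near F, forall i, `|l 0 i - f t 0 i| < r.
  by apply: filter_forall => i; have /cvgrPdist_lt := fl i; exact.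
by apply: filterS H => t /(ball_coordP _ _ r0).
Qed.

Definition lin_form (c : 'I_n -> R) (h : rV) : R := \sum_i h 0 i * c i.

Fact lin_form_is_linear c : linear (lin_form c : rV -> R^o).
Proof.
move=> a u v; rewrite /lin_form scaler_sumr -big_split /=; apply: eq_bigr => i _.
by rewrite !mxE mulrDl -mulrA.
Qed.
HB.instance Definition _ c :=
  GRing.isLinear.Build R rV R^o _ (lin_form c) (lin_form_is_linear c).

Lemma lin_form_continuous c : continuous (lin_form c).
Proof.
move=> x; apply: (@cvg_sumr _ _ (nbhs x)) => i _.
exact: (cvgM (@coord_cvg x i) (@cst_continuous _ _ (c i) x)).
Qed.

(** The points [x + row_trunc h k] lead from [x] to [x + h] by changing one coordinate at a time; in
    the maximum norm this path does not leave the ball of radius [|h|]. *)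
Definition row_trunc (h : rV) k : rV := \row_j (if (j < k)%N then h 0 j else 0).

Lemma row_trunc0 h : row_trunc h 0 = 0.
Proof. by apply/rowP => j; rewrite !mxE ltn0. Qed.

Lemma row_truncn h : row_trunc h n = h.
Proof. by apply/rowP => j; rewrite !mxE ltn_ord. Qed.

Lemma row_truncS h (k : 'I_n) :
  row_trunc h k.+1 = row_trunc h k + h 0 k *: delta_mx 0 k.
Proof.
apply/rowP => j; rewrite !mxE eqxx /= ltnS leq_eqVlt.
have [->|jk] := eqVneq j k; first by rewrite eqxx ltnn add0r mulr1.
by rewrite (inj_eq val_inj) (negbTE jk) /= mulr0 addr0.
Qed.

Lemma row_trunc_norm (h : rV) (k : 'I_n) (s : R) : 0 <= s <= 1 ->
  `|row_trunc h k + (s * h 0 k) *: delta_mx 0 k| <= `|h|.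
Proof.
move=> /andP[s0 s1]; apply: norm_le_coord => // j; rewrite !mxE eqxx /=.
have [->|jk] := eqVneq j k.
  rewrite ltnn add0r mulr1 normrM ger0_norm //.
  by apply: le_trans (coord_le_norm h k); rewrite ler_piMl.
by rewrite mulr0 addr0; case: ifP => _; rewrite ?normr0 // coord_le_norm.
Qed.

Lemma row_trunc_ball (x h : rV) (r : R) (k : 'I_n) (s : R) : `|h| < r -> 0 <= s <= 1 ->
  ball x r (x + row_trunc h k + (s * h 0 k) *: delta_mx 0 k).
Proof.
move=> hr s01; rewrite -ball_normE /ball_ /= -addrA opprD addNKr normrN.
exact: le_lt_trans (row_trunc_norm h k s01) hr.
Qed.

Lemma row_telescope (F : rV -> R) (x h : rV) : F (x + h) - F x =
  \sum_(k < n) (F (x + row_trunc h k.+1) - F (x + row_trunc h k)).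
Proof.
rewrite -(big_mkord predT (fun k => F (x + row_trunc h k.+1) - F (x + row_trunc h k))).
by rewrite telescope_sumr // row_truncn row_trunc0 addr0.
Qed.

Local Notation e i := (delta_mx 0 i : rV).

Lemma contin_near (W : set rV) (F : rV -> R) x r : contin W F -> W x -> 0 < r ->
  \forall y \near x, `|F y - F x| <= r.
Proof.
move=> cF Wx r0; have /cvgrPdist_le /(_ r r0) := cF x Wx.
by apply: filterS => y; rewrite distrC.
Qed.

(** Each coordinate step of the telescoped difference is a mean value, and continuity of the partial
    derivatives replaces it by the value at [x] up to [r]. *)
Lemma C1_expansion (W : set rV) (F : rV -> R) x : open W -> W x -> Ck 1 W F ->
  (F : rV -> R^o) \o shift x =
  cst (F x) + (lin_form (fun i => 'D_(e i) F x) : rV -> R^o) +o_ (0 : rV) id.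
Proof.
move=> oW Wx /CkE [cF dF]; apply/eqaddoP => eps eps0.
(* Dividing by [n.+1] keeps the denominator nonzero when [n] is 0; the surplus summand is discarded
   below. *)
pose r := eps / n.+1%:R.
have r0 : 0 < r by rewrite divr_gt0.
have : \forall y \near x, W y /\ forall i, `|'D_(e i) F y - 'D_(e i) F x| <= r.
  apply: (@filterI _ (nbhs x)); first exact: near_open.
  by apply: (@filter_forall _ _ _ (nbhs x)) => i; have [_ [c _]] := dF i; apply: contin_near c _ _.
move=> /nbhs_row_ball [d d0 dH].
near=> h.
have hd : `|h| < d.
  near: h; apply/nbhs_row_ball; exists d => //= y.
  by rewrite -ball_normE /ball_ /= sub0r normrN.
have inb k s := @row_trunc_ball x h d k s hd.
rewrite /= -![(_ + _ : _ -> _) _]/(_ + _) -![(- _ : _ -> _) _]/(- _) /=.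
rewrite -![(_ + _ : _ -> _) _]/(_ + _) /cst /=.
have -> : F (h + x) - (F x + lin_form (fun i => 'D_(e i) F x) h) =
  \sum_(k < n) (F (x + row_trunc h k.+1) - F (x + row_trunc h k) - h 0 k * 'D_(e k) F x).
  rewrite sumrB -/(lin_form _ _) -row_telescope.
  by rewrite opprD addrA [h + x]addrC.
apply: le_trans (ler_norm_sum _ _ _) _.
have -> : eps * `|h| = \sum_(k < n.+1) (r * `|h|).
  rewrite sumr_const card_ord -mulr_natl mulrA; congr (_ * _).
  by rewrite /r mulrC divfK // pnatr_eq0.
rewrite big_ord_recr /= -[leLHS]addr0; apply: lerD; last by rewrite mulr_ge0 // ltW.
apply: ler_sum => k _.
rewrite row_truncS addrA.
have [s s01|s [s01 ->]] := @line_MVT R _ F (x + row_trunc h k) (e k) (h 0 k).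
  have [dk _] := dF k; apply: dk.
  by have [] := dH _ (inb k s s01).
rewrite -mulrBr normrM mulrC; apply: ler_pM => //; last exact: coord_le_norm.
by have [_] := dH _ (inb k s s01); apply.
Unshelve. all: by end_near. Qed.

Lemma C1_differentiable (W : set rV) (F : rV -> R) x : open W -> W x -> Ck 1 W F ->
  differentiable F x.
Proof.
move=> oW Wx CF; have E := C1_expansion oW Wx CF.
apply/diff_locallyP.
rewrite (@diff_unique _ _ R^o F (lin_form (fun i => 'D_(e i) F x)) x _ E); last first.
  exact: lin_form_continuous.
by split; [exact: lin_form_continuous|].
Qed.

Lemma C1_derive (W : set rV) (F : rV -> R) x v : open W -> W x -> Ck 1 W F ->
  'D_v F x = \sum_i v 0 i * 'D_(e i) F x.
Proof.
move=> oW Wx CF; have E := C1_expansion oW Wx CF.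
rewrite deriveE; last exact: C1_differentiable CF.
rewrite (@diff_unique _ _ R^o F (lin_form (fun i => 'D_(e i) F x)) x _ E) //.
exact: lin_form_continuous.
Qed.

End RowNorm.

(** * Chain rule, smooth functions and symmetry of second derivatives *)

Section Chain.
Variable R : realType.
Local Notation e i := (delta_mx 0 i).

Lemma derive_line (V V' : normedModType R) (f : V -> V') (x v : V) :
  'D_v f x = 'D_1 (fun h : R => f (h *: v + x)) 0.
Proof.
rewrite /derive; set g1 := fun h => h^-1 *: _; set g2 := fun h => h^-1 *: _.
suff -> : g1 = g2 by [].
by rewrite funeqE /g1 /g2 => h /=; rewrite addr0 scale0r add0r [_%:A]mulr1.
Qed.

Lemma chain1 (V : normedModType R) (g : R -> R) (f : V -> R) (x v : V) (dg : R) :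
  is_derive (f x) 1 g dg -> derivable f x v ->
  is_derive x v (g \o f) (dg * 'D_v f x).
Proof.
move=> gd fd.
pose ga := fun h : R => f (h *: v + x).
have E : ga 0 = f x by rewrite /ga scale0r add0r.
have dga : derivable ga 0 1 by apply/(derivable1P f x v).1.
have gd' : derivable g (ga 0) 1 by rewrite E; case: gd.
have d1 := (derivable1_diffP _ _).1 dga.
have d2 := (derivable1_diffP _ _).1 gd'.
have D := @derive1_comp _ ga g 0 dga gd'.
split.
  apply/derivable1P/derivable1_diffP.
  exact: (@differentiable_comp _ _ _ _ ga g 0 d1 d2).
rewrite derive_line -derive1E [LHS]D.
by rewrite !derive1E E (@derive_val _ _ _ _ _ _ _ gd) -derive_line.
Qed.

(** [phi] is derivable in the single direction [v] only; composing it with the line through [x]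
    gives a function of one variable, where derivable and differentiable coincide. *)
Lemma chain_rule n m (Y : set 'rV[R]_m) (F : 'rV[R]_m -> R) (phi : 'rV[R]_n -> 'rV[R]_m)
    (x v : 'rV[R]_n) : open Y -> Ck 1 Y F -> Y (phi x) ->
  (forall a, derivable (fun y => phi y 0 a) x v) ->
  is_derive x v (F \o phi)
    (\sum_a 'D_v (fun y => phi y 0 a) x * 'D_(e a) F (phi x)).
Proof.
move=> oY CF Yx dphi.
have dp : derivable phi x v.
  by apply/derivable_mxP => i a; rewrite (ord1 i).
pose ga := fun h : R => phi (h *: v + x).
have E : ga 0 = phi x by rewrite /ga scale0r add0r.
have dga : differentiable ga 0.
  by apply/derivable1_diffP/(derivable1P phi x v).1.
have dF : differentiable F (ga 0) by rewrite E; exact: (C1_differentiable oY Yx CF).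
have dc : differentiable (F \o ga) 0 by apply: differentiable_comp.
split; first by apply/derivable1P/derivable1_diffP.
rewrite derive_line (deriveE _ dc) diff_comp //=.
rewrite -[X in 'd F _ X](deriveE (1 : R) dga) -(deriveE _ dF).
rewrite E (C1_derive _ oY Yx CF); apply: eq_bigr => a _.
by rewrite -derive_line derive_mx // mxE.
Qed.

Section Comp.
Variables (n m : nat) (X : set 'rV[R]_n) (Y : set 'rV[R]_m).
Variables (P0 : ('rV[R]_n -> R) -> Prop) (Q0 : ('rV[R]_m -> R) -> Prop).
Variable phi : 'rV[R]_n -> 'rV[R]_m.
Hypothesis (oX : open X) (oY : open Y).
Hypothesis (algP : function_algebra X P0).
Hypothesis Qcont : forall F, Q0 F -> contin Y F.
Hypothesis QP : forall F, Q0 F -> P0 (F \o phi).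
Hypothesis phiXY : forall x, X x -> Y (phi x).
Hypothesis phi_der : forall a i x, X x ->
  derivable (fun y => phi y 0 a) x (e i).
Hypothesis phi_smooth : forall a i k,
  Dk P0 k X (fun x => 'D_(e i) (fun y => phi y 0 a) x).

(** Only the partial derivatives of [phi], not its components, are asked to satisfy [P0]: these are
    the factors that the chain rule produces. *)
Lemma Dk_comp k F : Dk Q0 k Y F -> Dk P0 k X (F \o phi).
Proof.
elim: k F => [|k IH] F DF; first by case: DF => QF _; split=> //; exact: QP.
have CF : Ck 1 Y F.
  apply/CkE; apply: Dk_le (ltn0Sn k) _; apply: Dk_sub_set DF => //.
split=> [|i]; first by case: DF => QF _; exact: QP.
have ch x : X x -> _ := fun Xx => chain_rule oY CF (@phiXY x Xx) (fun a => @phi_der a i x Xx).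
split=> [x Xx|]; first by have [] := ch x Xx.
apply: (Dk_ext' oX algP (F := fun x => \sum_a 'D_(e i) (fun y => phi y 0 a) x *
    'D_(e a) F (phi x))) => [x Xx|].
  by have [_ ->] := ch x Xx.
apply: Dk_sum => // a _; apply: Dk_mul => //.
by apply: (IH (fun y => 'D_(e a) F y)); exact: Dk_der.
Qed.

End Comp.

Definition Cinf n (W : set 'rV[R]_n) F := forall k, Ck k W F.

Section Cinf.
Variable n : nat.
Implicit Types (W : set 'rV[R]_n) (F G : 'rV[R]_n -> R).

Lemma CinfE W F : Cinf W F <-> forall k, Dk (contin W) k W F.
Proof. by split=> H k; apply/CkE. Qed.

Lemma Cinf_contin W F : Cinf W F -> contin W F.
Proof. by move=> /(_ 0)[]. Qed.

Lemma Cinf_derivable W F i x : Cinf W F -> W x -> derivable F x (e i).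
Proof. by move=> /(_ 1)[_ /(_ i)[d _]]; exact: d. Qed.

Lemma Cinf_der W F i : Cinf W F -> Cinf W (fun x => 'D_(e i) F x).
Proof. by move=> CF k; case: (CF k.+1) => _ /(_ i)[_ H]; exact: H. Qed.

Lemma CinfI W F : contin W F -> (forall i x, W x -> derivable F x (e i)) ->
  (forall i, Cinf W (fun x => 'D_(e i) F x)) -> Cinf W F.
Proof. by move=> c d D [|k]; split=> // i; split=> [x Wx|]; [exact: d|exact: D]. Qed.

Lemma Cinf_ext W F G : open W -> (forall x, W x -> F x = G x) -> Cinf W F -> Cinf W G.
Proof.
move=> oW FG /CinfE H; apply/CinfE => k.
exact: (Dk_ext oW (contin_algebra oW) FG).
Qed.

Lemma Cinf_subset V W F : V `<=` W -> Cinf W F -> Cinf V F.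
Proof.
move=> VW /CinfE H; apply/CinfE => k; apply: Dk_sub_set (H k) => // G cG x /VW.
exact: cG.
Qed.

Lemma Cinf_cst W a : open W -> Cinf W (cst a).
Proof. by move=> oW; apply/CinfE => k; apply: Dk_cst => //; exact: contin_algebra. Qed.

Lemma Cinf_add W F G : open W -> Cinf W F -> Cinf W G -> Cinf W (fun x => F x + G x).
Proof.
move=> oW /CinfE CF /CinfE CG; apply/CinfE => k.
by apply: Dk_add => //; exact: contin_algebra.
Qed.

Lemma Cinf_mul W F G : open W -> Cinf W F -> Cinf W G -> Cinf W (fun x => F x * G x).
Proof.
move=> oW /CinfE CF /CinfE CG; apply/CinfE => k.
by apply: Dk_mul => //; exact: contin_algebra.
Qed.

Lemma Cinf_opp W F : open W -> Cinf W F -> Cinf W (fun x => - F x).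
Proof.
move=> oW /CinfE CF; apply/CinfE => k.
by apply: Dk_opp => //; exact: contin_algebra.
Qed.

Lemma Cinf_sub W F G : open W -> Cinf W F -> Cinf W G -> Cinf W (fun x => F x - G x).
Proof. by move=> oW CF CG; apply: Cinf_add => //; exact: Cinf_opp. Qed.

Lemma Cinf_sum W (I : Type) (r : seq I) (P : pred I) (F : I -> 'rV[R]_n -> R) : open W ->
  (forall i, P i -> Cinf W (F i)) -> Cinf W (fun x => \sum_(i <- r | P i) F i x).
Proof.
move=> oW CF; apply/CinfE => k; apply: Dk_sum => //; first exact: contin_algebra.
by move=> i /CF /CinfE.
Qed.

Lemma derive_coord (x : 'rV[R]_n) a i :
  is_derive x (e i) (fun y : 'rV[R]_n => y 0 a) (i == a)%:R.
Proof.
have E (h : R) : ((fun y : 'rV[R]_n => y 0 a) \o shift x) (h *: e i) - x 0 a =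
    h * (i == a)%:R.
  by rewrite /= !mxE eqxx /= [a == i]eq_sym addrK.
suff : (fun h : R => h^-1 *: (((fun y : 'rV[R]_n => y 0 a) \o shift x) (h *: e i)
    - x 0 a)) @ 0^' --> ((i == a)%:R : R).
  by move=> H; split; [apply/cvg_ex; eexists; exact: H|exact: cvg_lim H].
apply: cvg_near_cst.
near=> h; rewrite E /GRing.scale /= mulKf //.
by near: h; exact: nbhs_dnbhs_neq.
Unshelve. all: by end_near. Qed.

Lemma Cinf_coord W a : open W -> Cinf W (fun x => x 0 a).
Proof.
move=> oW; apply: CinfI => [x _|i x _|i]; first exact: coord_cvg.
  by have [] := derive_coord x a i.
apply: Cinf_ext (Cinf_cst (i == a)%:R oW) => // x _.
by have [_ ->] := derive_coord x a i.
Qed.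

Lemma Cinf_comp m W (Y : set 'rV[R]_m) (F : 'rV[R]_m -> R) (phi : 'rV[R]_n -> 'rV[R]_m) :
  open W -> open Y -> (forall x, W x -> Y (phi x)) ->
  (forall a, Cinf W (fun x => phi x 0 a)) -> Cinf Y F -> Cinf W (F \o phi).
Proof.
move=> oW oY WY Cphi CF; apply/CinfE => k; have /CkE CFk := CF k.
apply: (Dk_comp oW oY (contin_algebra oW) _ _ WY _ _ CFk) => //.
- move=> G cG x Wx; apply: (@cvg_comp _ _ _ _ _ (nbhs x) (nbhs (phi x)) _ _ (cG _ (WY _ Wx))).
  by apply: (@row_cvg _ _ _ (nbhs x)) => i; exact: (Cinf_contin (Cphi i) Wx).
- by move=> a i x Wx; exact: (Cinf_derivable (Cphi a) Wx).
- move=> a i l; exact: ((CinfE _ _).1 (Cinf_der i (Cphi a)) l).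
Qed.

(** The exponent is generalised in the induction on the order, since each derivative lowers it by
    one. *)
Lemma Cinf_powR W F a : open W -> (forall x, W x -> 0 < F x) -> Cinf W F ->
  Cinf W (fun x => F x `^ a).
Proof.
move=> oW F0 CF k; apply/CkE; elim: k a => [|k IH] a.
  split=> // x Wx; have [d _] := is_derive1_powR a (F0 _ Wx).
  have c := differentiable_continuous ((derivable1_diffP _ _).1 d).
  exact: (@cvg_comp _ _ _ F (fun u => u `^ a) (nbhs x) (nbhs (F x)) _ (Cinf_contin CF Wx) c).
have ch i x (Wx : W x) :=
  chain1 (is_derive1_powR a (F0 _ Wx)) (Cinf_derivable (i := i) CF Wx).
split.
  by have := IH a; exact: Dk_base.
move=> i; split=> [x Wx|]; first by have [] := ch i x Wx.
apply: (Dk_ext' oW (contin_algebra oW)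
  (F := fun x => (a * F x `^ (a - 1)) * 'D_(e i) F x)) => [x Wx|].
  by have [_ ->] := ch i x Wx.
apply: Dk_mul => //; first exact: contin_algebra.
  by apply: Dk_scale => //; exact: contin_algebra.
exact: ((CinfE _ _).1 (Cinf_der i CF) k).
Qed.

Lemma Cinf_inv W F : open W -> (forall x, W x -> F x != 0) -> Cinf W F ->
  Cinf W (fun x => (F x)^-1).
Proof.
move=> oW F0 CF.
have CFF := Cinf_mul oW CF CF.
have p x : W x -> 0 < F x * F x by move=> Wx; rewrite -expr2 exprn_even_gt0 // F0.
apply: Cinf_ext (Cinf_mul oW CF (Cinf_powR (-1) oW p CFF)) => // x Wx.
by rewrite powRN powRr1 ?ltW ?p // invfM mulrA divff ?F0 // mul1r.
Qed.

(** A power of the absolute value becomes a power of a square, which is smooth and positive away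
    from zero, so that signs need not be distinguished. *)
Lemma normr_powR_sqr (x a : R) : `|x| `^ a = (x * x) `^ (a / 2).
Proof.
rewrite -expr2 -[x ^+ 2]ger0_norm ?sqr_ge0 // normrX -powR_mulrn // -powRrM.
by rewrite mulrCA divff ?mulr1 // pnatr_eq0.
Qed.

Lemma Cinf_normr_powR W F a : open W -> (forall x, W x -> F x != 0) -> Cinf W F ->
  Cinf W (fun x => `|F x| `^ a).
Proof.
move=> oW F0 CF; have CFF := Cinf_mul oW CF CF.
have p x : W x -> 0 < F x * F x by move=> Wx; rewrite -expr2 exprn_even_gt0 // F0.
by apply: Cinf_ext (Cinf_powR (a / 2) oW p CFF) => // x Wx; rewrite normr_powR_sqr.
Qed.

End Cinf.

(** Mean value theorem first in direction [i], for the increment of [F] by [t *: e j], then in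
    direction [j], for the partial derivative. The left side is symmetric in [i] and [j], which is
    what gives [clairaut]. *)
Lemma second_difference n (W : set 'rV[R]_n) (F : 'rV[R]_n -> R) x (i j : 'I_n) (t d : R) :
  open W -> Ck 2 W F -> ball x d `<=` W -> 0 < t -> 2 * t < d ->
  exists y, ball x d y /\
    F (x + t *: e i + t *: e j) - F (x + t *: e i)
    - F (x + t *: e j) + F x =
    t * (t * 'D_(e j) (fun z => 'D_(e i) F z) y).
Proof.
move=> oW [_ CF] dW t0 td.
have inb (s r : R) : 0 <= s <= 1 -> 0 <= r <= 1 ->
    ball x d (x + (s * t) *: e i + (r * t) *: e j).
  move=> /andP[s0 s1] /andP[r0 r1]; apply/ball_coordP; first by lra.
  move=> k; rewrite !mxE !eqxx /=.
  have : 0 <= s * t * (k == i)%:R <= t.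
    by case: eqP => _; rewrite ?mulr1 ?mulr0 ?mulr_ge0 ?ler_piMl ?lexx ?(ltW t0).
  have : 0 <= r * t * (k == j)%:R <= t.
    by case: eqP => _; rewrite ?mulr1 ?mulr0 ?mulr_ge0 ?ler_piMl ?lexx ?(ltW t0).
  move=> /andP[? ?] /andP[? ?]; rewrite distrC ger0_norm; lra.
have [dF [_ CF2]] := CF i; have [dG _] := CF2 j.
pose G z := F (z + t *: e j) - F z.
have z01 : 0 <= (0:R) <= 1 by rewrite lexx ler01.
have o01 : 0 <= (1:R) <= 1 by rewrite lexx ler01.
have dsh s : 0 <= s <= 1 -> is_derive (x + (s * t) *: e i) (e i)
    (fun z => F (z + t *: e j))
    ('D_(e i) F (x + (s * t) *: e i + t *: e j)).
  move=> s01; have : derivable F (x + (s * t) *: e i + t *: e j) (e i).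
    by apply: dF; apply: dW; have := inb s 1 s01 o01; rewrite mul1r.
  have E : (fun h : R => h^-1 *: (((fun z => F (z + t *: e j)) \o shift
      (x + (s * t) *: e i)) (h *: e i) -
      F (x + (s * t) *: e i + t *: e j))) = (fun h : R => h^-1 *: ((F \o shift
      (x + (s * t) *: e i + t *: e j)) (h *: e i) -
      F (x + (s * t) *: e i + t *: e j))).
    by apply/funext => h /=; rewrite -!addrA.
  by move=> dd; split; rewrite /derivable /derive E.
have d0 s : 0 <= s <= 1 -> derivable F (x + (s * t) *: e i) (e i).
  move=> s01; apply: dF; apply: dW; have := inb s 0 s01 z01.
  by rewrite mul0r scale0r addr0.
have [s s01|s [s01 Es]] := @line_MVT R _ G x (e i) t.
  by apply: derivableB; [have [] := dsh s s01|exact: d0].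
have [r r01|r [r01 Er]] := @line_MVT R _ (fun z => 'D_(e i) F z)
    (x + (s * t) *: e i) (e j) t.
  by apply: dG; apply: dW; exact: inb.
exists (x + (s * t) *: e i + (r * t) *: e j); split; first exact: inb.
rewrite -Er; move: Es; rewrite deriveB; last 2 first.
- by have [] := dsh s s01.
- exact: d0.
have [_ ->] := dsh s s01.
rewrite /G => <-; ring.
Qed.

Lemma clairaut n (W : set 'rV[R]_n) (F : 'rV[R]_n -> R) x (i j : 'I_n) :
  open W -> W x -> Ck 2 W F ->
  'D_(e i) (fun y => 'D_(e j) F y) x =
  'D_(e j) (fun y => 'D_(e i) F y) x.
Proof.
move=> oW Wx CF.
set A := 'D__ _ _; set B := 'D__ _ _.
apply/eqP; rewrite -subr_eq0 -normr_le0; apply/ler_addgt0Pr => eps eps0.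
rewrite add0r.
have c i' j' : contin W (fun y => 'D_(e i') (fun y => 'D_(e j') F y) y).
  by have [_ /(_ j')[_ [_ /(_ i')[_ [cc _]]]]] := CF.
have e2 : 0 < eps / 2 by lra.
have H := near_and (near_open oW Wx)
  (near_and (contin_near (c i j) Wx e2) (contin_near (c j i) Wx e2)).
have [d d0 dH] := (nbhs_row_ball _ _).1 H.
have t0 : 0 < d / 4 by lra.
have td : 2 * (d / 4) < d by lra.
have dW : ball x d `<=` W by move=> y /dH[].
have [y [/dH[_ [_ y2]] Ey]] := second_difference i j oW CF dW t0 td.
have [z [/dH[_ [z1 _]] Ez]] := second_difference j i oW CF dW t0 td.
have E : 'D_(e i) (fun y => 'D_(e j) F y) z =
         'D_(e j) (fun y => 'D_(e i) F y) y.
  have EE := esym (etrans (esym Ey) (etrans _ Ez)).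
  apply: (mulfI (lt0r_neq0 t0)); apply: (mulfI (lt0r_neq0 t0)); apply: EE.
  by rewrite (addrAC x); congr (_ + _); exact: addrAC.
rewrite -E in y2.
rewrite distrC in z1; rewrite (splitr eps); exact: le_trans (ler_distD _ _ _) (lerD z1 y2).
Qed.

End Chain.

(** * Seeley's extension across a hyperplane *)

Section SeeleyCoefficients.
Variable R : realType.

Lemma ratio_decay (u : nat -> R) : (forall k, 0 <= u k) ->
  (exists K, forall k, (K <= k)%N -> u k.+1 <= u k / 2) ->
  exists2 C, 0 <= C & forall k, u k <= C * 2^-1 ^+ k.
Proof.
move=> u0 [K uK]; pose C := \sum_(i < K.+1) u i * 2 ^+ i.
have C0 : 0 <= C by apply: sumr_ge0 => i _; rewrite mulr_ge0 ?exprn_ge0.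
exists C => //.
have small k : (k <= K)%N -> u k <= C * 2^-1 ^+ k.
  move=> kK; rewrite exprVn ler_pdivlMr ?exprn_gt0 //.
  have kK' : (k < K.+1)%N by [].
  rewrite /C (bigD1 (Ordinal kK')) //= lerDl.
  by apply: sumr_ge0 => i _; rewrite mulr_ge0 ?exprn_ge0.
elim=> [|k IH]; first exact: small.
have [kK|Kk] := leqP k.+1 K; first exact: small.
apply: le_trans (uK k _) _; first by rewrite -ltnS.
by rewrite exprSr mulrA ler_pM2r // invr_gt0.
Qed.

(** Up to the sign (-1)^k this is the q-Pochhammer symbol (2; 2)_k. It grows like 2^(k(k+1)/2),
    faster than every 2^(k M), whence the decay below. *)
Definition qpoch k : R := \prod_(i < k) (2 ^+ i.+1 - 1).

Lemma exp2_ge1 k : 1 <= 2 ^+ k :> R.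
Proof. by rewrite exprn_ege1 // ler1n. Qed.

Lemma exp2S_gt1 k : 0 < 2 ^+ k.+1 - 1 :> R.
Proof. have := exp2_ge1 k; rewrite exprS; lra. Qed.

Lemma qpochS k : qpoch k.+1 = qpoch k * (2 ^+ k.+1 - 1).
Proof. by rewrite /qpoch big_ord_recr. Qed.

Lemma qpoch_gt0 k : 0 < qpoch k.
Proof. by apply: prodr_gt0 => i _; exact: exp2S_gt1. Qed.

Lemma qpoch_decay M : exists2 C, 0 <= C &
  forall k, 2 ^+ (k * M) / qpoch k <= C * 2^-1 ^+ k.
Proof.
apply: ratio_decay => [k|]; first by rewrite divr_ge0 ?exprn_ge0 ?ltW ?qpoch_gt0.
(* The ratio of consecutive terms is 2^M / (2^(k+1) - 1), which is at most 1/2 once k > M. *)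
exists M.+1 => k Mk; rewrite mulSn exprD qpochS invfM [2 ^+ M * _]mulrC mulrACA.
apply: ler_wpM2l; first by rewrite divr_ge0 ?exprn_ge0 ?ltW ?qpoch_gt0.
rewrite ler_pdivrMr ?exp2S_gt1 // ler_pdivlMl //.
have : 2 ^+ M.+1 <= 2 ^+ k :> R by rewrite ler_eXn2l // ltr1n.
have := exp2_ge1 k; rewrite !exprS; lra.
Qed.

Lemma half_lt1 : `|2^-1 : R| < 1.
Proof. by rewrite ger0_norm; lra. Qed.

Lemma series_recr (u : nat -> R) k : series u k.+1 = series u k + u k.
Proof. by rewrite /series /= big_nat_recr. Qed.

Lemma series_0 (u : nat -> R) : series u 0 = 0.
Proof. by rewrite /series /= big_geq. Qed.

(* Up to the sign (-1)^m, [theta m k] is b_k (- 2^k)^m - b_k (- 2^k)^m.+1 for the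
   unnormalized Seeley coefficients b_k = [seeley0 k]: that [theta m] sums to 0
   makes all moments of b equal. *)
Definition theta m k : R := (-1) ^+ k * 2 ^+ (k * m.+1) / qpoch k.

Lemma theta_sum0 K : series (theta 0) K.+1 = (-1) ^+ K / qpoch K.
Proof.
elim: K => [|K IH].
  by rewrite series_recr series_0 add0r /theta mul0n !expr0 mul1r.
rewrite series_recr IH /theta muln1 qpochS.
have q0 := lt0r_neq0 (qpoch_gt0 K); have e0 := lt0r_neq0 (exp2S_gt1 K).
rewrite [(-1) ^+ K.+1]exprS; field; exact/andP.
Qed.

(** In the limit, the sum of [theta m.+1] is 1 - 2^(m+1) times that of [theta m]; hence all of them
    vanish with the first, whose partial sums are explicit. *)
Lemma theta_sumS m K :
  series (theta m.+1) K.+1 = series (theta m) K.+1 - 2 ^+ m.+1 * series (theta m) K.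
Proof.
elim: K => [|K IH].
  by rewrite !series_recr !series_0 mulr0 subr0 !add0r /theta !mul0n.
rewrite (series_recr _ K.+1) IH (series_recr (theta m) K.+1) (series_recr (theta m) K).
rewrite /theta qpochS.
have q0 := lt0r_neq0 (qpoch_gt0 K); have e0 := lt0r_neq0 (exp2S_gt1 K).
have E1 : 2 ^+ (K.+1 * m.+2) = 2 ^+ (K * m.+1) * 2 ^+ m.+1 * 2 ^+ K.+1 :> R.
  by rewrite -!exprD; congr (_ ^+ _); ring.
have E2 : 2 ^+ (K.+1 * m.+1) = 2 ^+ (K * m.+1) * 2 ^+ m.+1 :> R.
  by rewrite -!exprD; congr (_ ^+ _); ring.
rewrite E1 E2 [(-1) ^+ K.+1]exprS; field; exact/andP.
Qed.

Lemma cvg_shiftS_R (u : nat -> R) (l : R) : (u \o S) @ \oo --> l -> u @ \oo --> l.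
Proof. by move=> H; rewrite -(cvg_shiftS u (nbhs l)). Qed.

Lemma theta_series m : series (theta m) @ \oo --> (0 : R).
Proof.
elim: m => [|m IH].
  have [C C0 HC] := qpoch_decay 0.
  apply: cvg_shiftS_R; apply: (@squeeze_cvgr _ _ _ _ (fun k => - (C * 2^-1 ^+ k))
      (fun k => C * 2^-1 ^+ k)).
  - near=> k; rewrite /= theta_sum0 -ler_norml normrM normrX normrN1 expr1n mul1r.
    rewrite ger0_norm; last by rewrite invr_ge0 ltW ?qpoch_gt0.
    by have := HC k; rewrite muln0 expr0 mul1r.
  - rewrite -[X in _ --> X]oppr0; apply: cvgN.
    by apply: (@cvg_geometric R C 2^-1); exact: half_lt1.
  - by apply: (@cvg_geometric R C 2^-1); exact: half_lt1.
apply: cvg_shiftS_R.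
have -> : series (theta m.+1) \o S =
    (fun K => series (theta m) K.+1 - 2 ^+ m.+1 * series (theta m) K).
  by apply/funext => K /=; exact: theta_sumS.
have -> : (0 : R) = 0 - 2 ^+ m.+1 * 0 by rewrite mulr0 subr0.
apply: cvgB; first by rewrite (cvg_shiftS (series (theta m)) (nbhs (0 : R))).
by apply: cvgM => //; exact: cvg_cst.
Unshelve. all: by end_near. Qed.

(** For finitely many nodes -2^0, ..., -2^N the moment equations are solved by the values at 1 of
    the Lagrange polynomials. Up to a factor independent of [k], [seeley0 k] is the limit of the
    k-th of these values as N grows. *)
Definition seeley0 k : R := (- 2) ^+ k / (qpoch k * (2 ^+ k + 1)).

Lemma seeley0_norm k : `|seeley0 k| = 2 ^+ k / (qpoch k * (2 ^+ k + 1)).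
Proof.
have q0 := qpoch_gt0 k; have e1 := exp2_ge1 k.
have p0 : 0 < 2 ^+ k + 1 :> R by lra.
rewrite /seeley0 normrM normrX normrN normr_nat [X in _ * X]gtr0_norm //.
by rewrite invr_gt0 mulr_gt0.
Qed.

Lemma seeley0_decay M : exists2 C, 0 <= C &
  forall k, `|seeley0 k| * 2 ^+ (k * M) <= C * 2^-1 ^+ k.
Proof.
have [C C0 HC] := qpoch_decay M.+1; exists C => // k; apply: le_trans (HC k).
have q0 := qpoch_gt0 k; have e1 := exp2_ge1 k.
have p0 : 0 < 2 ^+ k + 1 :> R by lra.
rewrite seeley0_norm.
rewrite mulnS exprD mulrAC ler_pdivrMr ?mulr_gt0 // mulrA divfK ?gt_eqF //.
by rewrite ler_peMr; [|rewrite mulr_ge0 ?exprn_ge0|lra].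
Qed.

Lemma decay_cvg (u : nat -> R) C : (forall k, `|u k| <= C * 2^-1 ^+ k) ->
  cvgn (series u).
Proof.
move=> uC; apply: (@normed_cvg _ R^o).
have C0 : 0 <= C by have := uC 0; rewrite expr0 mulr1; apply: le_trans.
apply: (@series_le_cvg _ _ (geometric C 2^-1)) => [k|k|k|].
- by rewrite normr_ge0.
- by rewrite /= mulr_ge0 ?exprn_ge0 ?invr_ge0.
- exact: uC.
- exact: is_cvg_geometric_series half_lt1.
Qed.

Lemma norm_dilation k m : `|(- 2 ^+ k) ^+ m| = 2 ^+ (k * m) :> R.
Proof. by rewrite normrX normrN normrX normr_nat -exprM. Qed.

Lemma seeley0_cvg m : cvgn (series (fun k => seeley0 k * (- 2 ^+ k) ^+ m)).
Proof.
have [C C0 HC] := seeley0_decay m; apply: (@decay_cvg _ C) => k.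
by rewrite normrM norm_dilation; exact: HC.
Qed.

Lemma seeley0_sum m :
  lim (series (fun k => seeley0 k * (- 2 ^+ k) ^+ m) @ \oo) =
  lim (series seeley0 @ \oo).
Proof.
elim: m => [|m <-]; first by under eq_fun do rewrite expr0 mulr1.
apply/esym/eqP; rewrite -subr_eq0 -lim_seriesB; [|exact: seeley0_cvg|exact: seeley0_cvg].
apply/eqP/cvg_lim => //.
have -> : (fun k => seeley0 k * (- 2 ^+ k) ^+ m) - (fun k => seeley0 k * (- 2 ^+ k) ^+ m.+1) =
    (-1) ^+ m *: theta m.
  apply/funext => k.
  transitivity (seeley0 k * (- 2 ^+ k) ^+ m - seeley0 k * (- 2 ^+ k) ^+ m.+1); first by [].
  transitivity ((-1) ^+ m * theta m k); last by [].
  rewrite /seeley0 /theta.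
  have q0 := lt0r_neq0 (qpoch_gt0 k); have e1 := exp2_ge1 k.
  have p0 : 2 ^+ k + 1 != 0 :> R by apply: lt0r_neq0; lra.
  rewrite [_ ^+ m.+1]exprS mulnS exprD -[(- 2) ^+ k]mulr1 exprNn [(- 2 ^+ k) ^+ m]exprNn.
  rewrite -exprM; field; exact/andP.
rewrite -[X in _ --> X](mulr0 ((-1) ^+ m)).
have -> : series ((-1) ^+ m *: theta m) = (fun n => (-1) ^+ m * series (theta m) n).
  by apply/funext => K; rewrite /series /= mulr_sumr.
by apply: cvgM; [exact: cvg_cst|exact: theta_series].
Qed.

Lemma seeley0_small k : (3 <= k)%N -> 2 * `|seeley0 k.+1| <= `|seeley0 k|.
Proof.
move=> k3; rewrite !seeley0_norm.
have q0 := qpoch_gt0 k; have e1 := exp2_ge1 k; have eS := exp2S_gt1 k.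
have p0 : 0 < 2 ^+ k + 1 :> R by lra.
have p1 : 0 < 2 ^+ k.+1 + 1 :> R by rewrite exprS; lra.
rewrite qpochS.
have E8 : 8 <= 2 ^+ k :> R.
  have -> : 8 = 2 ^+ 3 :> R by ring.
  by rewrite ler_eXn2l // ltr1n.
rewrite mulrA ler_pdivrMr ?mulr_gt0 // mulrAC ler_pdivlMr ?mulr_gt0 //.
move: p0 p1 eS e1 E8; rewrite !exprS; set t := 2 ^+ k => p0 p1 eS e1 E8.
have -> : 2 * (2 * t) * (qpoch k * (t + 1)) = (t * qpoch k) * (4 * (t + 1)) by ring.
have -> : t * (qpoch k * (2 * t - 1) * (2 * t + 1)) =
  (t * qpoch k) * ((2 * t - 1) * (2 * t + 1)) by ring.
apply: ler_wpM2l; [by apply: mulr_ge0; [lra|exact: ltW]|nra].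
Qed.

(** The common value of the moments has to be nonzero in order to be normalised to 1. From index 3
    on the terms at least halve, so the partial sum minus the absolute value of its last term does
    not decrease; after four terms it is 1/2 - 2/3 + 4/15 - 8/189 - 8/189 > 1/100. *)
Lemma seeley0_neq0 : 0 < lim (series seeley0 @ \oo).
Proof.
have cv : cvgn (series seeley0).
  have := @seeley0_cvg 0; by under eq_fun do rewrite expr0 mulr1.
pose c : R := 1 / 100.
have c0 : 0 < c by rewrite /c; lra.
suff H k : c + `|seeley0 (k + 3)%N| <= series seeley0 (k + 4)%N.
  apply: lt_le_trans c0 _; apply: limr_ge => //.
  exists 4%N => // k /= k4; rewrite -(subnK k4); apply: le_trans (H _).
  by rewrite lerDl.
elim: k => [|k IH].
  have E0 : seeley0 0 = 1 / 2 by rewrite /seeley0 /qpoch big_ord0 !expr0; field.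
  have E1 : seeley0 1 = - (2 / 3).
    by rewrite /seeley0 /qpoch !big_ord_recr big_ord0 /= !exprS !expr0; field.
  have E2 : seeley0 2 = 4 / 15.
    by rewrite /seeley0 /qpoch !big_ord_recr big_ord0 /= !exprS !expr0; field.
  have E3 : seeley0 3 = - (8 / 189).
    by rewrite /seeley0 /qpoch !big_ord_recr big_ord0 /= !exprS !expr0; field.
  by rewrite !add0n !series_recr series_0 E0 E1 E2 E3 /c normrN ger0_norm; lra.
have -> : (k.+1 + 4 = (k + 4).+1)%N by [].
have -> : (k.+1 + 3 = (k + 3).+1)%N by [].
rewrite series_recr; have := seeley0_small (leq_addl k 3).
have := ler_norm (- seeley0 (k + 4)%N); rewrite normrN.
by move: IH; rewrite (addnS k 3); lra.
Qed.

Lemma seeley_coefficients : exists a : nat -> R,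
  (forall M, exists2 C, 0 <= C & forall k, `|a k| * 2 ^+ (k * M) <= C * 2^-1 ^+ k) /\
  (forall m, series (fun k => a k * (- 2 ^+ k) ^+ m) @ \oo --> (1 : R)).
Proof.
pose c := lim (series seeley0 @ \oo); have c0 : 0 < c := seeley0_neq0.
exists (fun k => c^-1 * seeley0 k); split=> [M|m].
  have [C C0 HC] := seeley0_decay M; exists (c^-1 * C) => [|k].
    by rewrite mulr_ge0 // invr_ge0 ltW.
  rewrite normrM gtr0_norm ?invr_gt0 // -!mulrA; apply: ler_wpM2l => //.
  by rewrite invr_ge0 ltW.
have -> : series (fun k => c^-1 * seeley0 k * (- 2 ^+ k) ^+ m) =
    (fun n => c^-1 * series (fun k => seeley0 k * (- 2 ^+ k) ^+ m) n).
  by apply/funext => K; rewrite /series /= mulr_sumr; apply: eq_bigr => k _; rewrite -mulrA.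
rewrite -[X in _ --> X](mulVf (lt0r_neq0 c0)).
by apply: cvgM; [exact: cvg_cst|rewrite /c -(seeley0_sum m); exact: seeley0_cvg].
Qed.

End SeeleyCoefficients.

(** * Functions whose derivatives of all orders are bounded *)

Section BoundedAlgebra.
Variables (R : realType) (n : nat).
Local Notation rV := 'rV[R]_n.
Local Notation e i := (delta_mx 0 i : rV).

Definition cont_bounded (W : set rV) (F : rV -> R) :=
  contin W F /\ exists K, forall x, W x -> `|F x| <= K.

Lemma cont_bounded_algebra W : open W -> function_algebra W (cont_bounded W).
Proof.
move=> oW; have [ext c add mul] := contin_algebra oW.
split=> [F G FG [cF [K HK]]|a|F G [cF [K HK]] [cG [L HL]]|F G [cF [K HK]] [cG [L HL]]].
- by split; [exact: ext cF|exists K => x Wx; rewrite -FG ?HK].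
- by split; [exact: c|exists `|a|].
- split; first exact: add; exists (K + L) => x Wx.
  by apply: le_trans (ler_normD _ _) _; apply: lerD; auto.
- split; first exact: mul; exists (K * L) => x Wx.
  by rewrite normrM; apply: ler_pM; auto.
Qed.

Definition bounded_smooth (W : set rV) F := forall k, Dk (cont_bounded W) k W F.

Lemma bounded_smooth_der W F i : bounded_smooth W F ->
  bounded_smooth W (fun x => 'D_(e i) F x).
Proof. by move=> H k; have := H k.+1; exact: Dk_der. Qed.

Lemma bounded_smooth_derivable W F i x : bounded_smooth W F -> W x -> derivable F x (e i).
Proof. by move=> H; apply: Dk_derivable (H 1%N). Qed.

Lemma bounded_smooth_bound W F : bounded_smooth W F ->
  exists2 K, 0 <= K & forall x, W x -> `|F x| <= K.
Proof.
move=> /(_ 0%N)[[_ [K HK]] _]; exists `|K| => // x /HK; move/le_trans; apply.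
exact: ler_norm.
Qed.

Lemma bounded_smooth_Cinf W F : bounded_smooth W F -> Cinf W F.
Proof.
move=> H; apply/CinfE => k; apply: Dk_sub_set (H k) => //.
by move=> G [].
Qed.

End BoundedAlgebra.

Lemma cvgn_cst (R : realType) (a : R) : (fun _ : nat => a) @ \oo --> a.
Proof. exact: cvg_cst. Qed.

Lemma cvgn_add (R : realType) (u v : nat -> R) (a b : R) :
  u @ \oo --> a -> v @ \oo --> b -> (fun k => u k + v k) @ \oo --> a + b.
Proof. exact: cvgD. Qed.

Lemma cvgn_sub (R : realType) (u v : nat -> R) (a b : R) :
  u @ \oo --> a -> v @ \oo --> b -> (fun k => u k - v k) @ \oo --> a - b.
Proof. exact: cvgB. Qed.

Lemma cvgn_mul (R : realType) (u v : nat -> R) (a b : R) :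
  u @ \oo --> a -> v @ \oo --> b -> (fun k => u k * v k) @ \oo --> a * b.
Proof. exact: cvgM. Qed.

Lemma lim_norm_le (R : realType) (u : nat -> R) (l B : R) :
  u @ \oo --> l -> (forall k, `|u k| <= B) -> `|l| <= B.
Proof.
move=> ul uB; apply: (cvgr_to_le (cvg_norm ul)).
by apply: nearW => k; exact: uB.
Qed.

Lemma uniform_bound (R : realType) (I : finType) (T : Type) (A : set T) (f : I -> T -> R) :
  (forall t, exists2 K, 0 <= K & forall x, A x -> `|f t x| <= K) ->
  exists2 K, 0 <= K & forall t x, A x -> `|f t x| <= K.
Proof.
move=> H; have /choice [K HK] : forall t, exists K, 0 <= K /\ forall x, A x -> `|f t x| <= K.
  by move=> t; have [K K0 HK] := H t; exists K.
exists (\sum_t K t) => [|t x Ax]; first by apply: sumr_ge0 => t _; have [] := HK t.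
apply: le_trans ((HK t).2 x Ax) _; rewrite (bigD1 t) //= lerDl.
by apply: sumr_ge0 => r _; have [] := HK r.
Qed.

(** * Boundary values and Taylor estimates on a half slab *)

Section HalfSlab.
Variables (R : realType) (n : nat).
Local Notation rV := 'rV[R]_n.
Local Notation e i := (delta_mx 0 i : rV).
Variables (i0 : 'I_n) (x0 : rV) (d : R).

Implicit Types (F H : rV -> R) (x : rV).

Definition slab : set rV := [set x | forall j, j != i0 -> `|x 0 j - x0 0 j| < d].
Definition hslab : set rV := [set x | slab x /\ 0 < x 0 i0].
Definition cslab : set rV := [set x | slab x /\ 0 <= x 0 i0].

Lemma slab_open : open slab.
Proof.
rewrite openE => x Vx.
suff H j : \forall y \near (x : rV), j != i0 -> `|(y : rV) 0 j - x0 0 j| < d by exact: (near_forall H).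
have [->|ji] := eqVneq j i0; first by apply: near_all.
have c : (fun y : rV => `|y 0 j - x0 0 j|) @ x --> `|x 0 j - x0 0 j|.
  exact: (cvg_norm (cvgB (@coord_cvg _ _ x j) (@cst_continuous _ _ (x0 0 j) x))).
by apply: near_imp (cvgr_lt _ c d (Vx j ji)) => y yd _.
Qed.

Lemma hslab_open : open hslab.
Proof.
apply: openI; first exact: slab_open.
rewrite openE => x /= x0'; exact: (cvgr_gt _ (@coord_cvg _ _ x i0) 0 x0').
Qed.

Lemma conv_lt (a c b s : R) : 0 <= s <= 1 -> a < b -> a + c < b -> a + s * c < b.
Proof.
move=> /andP[s0 s1] ab acb; have [c0|c0] := leP c 0.
  by apply: le_lt_trans ab; rewrite gerDl mulr_ge0_le0.
by apply: le_lt_trans acb; rewrite lerD2l ler_piMl // ltW.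
Qed.

Lemma conv_norm_lt (a c b s : R) : 0 <= s <= 1 -> `|a| < b -> `|a + c| < b ->
  `|a + s * c| < b.
Proof.
move=> s01; rewrite !ltr_norml => /andP[a1 a2] /andP[b1 b2].
have H1 : - a < b by lra.
have H2 : - a + - c < b by lra.
rewrite (conv_lt s01 a2 b2) andbT.
by have := conv_lt s01 H1 H2; rewrite mulrN; lra.
Qed.

Lemma coord_step (x : rV) j h k : (x + h *: e j) 0 k = x 0 k + h * (k == j)%:R.
Proof. by rewrite !mxE eqxx. Qed.

Lemma step_ball (x : rV) i r h : `|h| < r -> ball x r (x + h *: e i).
Proof.
move=> hr; have r0 : 0 < r by apply: le_lt_trans hr.
apply/ball_coordP => // k; rewrite coord_step opprD addNKr normrN normrM.
by apply: le_lt_trans hr; rewrite ler_piMr //; case: eqP => _; rewrite ?normr1 ?normr0.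
Qed.

Lemma hslab_seg x j (h s : R) : hslab x -> hslab (x + h *: e j) -> 0 <= s <= 1 ->
  hslab (x + (s * h) *: e j).
Proof.
move=> [Vx px] [Vy py] s01; split=> [k ki|].
  move: (Vx k ki) (Vy k ki); rewrite !coord_step ![_ + _ - x0 0 k]addrAC => a1 a2.
  by rewrite -mulrA; exact: conv_norm_lt.
move: px py; rewrite !coord_step -mulrA => px py.
have H1 : - x 0 i0 < 0 by lra.
have H2 : - x 0 i0 + - (h * (i0 == j)%:R) < 0 by lra.
by have := conv_lt s01 H1 H2; rewrite mulrN; lra.
Qed.

Lemma lipschitz_step F K j x h : (forall y, hslab y -> derivable F y (e j)) ->
  (forall y, hslab y -> `|'D_(e j) F y| <= K) -> hslab x -> hslab (x + h *: e j) ->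
  `|F (x + h *: e j) - F x| <= `|h| * K.
Proof.
move=> dF bF Xx Xy.
have [s s01|s [s01 ->]] := @line_MVT R _ F x (e j) h.
  by apply: dF; exact: hslab_seg.
by rewrite normrM ler_wpM2l // bF //; exact: hslab_seg.
Qed.

Lemma taylor_step F K j x h : (forall y, hslab y -> derivable F y (e j)) ->
  (forall y, hslab y -> derivable (fun z => 'D_(e j) F z) y (e j)) ->
  (forall y, hslab y -> `|'D_(e j) (fun z => 'D_(e j) F z) y| <= K) -> 0 <= K ->
  hslab x -> hslab (x + h *: e j) ->
  `|F (x + h *: e j) - F x - h * 'D_(e j) F x| <= h ^+ 2 * K.
Proof.
move=> dF ddF bF K0 Xx Xy.
have [s s01|s [s01 ->]] := @line_MVT R _ F x (e j) h.
  by apply: dF; exact: hslab_seg.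
have L := @lipschitz_step (fun z => 'D_(e j) F z) K j x (s * h) ddF bF Xx
  (hslab_seg Xx Xy s01).
rewrite -mulrBr normrM -[h ^+ 2]ger0_norm ?sqr_ge0 // expr2 normrM -mulrA.
apply: ler_wpM2l => //; apply: le_trans L _; rewrite normrM.
move: s01 => /andP[s0 s1]; rewrite ger0_norm // -mulrA ler_piMl // mulr_ge0 //.
Qed.

(* Limit from inside the half slab; meaningful on [cslab] only. *)
Definition bar H (x : rV) : R := lim ((fun k => H (x + k.+1%:R^-1 *: e i0)) @ \oo).

Lemma cslab_shift x (s : R) : cslab x -> 0 < s -> hslab (x + s *: e i0).
Proof.
move=> [Vx px] s0; split=> [k ki|]; rewrite coord_step.
  by rewrite (negbTE ki) mulr0 addr0; exact: Vx.
by rewrite eqxx mulr1; lra.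
Qed.

Lemma inv_gt0 k : 0 < k.+1%:R^-1 :> R.
Proof. by rewrite invr_gt0. Qed.

Lemma cvg_inv0 : (fun k : nat => k.+1%:R^-1 : R) @ \oo --> (0 : R).
Proof. exact: cvg_harmonic. Qed.

Lemma bar_cvg H x : bounded_smooth hslab H -> cslab x ->
  (fun k => H (x + k.+1%:R^-1 *: e i0)) @ \oo --> bar H x.
Proof.
move=> nH cx.
have [B B0 HB] := bounded_smooth_bound nH.
have [K K0 HK] := bounded_smooth_bound (bounded_smooth_der i0 nH).
pose s (k : nat) : R := k.+1%:R^-1.
(* Adding [K * s k] turns the Lipschitz bound into monotonicity, so that a bounded monotone sequence
   remains. *)
pose u k := H (x + s k *: e i0) + K * s k.
have cu : cvgn u.
  apply: nonincreasing_is_cvgn; last first.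
    exists (- B) => _ [k _ <-]; rewrite /u.
    have := HB _ (cslab_shift cx (inv_gt0 k)); rewrite ler_norml => /andP[b1 _].
    by apply: le_trans b1 _; rewrite lerDl mulr_ge0 // ltW // inv_gt0.
  move=> k l kl.
  have sl : s l <= s k by rewrite /s lef_pV2 ?posrE // ler_nat ltnS.
  have E : x + s l *: e i0 = x + s k *: e i0 + (s l - s k) *: e i0.
    by rewrite -addrA -scalerDl [s k + _]addrC subrK.
  have := @lipschitz_step H K i0 (x + s k *: e i0) (s l - s k)
    (fun y Xy => bounded_smooth_derivable nH Xy) HK (cslab_shift cx (inv_gt0 k)).
  rewrite -E => /(_ (cslab_shift cx (inv_gt0 l))).
  rewrite [`|s l - s k|]ler0_norm ?subr_le0 // ler_norml => /andP[_ b2].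
  by rewrite /u; move: b2; lra.
have cs : (fun k => K * s k) @ \oo --> K * 0.
  by apply: cvgM; [exact: cvg_cst|exact: cvg_inv0].
suff : cvgn (fun k => H (x + s k *: e i0)) by [].
have -> : (fun k => H (x + s k *: e i0)) = (fun k => u k - K * s k).
  by apply/funext => k; rewrite /u addrK.
by apply: is_cvgB => //; apply/cvg_ex; exists (K * 0).
Qed.

Lemma bar_eq H x : bounded_smooth hslab H -> hslab x -> bar H x = H x.
Proof.
move=> nH Xx; have cx : cslab x by case: Xx => ? /ltW.
apply/cvg_lim => //.
have cH := Cinf_contin (bounded_smooth_Cinf nH) Xx.
have c : (fun k : nat => x + k.+1%:R^-1 *: e i0) @ \oo --> x.
  apply: row_cvg => j; under eq_fun do rewrite coord_step.
  have := cvgn_add (@cvgn_cst _ (x 0 j)) (cvgn_mul cvg_inv0 (@cvgn_cst _ (j == i0)%:R)).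
  by rewrite mul0r addr0 => cc; exact: cc.
exact: (@cvg_comp _ _ _ (fun k : nat => x + k.+1%:R^-1 *: e i0) H \oo (nbhs x) _ c cH).
Qed.

Lemma bar_bound H : bounded_smooth hslab H ->
  exists2 K, 0 <= K & forall x, cslab x -> `|bar H x| <= K.
Proof.
move=> nH; have [B B0 HB] := bounded_smooth_bound nH; exists B => // x cx.
apply: lim_norm_le (bar_cvg nH cx) _ => k; apply: HB.
exact: cslab_shift (inv_gt0 k).
Qed.

(** Limit of [taylor_step]. A quadratic remainder that is uniform up to the face is all that is
    needed to differentiate the reflection there. *)
Lemma bar_taylor H : bounded_smooth hslab H ->
  exists2 K, 0 <= K & forall x h j, cslab x -> cslab (x + h *: e j) ->
  `|bar H (x + h *: e j) - bar H x - h * bar (fun y => 'D_(e j) H y) x| <= h ^+ 2 * K.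
Proof.
move=> nH.
have [K K0 HK] := uniform_bound (fun j =>
  bounded_smooth_bound (bounded_smooth_der j (bounded_smooth_der j nH))).
exists K => // x h j cx cy.
have nD := bounded_smooth_der j nH.
have c := cvgn_sub (cvgn_sub (bar_cvg nH cy) (bar_cvg nH cx))
  (cvgn_mul (@cvgn_cst _ h) (bar_cvg nD cx)).
apply: (lim_norm_le c) => k.
have := @taylor_step H K j (x + k.+1%:R^-1 *: e i0) h
  (fun y Xy => bounded_smooth_derivable nH Xy)
  (fun y Xy => bounded_smooth_derivable nD Xy) (HK j) K0
  (cslab_shift cx (inv_gt0 k)).
rewrite addrAC => /(_ (cslab_shift cy (inv_gt0 k))).
by rewrite addrAC.
Qed.

End HalfSlab.

Lemma cvg_at_dist (R : realType) (T : topologicalType) (F : T -> R) (x : T) :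
  (forall eps, 0 < eps -> \forall y \near x, `|F x - F y| <= eps) -> F @ x --> F x.
Proof. by move=> H; apply/cvgrPdist_le. Qed.

(** * The series that occur in the reflection *)

Section WeightedSums.
Variables (R : realType) (a : nat -> R).
Hypothesis decay : forall M, exists2 C, 0 <= C &
  forall k, `|a k| * 2 ^+ (k * M) <= C * 2^-1 ^+ k.

Definition wsum m (g : nat -> R) : R :=
  lim (series (fun k => a k * (- 2 ^+ k) ^+ m * g k) @ \oo).

(** The exponent 2 is that of the Taylor remainder: the k-th dilation stretches a step of length h
    to 2^k h, and its square enters the remainder. *)
Definition tame (B : R) (g : nat -> R) := forall k, `|g k| <= B * (2 ^+ k) ^+ 2.

Lemma wsum_bound m : exists2 C, 0 <= C & forall g B, 0 <= B -> tame B g ->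
  (series (fun k => a k * (- 2 ^+ k) ^+ m * g k) @ \oo --> wsum m g) /\
  `|wsum m g| <= B * C.
Proof.
(* [m] powers of 2^k come from the weight and two from the growth that [tame] allows; the factor 2
   is the sum of the geometric series. *)
have [C C0 HC] := decay (m + 2); exists (2 * C) => [|g B B0 gB].
  by rewrite mulr_ge0.
have H k : `|a k * (- 2 ^+ k) ^+ m * g k| <= (B * C) * 2^-1 ^+ k.
  rewrite !normrM norm_dilation.
  apply: le_trans (ler_wpM2l _ (gB k)) _; first by rewrite mulr_ge0 ?exprn_ge0.
  have -> : `|a k| * 2 ^+ (k * m) * (B * 2 ^+ k ^+ 2) = B * (`|a k| * 2 ^+ (k * (m + 2))).
    by rewrite mulnDr exprD -exprM; ring.
  by rewrite -mulrA; apply: ler_wpM2l.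
have c : series (fun k => a k * (- 2 ^+ k) ^+ m * g k) @ \oo --> wsum m g.
  exact: decay_cvg H.
split=> //; apply: (lim_norm_le c) => N.
have -> : B * (2 * C) = B * C * (1 - 2^-1)^-1 by field.
rewrite /series /=; apply: le_trans (ler_norm_sum _ _ _) _.
apply: le_trans (ler_sum _ (fun k _ => H k)) _.
apply: (@geometric_le_lim R N (B * C) 2^-1); [exact: mulr_ge0|lra|exact: half_lt1].
Qed.

Lemma wsum_cvg m g B : 0 <= B -> tame B g ->
  series (fun k => a k * (- 2 ^+ k) ^+ m * g k) @ \oo --> wsum m g.
Proof. by move=> B0 gB; have [C _ /(_ g B B0 gB)[]] := wsum_bound m. Qed.

Lemma wsum_lin m (f g h : nat -> R) (t A B C : R) : 0 <= A -> 0 <= B -> 0 <= C ->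
  tame A f -> tame B g -> tame C h ->
  wsum m (fun k => f k - g k - t * h k) = wsum m f - wsum m g - t * wsum m h.
Proof.
move=> A0 B0 C0 fA gB hC; apply/cvg_lim => //.
have -> : series (fun k => a k * (- 2 ^+ k) ^+ m * (f k - g k - t * h k)) =
  (fun N => series (fun k => a k * (- 2 ^+ k) ^+ m * f k) N -
    series (fun k => a k * (- 2 ^+ k) ^+ m * g k) N -
    t * series (fun k => a k * (- 2 ^+ k) ^+ m * h k) N).
  apply/funext => N; rewrite /series /= mulr_sumr -!sumrB; apply: eq_bigr => k _.
  ring.
have cf := wsum_cvg (m := m) A0 fA; have cg := wsum_cvg (m := m) B0 gB.
have ch := wsum_cvg (m := m) C0 hC.
exact: (cvgn_sub (cvgn_sub cf cg) (cvgn_mul (@cvgn_cst _ t) ch)).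
Qed.

Lemma wsumS m g : wsum m.+1 g = wsum m (fun k => - 2 ^+ k * g k).
Proof.
rewrite /wsum; congr (lim (series _ @ \oo)); apply/funext => k.
by rewrite exprSr; ring.
Qed.

End WeightedSums.

(** * Reflection across the face and its smoothness *)

Section Seeley.
Variables (R : realType) (n : nat).
Local Notation rV := 'rV[R]_n.
Local Notation e i := (delta_mx 0 i : rV).
Variables (i0 : 'I_n) (x0 : rV) (d : R).
Variable a : nat -> R.
Hypothesis decay : forall M, exists2 C, 0 <= C &
  forall k, `|a k| * 2 ^+ (k * M) <= C * 2^-1 ^+ k.
Hypothesis moments : forall m, series (fun k => a k * (- 2 ^+ k) ^+ m) @ \oo --> (1 : R).

Implicit Types (H : rV -> R) (x : rV).
Local Notation slab := (slab i0 x0 d).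
Local Notation hslab := (hslab i0 x0 d).
Local Notation cslab := (cslab i0 x0 d).
Local Notation bar := (bar i0).
Local Notation wsum := (wsum a).

(** Multiplies the coordinate [i0] by - 2^k; it is written as a step along [e i0] so that the lemmas
    on coordinate steps apply. *)
Definition dilate k x : rV := x + (- (2 ^+ k + 1) * x 0 i0) *: e i0.

Lemma dilate_coord k x : dilate k x 0 i0 = - 2 ^+ k * x 0 i0.
Proof. by rewrite /dilate coord_step eqxx mulr1; ring. Qed.

Lemma dilate_slab k x : slab x -> slab (dilate k x).
Proof. by move=> Vx j ji; rewrite coord_step (negbTE ji) mulr0 addr0; exact: Vx. Qed.

Lemma dilate_cslab k x : slab x -> x 0 i0 <= 0 -> cslab (dilate k x).
Proof.
move=> Vx px; split; first exact: dilate_slab.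
by rewrite dilate_coord mulNr oppr_ge0 pmulr_rle0 // exprn_gt0.
Qed.

Lemma dilate_step k x j h : dilate k (x + h *: e j) =
  dilate k x + (h * (if j == i0 then - 2 ^+ k else 1)) *: e j.
Proof.
apply/rowP => l; rewrite /dilate !coord_step; have [->|ji] := eqVneq j i0.
  by rewrite /=; ring.
by rewrite /=; ring.
Qed.

(* The index [m] counts the derivatives taken in the direction [i0]: each of them
   multiplies the k-th term of the reflected sum by - 2^k. *)
Definition reflect m H x : R :=
  if 0 <= x 0 i0 then bar H x else wsum m (fun k => bar H (dilate k x)).

Lemma bar_dilate_bound H : bounded_smooth hslab H ->
  exists2 B, 0 <= B & forall x k, slab x -> x 0 i0 <= 0 -> `|bar H (dilate k x)| <= B.
Proof.
move=> nH; have [K K0 HK] := bar_bound nH; exists K => // x k Vx px.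
exact/HK/dilate_cslab.
Qed.

Lemma bounded_tame (g : nat -> R) B : 0 <= B -> (forall k, `|g k| <= B) -> tame B g.
Proof.
move=> B0 gB k; apply: le_trans (gB k) _.
by rewrite ler_peMr // -exprM exp2_ge1.
Qed.

(** On the face every dilation fixes [x] and the coefficients have all moments equal to 1, so the
    two branches of [reflect] agree there, for every [m]. *)
Lemma reflect_left m H x : bounded_smooth hslab H -> slab x -> x 0 i0 <= 0 ->
  reflect m H x = wsum m (fun k => bar H (dilate k x)).
Proof.
move=> nH Vx x0'; rewrite /reflect; case: ifP => // x0''.
have E : x 0 i0 = 0 by apply/eqP; rewrite eq_le x0' x0''.
apply/esym/cvg_lim => //.
have -> : series (fun k => a k * (- 2 ^+ k) ^+ m * bar H (dilate k x)) =
    (fun N => series (fun k => a k * (- 2 ^+ k) ^+ m) N * bar H x).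
  apply/funext => N; rewrite /series /= mulr_suml; apply: eq_bigr => k _.
  by rewrite /dilate E mulr0 scale0r addr0.
by have := cvgn_mul (@moments m) (@cvgn_cst _ (bar H x)); rewrite mul1r.
Qed.

(** The expansions of the single terms are added up. In direction [i0] the inner derivative - 2^k is
    absorbed by raising [m], and the remainder of the k-th term is at most 4^k h^2 K, which the
    coefficients still sum. Both end points lie on one closed side of the face, so a single branch
    is involved. *)
Lemma reflect_taylor m H : bounded_smooth hslab H ->
  exists2 K, 0 <= K & forall x h j, slab x -> slab (x + h *: e j) ->
    (0 <= x 0 i0 /\ 0 <= (x + h *: e j) 0 i0) \/
    (x 0 i0 <= 0 /\ (x + h *: e j) 0 i0 <= 0) ->
  `|reflect m H (x + h *: e j) - reflect m H x -
    h * reflect (m + (j == i0)) (fun y => 'D_(e j) H y) x| <= h ^+ 2 * K.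
Proof.
move=> nH; have [K K0 HK] := bar_taylor nH.
have [B B0 HB] := bar_dilate_bound nH.
have [C C0 HC] := wsum_bound decay m.
exists (K + K * C) => [|x h j Vx Vy [[px py]|[px py]]].
- by rewrite addr_ge0 // mulr_ge0.
- rewrite /reflect px py; apply: le_trans (HK x h j _ _) _ => //.
  by rewrite ler_wpM2l ?sqr_ge0 // lerDl mulr_ge0.
have nD := bounded_smooth_der j nH.
have [D D0 HD] := bar_dilate_bound nD.
rewrite !reflect_left //.
pose s k : R := if j == i0 then - 2 ^+ k else 1.
have s1 k : `|s k| <= (2 ^+ k) ^+ 2.
  rewrite /s; case: ifP => _; last by rewrite normr1 -exprM exp2_ge1.
  by rewrite normrN normrX normr_nat ler_eXnr // exp2_ge1.
have s2 k : s k ^+ 2 <= (2 ^+ k) ^+ 2.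
  by rewrite /s; case: ifP => _; rewrite ?sqrrN // expr1n -exprM exp2_ge1.
pose u k := bar H (dilate k (x + h *: e j)) - bar H (dilate k x) -
  h * (s k * bar (fun y => 'D_(e j) H y) (dilate k x)).
have uK : tame (h ^+ 2 * K) u.
  move=> k; rewrite /u dilate_step -/(s k).
  have cy : cslab (dilate k x + (h * s k) *: e j).
    by rewrite /s -dilate_step; exact: dilate_cslab.
  have := HK _ _ _ (dilate_cslab k Vx px) cy; rewrite -[h * s k * _]mulrA => /le_trans; apply.
  have -> : (h * s k) ^+ 2 * K = h ^+ 2 * K * s k ^+ 2 by ring.
  by apply: ler_wpM2l (s2 k); rewrite mulr_ge0 ?sqr_ge0.
have tD : tame D (fun k => s k * bar (fun y => 'D_(e j) H y) (dilate k x)).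
  by move=> k; rewrite normrM mulrC; apply: ler_pM => //; exact: HD.
have -> : wsum m (fun k => bar H (dilate k (x + h *: e j))) -
   wsum m (fun k => bar H (dilate k x)) -
   h * wsum (m + (j == i0)) (fun k => bar (fun y => 'D_(e j) H y) (dilate k x)) = wsum m u.
  have -> : wsum (m + (j == i0)) (fun k => bar (fun y => 'D_(e j) H y) (dilate k x)) =
      wsum m (fun k => s k * bar (fun y => 'D_(e j) H y) (dilate k x)).
    rewrite /s; case: eqP => _; first by rewrite addn1 wsumS.
    by rewrite addn0; congr (wsum _ _); apply/funext => k; rewrite mul1r.
  by rewrite -(wsum_lin decay m h B0 B0 D0) //; apply: bounded_tame => // k; exact: HB.
have h0 : 0 <= h ^+ 2 * K by rewrite mulr_ge0 // sqr_ge0.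
have [_ HW] := HC u _ h0 uK.
apply: le_trans HW _; rewrite -mulrA ler_wpM2l ?sqr_ge0 //.
by rewrite lerDr.
Qed.

Lemma reflect_bound m H : bounded_smooth hslab H ->
  exists2 K, 0 <= K & forall x, slab x -> `|reflect m H x| <= K.
Proof.
move=> nH; have [K K0 HK] := bar_bound nH.
have [B B0 HB] := bar_dilate_bound nH.
have [C C0 HC] := wsum_bound decay m.
exists (K + B * C) => [|x Vx]; first by rewrite addr_ge0 // mulr_ge0.
have [px|px] := leP 0 (x 0 i0).
  rewrite /reflect px; apply: le_trans (HK x _) _ => //.
  by rewrite lerDl mulr_ge0.
rewrite reflect_left //; last exact: ltW.
have tB : tame B (fun k => bar H (dilate k x)).
  by apply: bounded_tame => // k; apply: HB => //; exact: ltW.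
have [_ HW] := HC _ _ B0 tB.
by apply: le_trans HW _; rewrite lerDr.
Qed.

Lemma quadratic_derive (F : rV -> R) x v L K r : 0 < r -> 0 <= K ->
  (forall h : R, `|h| < r -> `|F (x + h *: v) - F x - h * L| <= h ^+ 2 * K) ->
  is_derive x v F L.
Proof.
move=> r0 K0 HF.
suff c : (fun h : R => h^-1 *: ((F \o shift x) (h *: v) - F x)) @ 0^' --> L.
  by split; [apply/cvg_ex; exists L|exact: cvg_lim c].
apply/cvgrPdist_le => eps eps0.
have K1 : 0 < K + 1 by lra.
near=> h.
have h0 : h != 0 by near: h; exact: nbhs_dnbhs_neq.
have hr : `|h| < r by near: h; exact: dnbhs0_lt.
have he : `|h| <= eps / (K + 1) by near: h; apply: dnbhs0_le; exact: divr_gt0.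
have hp : 0 < `|h| by rewrite normr_gt0.
rewrite /= [h *: v + x]addrC /GRing.scale /=.
have -> : L - h^-1 * (F (x + h *: v) - F x) = - h^-1 * (F (x + h *: v) - F x - h * L).
  by field.
rewrite normrM normrN normfV ler_pdivrMl //.
apply: le_trans (HF h hr) _; rewrite -real_normK ?num_real // expr2 -mulrA.
rewrite ler_wpM2l //; apply: le_trans (ler_wpM2r K0 he) _.
by rewrite mulrAC ler_pdivrMr // ler_wpM2l ?(ltW eps0) //; lra.
Unshelve. all: by end_near. Qed.

(** Lipschitz bounds along coordinate steps suffice, since an increment telescopes through
    [row_trunc]; the constants [n.+1] and [K + 1] only keep the quotient defined. *)
Lemma step_continuous (F : rV -> R) x r K : 0 < r -> 0 <= K ->
  (forall y h j, ball x r y -> ball x r (y + h *: e j) ->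
     `|F (y + h *: e j) - F y| <= `|h| * K) -> F @ x --> F x.
Proof.
move=> r0 K0 HF; apply: cvg_at_dist => eps eps0.
pose s := Num.min r (eps / (n.+1%:R * (K + 1))).
have K1 : 0 < K + 1 by lra.
have p0 : 0 < n.+1%:R * (K + 1) :> R by rewrite mulr_gt0.
have s0 : 0 < s by rewrite lt_min r0 divr_gt0.
apply/nbhs_row_ball; exists s => // y xy.
pose h := y - x.
have hs : `|h| < s by rewrite /h distrC; move: xy; rewrite -ball_normE.
have inb (k : 'I_n) (t : R) : 0 <= t <= 1 -> ball x r (x + row_trunc h k + (t * h 0 k) *: e k).
  by apply: row_trunc_ball; apply: lt_le_trans hs _; rewrite ge_min lexx.
rewrite distrC (_ : y = x + h); last by rewrite /h addrC subrK.
rewrite row_telescope; apply: le_trans (ler_norm_sum _ _ _) _.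
have step (k : 'I_n) : `|F (x + row_trunc h k.+1) - F (x + row_trunc h k)| <= `|h| * K.
  rewrite row_truncS addrA; apply: le_trans (HF _ _ _ _ _) _.
  - by have := @inb k 0; rewrite mul0r scale0r addr0; apply; rewrite lexx ler01.
  - by have := @inb k 1; rewrite mul1r; apply; rewrite lexx ler01.
  - by apply: ler_wpM2r => //; exact: coord_le_norm.
apply: le_trans (ler_sum _ (fun k _ => step k)) _.
rewrite sumr_const card_ord -mulr_natl.
have hs' : `|h| <= eps / (n.+1%:R * (K + 1)).
  by apply: le_trans (ltW hs) _; rewrite ge_min lexx orbT.
have nn : n%:R <= n.+1%:R :> R by rewrite ler_nat.
have n0 : 0 <= n%:R :> R by [].
have KK : K <= K + 1 by lra.
have A : n%:R * (`|h| * K) <= n.+1%:R * (`|h| * (K + 1)).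
  by apply: ler_pM => //; [exact: mulr_ge0|exact: ler_wpM2l].
apply: le_trans A _; rewrite mulrCA.
by rewrite -ler_pdivlMr.
Qed.

Lemma reflect_derive m H x j : bounded_smooth hslab H -> slab x ->
  is_derive x (e j) (reflect m H) (reflect (m + (j == i0)) (fun y => 'D_(e j) H y) x).
Proof.
move=> nH Vx; have [K K0 HK] := reflect_taylor m nH.
have /nbhs_row_ball [r r0 rV] := near_open (@slab_open R n i0 x0 d) Vx.
(* Off the face, steps shorter than [|x 0 i0|] do not cross it; a point of the face belongs to both
   closed sides, so any step from it stays on one of them. *)
pose s := if x 0 i0 == 0 then r else Num.min r `|x 0 i0|.
have s0 : 0 < s.
  by rewrite /s; case: eqP => [_ //|/eqP px]; rewrite lt_min r0 normr_gt0.
apply: (quadratic_derive s0 K0) => h hs; apply: HK => //.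
  apply/rV/step_ball.
  apply: lt_le_trans hs _; rewrite /s; case: ifP => // _.
  by rewrite ge_min lexx.
move: hs; rewrite /s coord_step; case: eqP => [-> _|/eqP px].
  rewrite lexx add0r.
  by have [?|/ltW ?] := leP 0 (h * (i0 == j)%:R); auto.
rewrite lt_min => /andP[_ hx].
have hh : `|h * (i0 == j)%:R| <= `|h|.
  by rewrite normrM ler_piMr //; case: eqP => _; rewrite ?normr1 ?normr0.
move: (h * _) hh => w wh; have {hx wh} := le_lt_trans wh hx.
have [p|p] := leP 0 (x 0 i0); rewrite ltr_norml => /andP[w1 w2].
  by left; split=> //; move: w1; rewrite ?(ger0_norm p); lra.
by right; split; [exact: ltW|move: w2; rewrite ?(ltr0_norm p); lra].
Qed.

(** Partial derivatives exist on the whole slab, the face included, and are bounded; the mean value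
    theorem then gives the Lipschitz bounds, also for segments that cross the face. *)
Lemma reflect_continuous m H : bounded_smooth hslab H -> contin slab (reflect m H).
Proof.
move=> nH x Vx.
have [K K0 HK] := uniform_bound (fun j =>
  reflect_bound (m + (j == i0)) (bounded_smooth_der j nH)).
have /nbhs_row_ball [r r0 rV] := near_open (@slab_open R n i0 x0 d) Vx.
apply: (step_continuous r0 K0) => y h j By Bz.
have seg (s : R) : 0 <= s <= 1 -> slab (y + (s * h) *: e j).
  move=> s01 k ki; move: (rV _ By k ki) (rV _ Bz k ki).
  rewrite !coord_step ![_ + _ - x0 0 k]addrAC -mulrA; exact: conv_norm_lt.
have [s s01|s [s01 ->]] := @line_MVT R _ (reflect m H) y (e j) h.
  by have [] := reflect_derive m j nH (seg s s01).
have [_ ->] := reflect_derive m j nH (seg s s01).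
by rewrite normrM ler_wpM2l //; exact: HK (seg s s01).
Qed.

Lemma reflect_Cinf m H : bounded_smooth hslab H -> Cinf slab (reflect m H).
Proof.
move=> nH k; elim: k m H nH => [|k IH] m H nH.
  by split=> //; exact: reflect_continuous.
split; first exact: reflect_continuous.
move=> i; split=> [x Vx|]; first by have [] := reflect_derive m i nH Vx.
apply/CkE; apply: (Dk_ext' (@slab_open R n i0 x0 d) (contin_algebra (@slab_open R n i0 x0 d))
  (F := reflect (m + (i == i0)) (fun y => 'D_(e i) H y))) => [x Vx|].
  by have [_ ->] := reflect_derive m i nH Vx.
by apply/CkE/IH; exact: bounded_smooth_der.
Qed.

End Seeley.

Lemma seeley_extension (R : realType) n (i0 : 'I_n) (x0 : 'rV[R]_n) (d : R) H :
  bounded_smooth (hslab i0 x0 d) H ->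
  exists2 G, Cinf (slab i0 x0 d) G & forall x, hslab i0 x0 d x -> G x = H x.
Proof.
move=> nH; have [a [decay moments]] := seeley_coefficients R.
exists (reflect i0 a 0 H); first exact: reflect_Cinf.
move=> x Xx; rewrite /reflect (ltW Xx.2); exact: bar_eq nH Xx.
Qed.

(** * From the half slab to a half box *)

Section HalfBox.
Variables (R : realType) (n : nat).
Local Notation rV := 'rV[R]_n.
Local Notation e i := (delta_mx 0 i : rV).
Variables (i0 : 'I_n) (x0 : rV) (d : R).
Hypothesis (d0 : 0 < d) (x00 : x0 0 i0 = 0).

Definition hbox : set rV := [set x | ball x0 d x /\ 0 < x 0 i0].

Lemma hbox_open : open hbox.
Proof.
apply: openI; first exact: ball_open.
by rewrite openE => x /= p; exact: (cvgr_gt _ (@coord_cvg _ _ x i0) 0 p).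
Qed.

Definition set_coord (x : rV) (v : R) : rV := \row_j (if j == i0 then v else x 0 j).

(* The substitution t |-> d t / (1 + t) in the coordinate [i0] carries the
   unbounded half slab, where all the dilations of Seeley's formula are defined,
   onto the half box. *)
Definition inv1p (x : rV) : R := (1 + x 0 i0)^-1.
Definition squeeze (x : rV) : rV := set_coord x (d * (1 - inv1p x)).
Definition unsqueeze (x : rV) : rV := set_coord x (x 0 i0 * (d - x 0 i0)^-1).

Local Notation hslab := (hslab i0 x0 d).

Lemma inv1p_itv x : hslab x -> 0 < inv1p x < 1.
Proof.
by move=> [_ px]; rewrite /inv1p invr_gt0 invf_lt1; [apply/andP; split|]; lra.
Qed.

Lemma inv1p_derive x i : hslab x ->
  is_derive x (e i) inv1p (- (i == i0)%:R * (inv1p x * inv1p x)).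
Proof.
move=> [_ px]; have [dc Dc] := derive_coord x i0 i.
have nz : 1 + x 0 i0 != 0 by apply: lt0r_neq0; lra.
have cc : derivable (cst 1 : rV -> R) x (e i) by exact: derivable_cst.
have d1 : derivable (fun y : rV => 1 + y 0 i0) x (e i) := derivableD cc dc.
have D1 : 'D_(e i) (fun y : rV => 1 + y 0 i0) x = (i == i0)%:R.
  by rewrite [LHS](deriveD cc dc) derive_cst add0r.
have dV : derivable (fun y : rV => (1 + y 0 i0)^-1) x (e i) := @derivableV _ _ (fun y : rV => 1 + y 0 i0) x (e i) nz d1.
have DV := @deriveV _ _ (fun y : rV => 1 + y 0 i0) x (e i) nz d1.
rewrite /inv1p; split; first exact: dV.
rewrite [LHS]DV D1 /GRing.scale /= expr2 invfM; ring.
Qed.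

(** The derivative of u = 1 / (1 + t) is - u^2, so all derivatives are polynomials in u, which stays
    between 0 and 1. *)
Lemma inv1p_smooth : bounded_smooth hslab inv1p.
Proof.
have oX := @hslab_open R n i0 x0 d; have alg := cont_bounded_algebra oX.
have CI : Cinf hslab inv1p.
  apply: Cinf_inv => // [x [_ px]|]; first by apply: lt0r_neq0; lra.
  by apply: Cinf_add => //; [exact: Cinf_cst|exact: Cinf_coord].
elim=> [|k IH].
  split=> //; split; first exact: Cinf_contin.
  by exists 1 => x /inv1p_itv /andP[a b]; rewrite gtr0_norm // ltW.
split; first exact: Dk_base IH.
move=> i; split=> [x Xx|]; first by have [] := inv1p_derive i Xx.
apply: (Dk_ext' oX alg (F := fun x => - (i == i0)%:R * (inv1p x * inv1p x))) => [x Xx|].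
  by have [_ ->] := inv1p_derive i Xx.
by apply: Dk_scale => //; exact: Dk_mul.
Qed.

Lemma set_coordE x v j : set_coord x v 0 j = if j == i0 then v else x 0 j.
Proof. by rewrite mxE. Qed.

Lemma squeeze_hbox x : hslab x -> hbox (squeeze x).
Proof.
move=> Xx; have /andP[u0 u1] := inv1p_itv Xx; split.
  apply/ball_coordP => // j; rewrite set_coordE; case: eqP => [->|/eqP ji].
    have : 0 < d * (1 - inv1p x) by apply: mulr_gt0 => //; lra.
    have : 0 < d * inv1p x by exact: mulr_gt0.
    rewrite x00 sub0r normrN => a b; rewrite gtr0_norm //; lra.
  by rewrite distrC; exact: Xx.1.
by rewrite set_coordE eqxx; apply: mulr_gt0 => //; lra.
Qed.

Lemma squeeze_derive a i x : hslab x ->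
  is_derive x (e i) (fun y => squeeze y 0 a)
    (if a == i0 then d * ((i == i0)%:R * (inv1p x * inv1p x)) else (i == a)%:R).
Proof.
move=> Xx; rewrite /squeeze; under eq_fun do rewrite set_coordE.
case: eqP => [_|_]; last exact: derive_coord.
have [du Du] := inv1p_derive i Xx.
have cc : derivable (cst 1 : rV -> R) x (e i) by exact: derivable_cst.
have d1 : derivable (fun y : rV => 1 - inv1p y) x (e i) := derivableB cc du.
have D1 : 'D_(e i) (fun y : rV => 1 - inv1p y) x = (i == i0)%:R * (inv1p x * inv1p x).
  by rewrite [LHS](deriveB cc du) derive_cst Du; ring.
have cd : derivable (cst d : rV -> R) x (e i) by exact: derivable_cst.
split; first exact: (derivableM cd d1).
rewrite [LHS](deriveM cd d1) D1 derive_cst /GRing.scale /cst /=; ring.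
Qed.

Lemma squeeze_Cinf a : Cinf hslab (fun y => squeeze y 0 a).
Proof.
have oX := @hslab_open R n i0 x0 d.
rewrite /squeeze; under eq_fun do rewrite set_coordE.
case: eqP => _; last exact: Cinf_coord.
apply: Cinf_mul => //; first exact: Cinf_cst.
apply: Cinf_sub => //; first exact: Cinf_cst.
exact: bounded_smooth_Cinf inv1p_smooth.
Qed.

Lemma unsqueezeK x : ball x0 d x -> 0 < x 0 i0 ->
  hslab (unsqueeze x) /\ squeeze (unsqueeze x) = x.
Proof.
move=> /(ball_coordP _ _ d0) B p.
have xd : x 0 i0 < d by have := B i0; rewrite x00 sub0r normrN gtr0_norm.
have dx : d - x 0 i0 != 0 by apply: lt0r_neq0; lra.
split.
  split=> [j ji|]; rewrite /unsqueeze set_coordE; first by rewrite (negbTE ji) distrC.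
  by rewrite eqxx divr_gt0 // subr_gt0.
apply/rowP => j; rewrite /squeeze set_coordE; case: eqP => [->|/eqP ji].
  rewrite /inv1p /unsqueeze set_coordE eqxx.
  have dn := lt0r_neq0 d0; field; apply/andP; split=> //.
  by have -> : d - x 0 i0 + x 0 i0 = d by ring.
by rewrite /unsqueeze set_coordE (negbTE ji).
Qed.

(** The inverse substitution u / (d - u) is smooth for all u < d, negative u included, and so
    carries the extension on the slab back to the full ball. *)
Lemma half_box_extension F : bounded_smooth hbox F ->
  exists2 G, Cinf (ball x0 d) G & forall x, ball x0 d x -> 0 < x 0 i0 -> G x = F x.
Proof.
move=> nF.
have oX := @hslab_open R n i0 x0 d; have alg := cont_bounded_algebra oX.
have [|G CG GH] := @seeley_extension R n i0 x0 d (F \o squeeze).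
  move=> k; apply: (Dk_comp oX hbox_open alg _ _ squeeze_hbox _ _ (nF k)).
  - by move=> K [].
  - move=> K [cK [B HB]]; split.
      move=> x Xx.
      have c : squeeze @ x --> squeeze x.
        apply: (@row_cvg _ _ _ (nbhs x)) => a.
        exact: (Cinf_contin (squeeze_Cinf a) Xx).
      exact: (@cvg_comp _ _ _ squeeze K (nbhs x) (nbhs (squeeze x)) _ c
        (cK _ (squeeze_hbox Xx))).
    by exists B => x Xx; apply: HB; exact: squeeze_hbox.
  - by move=> a i x Xx; have [] := squeeze_derive a i Xx.
  - move=> a i l; apply: (Dk_ext' oX alg (F := fun x => if a == i0 then
      d * ((i == i0)%:R * (inv1p x * inv1p x)) else (i == a)%:R)) => [x Xx|].
      by have [_ ->] := squeeze_derive a i Xx.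
    case: eqP => _; last exact: (Dk_cst oX alg).
    have Du := inv1p_smooth l.
    by do 2! apply: (Dk_scale oX alg); apply: (Dk_mul oX alg).
exists (G \o unsqueeze).
  have ob : open (ball x0 d) by exact: ball_open.
  apply: (Cinf_comp ob (@slab_open R n i0 x0 d) _ _ CG).
    move=> x /(ball_coordP _ _ d0) B j ji.
    by rewrite /unsqueeze set_coordE (negbTE ji) distrC.
  move=> a; apply: (Cinf_ext (F := fun x : rV => if a == i0 then x 0 i0 * (d - x 0 i0)^-1
      else x 0 a) ob) => [x _|]; first by rewrite /unsqueeze set_coordE.
  case: eqP => _; last exact: Cinf_coord.
  apply: Cinf_mul => //; first exact: Cinf_coord.
  apply: Cinf_inv => // [x /(ball_coordP _ _ d0) /(_ i0)|].
    by rewrite x00 sub0r normrN ltr_norml => /andP[_ xd]; apply: lt0r_neq0; lra.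
  by apply: Cinf_sub => //; [exact: Cinf_cst|exact: Cinf_coord].
move=> x B p; have [Xx E] := unsqueezeK B p.
by rewrite /= GH //= E.
Qed.

End HalfBox.

(** * Closed linear systems on a half box *)

Section LinearSystem.
Variables (R : realType) (n : nat).
Local Notation rV := 'rV[R]_n.
Local Notation e i := (delta_mx 0 i : rV).

Lemma is_derive_bigsum (V : normedModType R) (I : Type) (r : seq I) (x v : V)
    (g : I -> V -> R) (dg : I -> R) : (forall t, is_derive x v (g t) (dg t)) ->
  is_derive x v (fun z => \sum_(t <- r) g t z) (\sum_(t <- r) dg t).
Proof.
move=> H; elim: r => [|t r IH].
  by rewrite big_nil; under eq_fun do rewrite big_nil; exact: is_derive_cst.
rewrite big_cons; under eq_fun do rewrite big_cons.
exact: (is_deriveD (H t) IH).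
Qed.

Lemma contin_bounded_ball (W : set rV) F x0 d : 0 < d ->
  (forall x, `|x0 - x| <= d -> W x) -> contin W F ->
  exists K, forall x, ball x0 d x -> `|F x| <= K.
Proof.
move=> d0 inW cF.
pose A : set rV := closed_ball x0 d.
have AE : A = closed_ball_ Num.norm x0 d by rewrite /A closed_ballE.
have cA : compact A.
  apply: bounded_closed_compact; last exact: closed_ball_closed.
  exists (`|x0| + d); split; first exact: num_real.
  move=> M HM x; rewrite AE /closed_ball_ /= => xd; apply: le_trans (ltW HM).
  rewrite -[x](subKr x0); apply: le_trans (ler_normB _ _) _.
  by rewrite lerD2l.
have [||c cA' Hc] := @EVT_max_rV R n (fun x => `|F x|) A _ cA.
- by exists x0; rewrite AE /closed_ball_ /= subrr normr0 ltW.
- apply: continuous_in_subspaceT => x; rewrite inE AE /closed_ball_ /= => xd.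
  exact: (cvg_norm (cF x (inW x xd))).
exists (`|F c|) => x Bx; apply: Hc; rewrite inE AE /closed_ball_ /=.
by move: Bx; rewrite -ball_normE /ball_ /= => /ltW.
Qed.

Lemma Cinf_bounded_smooth (W B : set rV) F x0 d : 0 < d ->
  (forall x, `|x0 - x| <= d -> W x) -> B `<=` ball x0 d -> Cinf W F ->
  bounded_smooth B F.
Proof.
move=> d0 inW BB CF k; elim: k F CF => [|k IH] F CF.
  split=> //; split.
    move=> x /BB; rewrite -ball_normE /ball_ /= => /ltW /inW.
    exact: Cinf_contin CF x.
  have [K HK] := contin_bounded_ball d0 inW (Cinf_contin CF).
  by exists K => x /BB; exact: HK.
split; first by have := IH F CF; exact: Dk_base.
move=> i; split; last by apply: IH; exact: Cinf_der.
move=> x /BB; rewrite -ball_normE /ball_ /= => /ltW /inW.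
exact: Cinf_derivable CF.
Qed.

Lemma gronwall_segment (u du : R -> R) (C : R) :
  (forall s : R, 0 <= s <= 1 -> is_derive s 1 u (du s)) ->
  (forall s : R, 0 <= s <= 1 -> du s <= C * u s) -> u 1 <= expR C * u 0.
Proof.
move=> Hu Hdu.
pose w (s : R) := expR (- C * s) * u s.
have Hw (s : R) : 0 <= s <= 1 -> is_derive s 1 w (expR (- C * s) * (du s - C * u s)).
  move=> s01; have Hs := Hu s s01.
  have cc : derivable (cst (- C) : R -> R) s 1 by exact: derivable_cst.
  have ci : derivable (@id R) s 1 by exact: derivable_id.
  have lin : derivable (fun z : R => - C * z) s 1 := derivableM cc ci.
  have Dlin : 'D_1 (fun z : R => - C * z) s = - C.
    rewrite [LHS](deriveM cc ci) derive_cst derive_id /GRing.scale /cst /=; ring.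
  have [dE DE] := chain1 (is_derive_expR (- C * s)) lin.
  have [du' Du'] := Hs.
  split; first exact: (derivableM dE du').
  rewrite [LHS](deriveM dE du') DE Dlin Du' /GRing.scale /=; ring.
have [||c c01 E] := @MVT_segment R w (fun s => expR (- C * s) * (du s - C * u s)) 0 1 ler01.
- by move=> s /[!in_itv] /= /andP[s0 s1]; apply: Hw; rewrite !ltW.
- apply: derivable_within_continuous => s /[!in_itv] /= s01.
  by have [] := Hw s s01.
have : w 1 <= w 0.
  rewrite -subr_le0 E subr0 mulr1; apply: mulr_ge0_le0; first exact: expR_ge0.
  by rewrite subr_le0; apply: Hdu; move: c01; rewrite in_itv.
rewrite /w mulr0 expR0 mul1r mulr1 expRN => H.
by rewrite -ler_pdivrMl // expR_gt0.
Qed.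

Lemma sum_pairs (I : finType) (c : R) (a : I -> R) :
  \sum_t \sum_r c * (a t + a r) = c * (2 * #|I|%:R * \sum_t a t).
Proof.
under eq_bigr => t _.
  rewrite -mulr_sumr big_split /= sumr_const -mulr_natr.
  over.
rewrite -mulr_sumr big_split /= -mulr_suml sumr_const -mulr_natr.
by congr (_ * _); ring.
Qed.

Variables (I : finType) (f : I -> rV -> R) (A : 'I_n -> I -> I -> rV -> R).
Variables (i0 : 'I_n) (x0 : rV) (d : R).
Hypothesis (d0 : 0 < d) (x00 : x0 0 i0 = 0).
Local Notation hbox := (hbox i0 x0 d).
Hypothesis f_smooth : forall s, Cinf hbox (f s).
Hypothesis A_smooth : forall i s t, bounded_smooth hbox (A i s t).
Hypothesis f_system : forall i s x, hbox x ->
  'D_(e i) (f s) x = \sum_t A i s t x * f t x.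

Lemma hbox_convex x y (s : R) : hbox x -> hbox y -> 0 <= s <= 1 -> hbox (x + s *: (y - x)).
Proof.
move=> [/(ball_coordP _ _ d0) Bx px] [/(ball_coordP _ _ d0) By py] s01; split.
  apply/ball_coordP => // i.
  have -> : x0 0 i - (x + s *: (y - x)) 0 i = (x0 0 i - x 0 i) + s * (x 0 i - y 0 i).
    by rewrite !mxE; ring.
  by apply: conv_norm_lt => //; rewrite subrKA.
have H1 : - x 0 i0 < 0 by lra.
have H2 : - x 0 i0 + (- (y 0 i0 - x 0 i0)) < 0 by lra.
by have := conv_lt s01 H1 H2; rewrite !mxE mulrN; lra.
Qed.

Lemma system_bounded : exists B, forall s x, hbox x -> `|f s x| <= B.
Proof.
(* Starting point of all segments; [x0] itself lies on the face and not in the half box. *)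
pose y0 : rV := x0 + (d / 2) *: e i0.
have hy0 : hbox y0.
  split; last by rewrite coord_step eqxx mulr1 x00 add0r divr_gt0.
  by apply: step_ball; rewrite gtr0_norm ?divr_gt0 //; move: d0; lra.
have [KK K0 HK] := uniform_bound (fun p : 'I_n * I * I =>
  bounded_smooth_bound (A_smooth p.1.1 p.1.2 p.2)).
have AK i s t x : hbox x -> `|A i s t x| <= KK by exact: (HK (i, s, t)).
have oB := @hbox_open R n i0 x0 d.
pose u x := \sum_t f t x ^+ 2.
(* Entries of [v] are at most 2 d and those of [A] at most [KK]. Bounding 2 |f_t f_r| by f_t^2 +
   f_r^2 and summing over all pairs and over the n directions contributes the remaining factor 2 n
   |I|. *)
pose C := 4 * d * KK * n%:R * #|I|%:R.
have bound x : hbox x -> u x <= expR C * u y0.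
  move=> hx; pose v := x - y0.
  have vd i : `|v 0 i| <= 2 * d.
    move: hx hy0 => [/(ball_coordP _ _ d0) Bx _] [/(ball_coordP _ _ d0) By _].
    have -> : v 0 i = (x0 0 i - y0 0 i) - (x0 0 i - x 0 i) by rewrite /v !mxE; ring.
    apply: le_trans (ler_normB _ _) _.
    by move: (Bx i) (By i); move: `|_| `|_| => a b; lra.
  have hs (s : R) : 0 <= s <= 1 -> hbox (y0 + s *: v) by exact: hbox_convex.
  have Dv t z : hbox z -> 'D_v (f t) z = \sum_i v 0 i * \sum_r A i t r z * f r z.
    move=> hz; rewrite (C1_derive v oB hz (f_smooth t 1)).
    by apply: eq_bigr => i _; rewrite f_system.
  have dv t z : hbox z -> derivable (f t) z v.
    move=> hz; apply: diff_derivable.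
    exact: C1_differentiable oB hz (f_smooth t 1).
  pose g (s : R) := u (y0 + s *: v).
  pose dg (s : R) := \sum_t 2 * f t (y0 + s *: v) * 'D_v (f t) (y0 + s *: v).
  have Hg (s : R) : 0 <= s <= 1 -> is_derive s 1 g (dg s).
    move=> s01; apply: is_derive_bigsum => t.
    have [dl Dl] := line_derive (dv t _ (hs s s01)).
    have E : (fun z : R => f t (y0 + z *: v) ^+ 2) =
      (fun z : R => f t (y0 + z *: v)) * (fun z : R => f t (y0 + z *: v)) by [].
    rewrite E; split; first exact: derivableM.
    by rewrite deriveM // Dl /GRing.scale /=; ring.
  have Hdg (s : R) : 0 <= s <= 1 -> dg s <= C * g s.
    move=> s01; rewrite /dg /g; move: (hs s s01); move: (y0 + s *: v) => z hz.
    have Ht t : 2 * f t z * 'D_v (f t) z <=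
        \sum_(i < n) \sum_r (2 * d * KK) * (f t z ^+ 2 + f r z ^+ 2).
      rewrite Dv // mulr_sumr; apply: ler_sum => i _.
      rewrite mulrA mulr_sumr; apply: ler_sum => r _.
      apply: le_trans (ler_norm _) _.
      rewrite !normrM normr_nat.
      have H1 : `|v 0 i| * `|A i t r z| <= 2 * d * KK by apply: ler_pM => //; exact: AK.
      have H2 : 2 * `|f t z| * `|f r z| <= f t z ^+ 2 + f r z ^+ 2.
        rewrite -[f t z ^+ 2]real_normK ?num_real // -[f r z ^+ 2]real_normK ?num_real //.
        by have := sqr_ge0 (`|f t z| - `|f r z|); rewrite sqrrB; lra.
      have -> : 2 * `|f t z| * `|v 0 i| * (`|A i t r z| * `|f r z|) =
        (`|v 0 i| * `|A i t r z|) * (2 * `|f t z| * `|f r z|) by ring.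
      by apply: ler_pM => //; rewrite !mulr_ge0.
    apply: le_trans (ler_sum _ (fun t _ => Ht t)) _.
    rewrite exchange_big /= sumr_const card_ord sum_pairs -mulr_natl -/(u z).
    by rewrite le_eqVlt; apply/orP; left; apply/eqP; rewrite /C; ring.
  have := gronwall_segment Hg Hdg.
  by rewrite /g scale0r addr0 scale1r /v addrC subrK.
(* From a bound on the square to one on the function: |f| <= 1 + f^2. *)
exists (1 + expR C * u y0) => s x hx.
have := bound x hx; rewrite {1}/u (bigD1 s) //=.
have : 0 <= \sum_(t | t != s) f t x ^+ 2 by apply: sumr_ge0 => t _; exact: sqr_ge0.
rewrite -[f s x ^+ 2]real_normK ?num_real //.
have := sqr_ge0 (`|f s x| - 1); rewrite sqrrB.
have := normr_ge0 (f s x); move: (\sum_(t | _) _) `|f s x| => a b.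
rewrite expr1n mulr1; nra.
Qed.

(** Bootstrap: the system expresses each derivative of a solution by solutions, with coefficients
    that are bounded with all their derivatives. *)
Lemma system_bounded_smooth s : bounded_smooth hbox (f s).
Proof.
have [B HB] := system_bounded.
have oX := @hbox_open R n i0 x0 d; have alg := cont_bounded_algebra oX.
move=> k; elim: k s => [|k IH] s.
  by split=> //; split; [exact: Cinf_contin|exists B => x; exact: HB].
split; first exact: Dk_base (IH s).
move=> i; split=> [x hx|]; first exact: (Cinf_derivable (f_smooth s) hx).
apply: (Dk_ext' oX alg (F := fun x => \sum_t A i s t x * f t x)) => [x hx|].
  exact: f_system.
apply: Dk_sum => // t _; apply: Dk_mul => //; exact: A_smooth.
Qed.

Lemma linear_system_extension s :
  exists2 G, Cinf (ball x0 d) G & forall x, ball x0 d x -> 0 < x 0 i0 -> G x = f s x.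
Proof. exact: half_box_extension (system_bounded_smooth s). Qed.

End LinearSystem.

(** * Prolongation of the equation for zeta *)

Section DeriveRules.
Variables (R : realType) (n : nat).
Local Notation rV := 'rV[R]_n.
Local Notation e i := (delta_mx 0 i : rV).
Variable W : set rV.
Hypothesis oW : open W.
Implicit Types (F G : rV -> R).

Lemma Cinf_deriveD F G i x : Cinf W F -> Cinf W G -> W x ->
  'D_(e i) (fun y => F y + G y) x = 'D_(e i) F x + 'D_(e i) G x.
Proof.
move=> CF CG Wx; exact: (deriveD (Cinf_derivable CF Wx) (Cinf_derivable CG Wx)).
Qed.

Lemma Cinf_deriveM F G i x : Cinf W F -> Cinf W G -> W x ->
  'D_(e i) (fun y => F y * G y) x = F x * 'D_(e i) G x + G x * 'D_(e i) F x.
Proof.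
move=> CF CG Wx; exact: (deriveM (Cinf_derivable CF Wx) (Cinf_derivable CG Wx)).
Qed.

Lemma Cinf_deriveZ c F i x : Cinf W F -> W x ->
  'D_(e i) (fun y => c * F y) x = c * 'D_(e i) F x.
Proof.
move=> CF Wx; rewrite Cinf_deriveM //; last exact: Cinf_cst.
by rewrite derive_cst mulr0 addr0.
Qed.

Lemma Cinf_derive_sum (I : Type) (r : seq I) (F : I -> rV -> R) i x :
  (forall t, Cinf W (F t)) -> W x ->
  'D_(e i) (fun y => \sum_(t <- r) F t y) x = \sum_(t <- r) 'D_(e i) (F t) x.
Proof.
move=> CF Wx.
have H t := derivableP (Cinf_derivable (i := i) (CF t) Wx).
by have [_ ->] := is_derive_bigsum r H.
Qed.

Lemma Cinf_clairaut F i j x : Cinf W F -> W x ->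
  'D_(e i) (fun y => 'D_(e j) F y) x = 'D_(e j) (fun y => 'D_(e i) F y) x.
Proof. by move=> CF Wx; exact: (clairaut i j oW Wx (CF 2%N)). Qed.

End DeriveRules.

(** * Combinations with coefficients regular up to the boundary *)

Section LinearSpan.
Variables (R : realType) (n : nat).
Local Notation rV := 'rV[R]_n.
Local Notation e i := (delta_mx 0 i : rV).
Variables (W B : set rV).
Hypothesis (oW : open W) (oB : open B) (hbox_sub : B `<=` W).

(** The coefficients are smooth on [W], which will contain a neighbourhood of the boundary point,
    while the identity is required on the half box [B] only. This makes precise which terms may
    stand on the right side of the closed system. *)
Definition span (I : finType) (f : I -> rV -> R) (u : rV -> R) :=
  exists2 al : I -> rV -> R, forall t, Cinf W (al t) &
    forall x, B x -> u x = \sum_t al t x * f t x.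

Section OneFamily.
Variables (I : finType) (f : I -> rV -> R).

Lemma span_ext u v : (forall x, B x -> u x = v x) -> span f u -> span f v.
Proof. by move=> uv [al Ca H]; exists al => // x Bx; rewrite -uv ?H. Qed.

Lemma span_add u v : span f u -> span f v -> span f (fun x => u x + v x).
Proof.
move=> [al Ca H] [be Cb K]; exists (fun t x => al t x + be t x) => [t|x Bx].
  exact: Cinf_add.
by rewrite H // K // -big_split; apply: eq_bigr => t _; rewrite mulrDl.
Qed.

Lemma span_mul c u : Cinf W c -> span f u -> span f (fun x => c x * u x).
Proof.
move=> Cc [al Ca H]; exists (fun t x => c x * al t x) => [t|x Bx].
  exact: Cinf_mul.
by rewrite H // mulr_sumr; apply: eq_bigr => t _; rewrite mulrA.
Qed.

Lemma span_scale (c : R) u : span f u -> span f (fun x => c * u x).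
Proof. by apply: span_mul; exact: Cinf_cst. Qed.

Lemma span_sub u v : span f u -> span f v -> span f (fun x => u x - v x).
Proof.
move=> su /(span_scale (-1)) sv; apply: span_ext (span_add su sv) => x _.
by rewrite mulN1r.
Qed.

Lemma span0 : span f (fun _ => 0).
Proof.
exists (fun _ _ => 0) => [t|x _]; first exact: Cinf_cst.
by rewrite big1 // => t _; rewrite mul0r.
Qed.

Lemma span_sum (J : Type) (r : seq J) (u : J -> rV -> R) :
  (forall j, span f (u j)) -> span f (fun x => \sum_(j <- r) u j x).
Proof.
move=> su; elim: r => [|j r IH].
  by apply: span_ext span0 => x _; rewrite big_nil.
by apply: span_ext (span_add (su j) IH) => x _; rewrite big_cons.
Qed.

Lemma span_gen t : span f (f t).
Proof.
exists (fun s _ => (s == t)%:R) => [s|x _]; first exact: Cinf_cst.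
rewrite (bigD1 t) //= eqxx mul1r big1 ?addr0 // => s /negbTE ->.
by rewrite mul0r.
Qed.

Lemma span_Cinf u : (forall t, Cinf B (f t)) -> span f u -> Cinf B u.
Proof.
move=> Cf [al Ca H]; apply: (Cinf_ext (F := fun x => \sum_t al t x * f t x) oB).
  by move=> x Bx; rewrite H.
apply: Cinf_sum => // t _; apply: Cinf_mul => //.
exact: Cinf_subset (Ca t).
Qed.

End OneFamily.

(** Two families are needed because differentiation brings in new unknowns: from zeta to zeta and
    mu, and from these to zeta, mu and rho. *)
Lemma span_derive (I J : finType) (f : I -> rV -> R) (g : J -> rV -> R) u i :
  (forall t, Cinf B (f t)) -> (forall t, span g (f t)) ->
  (forall t, span g (fun x => 'D_(e i) (f t) x)) -> span f u ->
  span g (fun x => 'D_(e i) u x).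
Proof.
move=> Cf sf sD [al Ca H].
have CaB t : Cinf B (al t) by apply: Cinf_subset (Ca t).
apply: (span_ext (u := fun x => \sum_t (al t x * 'D_(e i) (f t) x +
    'D_(e i) (al t) x * f t x))).
  move=> x Bx; rewrite (eq_derive _ oB Bx H) (Cinf_derive_sum (W := B)) //.
    by apply: eq_bigr => t _; rewrite (Cinf_deriveM _ (CaB t) (Cf t) Bx) [_ * f t x]mulrC.
  by move=> t; exact: Cinf_mul.
apply: span_sum => t; apply: span_add; apply: span_mul => //.
exact: Cinf_der.
Qed.

End LinearSpan.

Lemma sum_delta (R : pzSemiRingType) (I : finType) (f : I -> R) k :
  \sum_s f s * (s == k)%:R = f k.
Proof.
rewrite (bigD1 k) //= eqxx mulr1 big1 ?addr0 // => s /negbTE ->; exact: mulr0.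
Qed.

(* Symmetry of the second derivatives of z^ik, contracted over i and solved for
   c m k = D_m mu^k; the trace of D mu stays as a new unknown. *)
Lemma trace_algebra (R : realType) n (a b : 'I_n -> R) (c : 'I_n -> 'I_n -> R) m k :
  (2 <= n)%N ->
  \sum_i (a i + (i == i)%:R * c m k + (i == k)%:R * c m i) =
  \sum_i (b i + (m == i)%:R * c i k + (m == k)%:R * c i i) ->
  c m k = (m == k)%:R * (n%:R^-1 * \sum_i c i i) + n%:R^-1 * \sum_i (b i - a i).
Proof.
move=> hn; rewrite !big_split /=.
have n0 : n%:R != 0 :> R by rewrite pnatr_eq0 -lt0n; exact: ltnW.
have -> : \sum_(i < n) (i == i)%:R * c m k = n%:R * c m k.
  rewrite (eq_bigr (fun=> c m k)) => [|i _]; last by rewrite eqxx mul1r.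
  by rewrite sumr_const card_ord mulr_natl.
have -> : \sum_(i < n) (i == k)%:R * c m i = c m k.
  by rewrite -(sum_delta (c m)); apply: eq_bigr => i _; exact: mulrC.
have -> : \sum_(i < n) (m == i)%:R * c i k = c m k.
  by rewrite -(sum_delta (c^~ k)); apply: eq_bigr => i _; rewrite eq_sym mulrC.
rewrite -mulr_sumr sumrN => S.
apply: (mulfI n0); rewrite mulrDr mulVKf // mulrCA mulVKf //.
by move: S; set X := \sum_i _; set Y := \sum_i _; set Z := \sum_i _; lra.
Qed.

Lemma delta_algebra (R : realType) (b c : bool) (p q r s : R) : b -> ~~ c ->
  b%:R * p + q = c%:R * r + s -> s - q = p.
Proof. by move=> -> /negbTE ->; rewrite mul1r mul0r add0r => <-; rewrite addrK. Qed.

(** * Closing the system for zeta, mu and rho *)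

Section Prolongation.
Variables (R : realType) (n : nat).
Local Notation rV := 'rV[R]_n.
Local Notation e i := (delta_mx 0 i : rV).
Hypothesis hn : (2 <= n)%N.
Variables (i0 : 'I_n) (x0 : rV) (d : R) (W : set rV).
Hypothesis (d0 : 0 < d) (x00 : x0 0 i0 = 0) (oW : open W).
Hypothesis inW : forall x, `|x0 - x| <= d -> W x.
Local Notation B := (hbox i0 x0 d).
Variables (z : 'I_n -> 'I_n -> rV -> R) (mu : 'I_n -> rV -> R).
Variable a : 'I_n -> 'I_n -> 'I_n -> 'I_n -> 'I_n -> rV -> R.
Hypothesis z_smooth : forall j k, Cinf B (z j k).
Hypothesis mu_smooth : forall k, Cinf B (mu k).
Hypothesis a_smooth : forall i j k p q, Cinf W (a i j k p q).
Hypothesis z_system : forall i j k x, B x -> 'D_(e i) (z j k) x =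
  \sum_p \sum_q a i j k p q x * z p q x + (i == j)%:R * mu k x + (i == k)%:R * mu j x.

Let lz i j k x := \sum_p \sum_q a i j k p q x * z p q x.
Let famz (t : 'I_n * 'I_n) := z t.1 t.2.
Let fam0 (t : 'I_n * 'I_n + 'I_n) :=
  match t with inl s => famz s | inr k => mu k end.

Let oB : open B := @hbox_open R n i0 x0 d.

Fact hbox_sub : B `<=` W.
Proof.
move=> x [bx _]; apply: inW; move: bx; rewrite -ball_normE /ball_ /=; exact: ltW.
Qed.
Hint Resolve hbox_sub : core.

(** What [trace_algebra] leaves of D_m mu^k besides its multiple of the identity. Only first
    derivatives of [lz] occur, so it is a combination of zeta and mu. *)
Let e_ m k x := n%:R^-1 * \sum_i
  ('D_(e i) (lz m i k) x - 'D_(e m) (lz i i k) x).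
Let rho x := n%:R^-1 * \sum_i 'D_(e i) (mu i) x.

Let fam (t : 'I_n * 'I_n + 'I_n + unit) :=
  match t with inl s => fam0 s | inr _ => rho end.

Fact famz_smooth t : Cinf B (famz t). Proof. exact: z_smooth. Qed.

Fact fam0_smooth t : Cinf B (fam0 t).
Proof. by case: t => [s|k]; [exact: famz_smooth|exact: mu_smooth]. Qed.

Fact rho_smooth : Cinf B rho.
Proof.
apply: Cinf_mul => //; first exact: Cinf_cst.
by apply: Cinf_sum => // i _; exact: Cinf_der.
Qed.

Fact fam_smooth t : Cinf B (fam t).
Proof. by case: t => [s|[]]; [exact: fam0_smooth|exact: rho_smooth]. Qed.

Fact lz_span i j k : span W B famz (lz i j k).
Proof.
rewrite /lz; apply: span_sum => // p; apply: span_sum => // q.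
by apply: span_mul => //; exact: (span_gen B oW famz (p, q)).
Qed.

Fact lz_smooth i j k : Cinf B (lz i j k).
Proof. exact: (span_Cinf oB hbox_sub famz_smooth (lz_span i j k)). Qed.

Fact z_der i j k x : B x -> 'D_(e i) (z j k) x =
  lz i j k x + (i == j)%:R * mu k x + (i == k)%:R * mu j x.
Proof. exact: z_system. Qed.

Fact z_der_span i j k : span W B fam0 (fun x => 'D_(e i) (z j k) x).
Proof.
have L : span W B fam0 (lz i j k).
  rewrite /lz; apply: span_sum => // p; apply: span_sum => // q.
  by apply: span_mul => //; exact: (span_gen B oW fam0 (inl (p, q))).
have M l : span W B fam0 (mu l) by exact: (span_gen B oW fam0 (inr l)).
apply: (span_ext (u := fun x => lz i j k x + (i == j)%:R * mu k x + (i == k)%:R * mu j x)).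
  by move=> x Bx; rewrite z_der.
by apply: span_add => //; [apply: span_add => //|]; exact: span_scale.
Qed.

Fact lz_der_span m i j k : span W B fam0 (fun x => 'D_(e m) (lz i j k) x).
Proof.
apply: (span_derive oW oB hbox_sub famz_smooth _ _ (lz_span i j k)) => t.
  exact: (span_gen B oW fam0 (inl t)).
exact: z_der_span.
Qed.

Fact e_span m k : span W B fam0 (e_ m k).
Proof.
apply: span_scale => //; apply: span_sum => // i.
by apply: span_sub => //; exact: lz_der_span.
Qed.

Fact e_smooth m k : Cinf B (e_ m k).
Proof. exact: (span_Cinf oB hbox_sub fam0_smooth (e_span m k)). Qed.

Fact z_der2 m i j k x : B x -> 'D_(e m) (fun y => 'D_(e i) (z j k) y) x =
  'D_(e m) (lz i j k) x + (i == j)%:R * 'D_(e m) (mu k) x +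
  (i == k)%:R * 'D_(e m) (mu j) x.
Proof.
move=> Bx; rewrite (eq_derive _ oB Bx (fun y By => z_der i j k By)).
have C1 := Cinf_mul oB (Cinf_cst (i == j)%:R oB) (mu_smooth k).
have C2 := Cinf_mul oB (Cinf_cst (i == k)%:R oB) (mu_smooth j).
rewrite (Cinf_deriveD (W := B) _ (Cinf_add oB (lz_smooth i j k) C1) C2) //.
rewrite (Cinf_deriveD (W := B) _ (lz_smooth i j k) C1) //.
by rewrite !(Cinf_deriveZ oB).
Qed.

Fact mu_der m k x : B x -> 'D_(e m) (mu k) x = (m == k)%:R * rho x + e_ m k x.
Proof.
move=> Bx.
have S : \sum_i 'D_(e m) (fun y => 'D_(e i) (z i k) y) x =
         \sum_i 'D_(e i) (fun y => 'D_(e m) (z i k) y) x.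
  by apply: eq_bigr => i _; exact: (Cinf_clairaut oB).
have S1 : \sum_i 'D_(e m) (fun y => 'D_(e i) (z i k) y) x = \sum_i ('D_(e m) (lz i i k) x +
    (i == i)%:R * 'D_(e m) (mu k) x + (i == k)%:R * 'D_(e m) (mu i) x).
  by apply: eq_bigr => i _; exact: z_der2.
have S2 : \sum_i 'D_(e i) (fun y => 'D_(e m) (z i k) y) x = \sum_i ('D_(e i) (lz m i k) x +
    (m == i)%:R * 'D_(e i) (mu k) x + (m == k)%:R * 'D_(e i) (mu i) x).
  by apply: eq_bigr => i _; exact: z_der2.
exact: (trace_algebra hn (a := fun i => 'D_(e m) (lz i i k) x)
  (b := fun i => 'D_(e i) (lz m i k) x) (c := fun i j => 'D_(e i) (mu j) x)
  (etrans (etrans (esym S1) S) S2)).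
Qed.

Fact fam0_span t : span W B fam (fam0 t).
Proof. exact: (span_gen B oW fam (inl t)). Qed.

Fact fam0_to_fam u : span W B fam0 u -> span W B fam u.
Proof.
move=> [al Ca H]; apply: (span_ext (u := fun x => \sum_t al t x * fam0 t x)).
  by move=> x Bx; rewrite H.
by apply: span_sum => // t; apply: span_mul => //; exact: fam0_span.
Qed.

Fact mu_der_span m k : span W B fam (fun x => 'D_(e m) (mu k) x).
Proof.
apply: (span_ext (u := fun x => (m == k)%:R * rho x + e_ m k x)).
  by move=> x Bx; rewrite mu_der.
apply: span_add => //; last by apply: fam0_to_fam; exact: e_span.
by apply: span_scale => //; exact: (span_gen B oW fam (inr tt)).
Qed.

Fact fam0_der_span m t : span W B fam (fun x => 'D_(e m) (fam0 t) x).
Proof.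
case: t => [s|k]; last exact: mu_der_span.
by apply: fam0_to_fam; exact: z_der_span.
Qed.

Fact e_der_span l m k : span W B fam (fun x => 'D_(e l) (e_ m k) x).
Proof.
apply: (span_derive oW oB hbox_sub fam0_smooth _ _ (e_span m k)) => t.
  exact: fam0_span.
exact: fam0_der_span.
Qed.

Fact mu_der2 l m k x : B x -> 'D_(e l) (fun y => 'D_(e m) (mu k) y) x =
  (m == k)%:R * 'D_(e l) rho x + 'D_(e l) (e_ m k) x.
Proof.
move=> Bx; rewrite (eq_derive _ oB Bx (fun y By => mu_der m k By)).
have C1 := Cinf_mul oB (Cinf_cst (m == k)%:R oB) rho_smooth.
rewrite (Cinf_deriveD (W := B) _ C1 (e_smooth m k)) //.
by rewrite (Cinf_deriveZ oB) //; exact: rho_smooth.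
Qed.

(** Let D_l and D_m act on mu^m with m different from l. In one order the Kronecker delta in front
    of the derivative of rho is 1, in the other it is 0, so D_l rho is isolated. The second index
    exists because n is at least 2. *)
Fact rho_der_span l : span W B fam (fun x => 'D_(e l) rho x).
Proof.
have [m ml] : exists m : 'I_n, m != l.
  have n0 : (0 < n)%N by exact: ltnW.
  have [l0|l0] := eqVneq l (Ordinal n0); last by exists (Ordinal n0); rewrite eq_sym.
  by exists (Ordinal hn); rewrite l0.
apply: (span_ext (u := fun x => 'D_(e m) (e_ l m) x - 'D_(e l) (e_ m m) x)).
  move=> x Bx.
  have E := etrans (esym (mu_der2 l m m Bx)) (etrans (Cinf_clairaut oB l m (mu_smooth m) Bx)
    (mu_der2 m l m Bx)).
  by apply: (delta_algebra _ _ E); [rewrite eqxx|rewrite eq_sym].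
by apply: span_sub => //; exact: e_der_span.
Qed.

Lemma prolongation_extension j k :
  exists2 G, Cinf (ball x0 d) G & forall x, ball x0 d x -> 0 < x 0 i0 -> G x = z j k x.
Proof.
have D (p : 'I_n * ('I_n * 'I_n + 'I_n + unit)) : exists al,
    (forall t, Cinf W (al t)) /\
    forall x, B x -> 'D_(e p.1) (fam p.2) x = \sum_t al t x * fam t x.
  have : span W B fam (fun x => 'D_(e p.1) (fam p.2) x).
    by case: p => i [t|[]]; [exact: fam0_der_span|exact: rho_der_span].
  by move=> [al Ca H]; exists al.
have [A HA] := choice D.
apply: (linear_system_extension (f := fam) (A := fun i s t => A (i, s) t) d0 x00
  fam_smooth _ _ (inl (inl (j, k)))).
- move=> i s t; apply: (Cinf_bounded_smooth d0 inW _ ((HA (i, s)).1 t)).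
  by move=> x [].
- by move=> i s x Bx; have [_ /(_ x Bx)] := HA (i, s).
Qed.

End Prolongation.

(** * Calculus on the half-space and on charts *)

Lemma open_preimage_in (T S : topologicalType) (W : set T) (F : T -> S) (V : set S) :
  open W -> (forall y, W y -> F @ y --> F y) -> open V -> open (W `&` F @^-1` V).
Proof.
move=> oW cF oV; rewrite openE => y [Wy Vy].
exact: (near_and (open_nbhs_nbhs (conj oW Wy)) (cF y Wy _ (open_nbhs_nbhs (conj oV Vy)))).
Qed.

Section HalfSpace.
Variables (R : realType) (n : nat).
Local Notation rV := 'rV[R]_n.
Local Notation e i := (delta_mx 0 i : rV).
Implicit Types (A B : set rV) (f g : rV -> R) (x : rV).

Lemma halfspace_filter_proper x i : halfspace x ->
  ProperFilter (within [set h : R | halfspace (x + h *: e i)] 0^').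
Proof.
move=> hx; apply: Build_ProperFilter_ex => P /nbhs_ballP[r /= r0 rP].
exists (r / 2); apply: rP => /=.
- by rewrite -ball_normE /ball_ /= sub0r normrN gtr0_norm ?divr_gt0 //; lra.
- by rewrite gt_eqF // divr_gt0.
move=> k k0; rewrite coord_step; apply: addr_ge0; first exact: hx.
by rewrite mulr_ge0 // divr_ge0 // ltW.
Qed.

Lemma pd_derive (W : set rV) F f i x : open W -> W x -> halfspace x ->
  (forall y, W y -> halfspace y -> F y = f y) -> derivable F x (e i) ->
  pd i f x = 'D_(e i) F x.
Proof.
move=> oW Wx hx Ff dF.
have PF := halfspace_filter_proper i hx.
apply: cvg_lim => //.
have /nbhs_row_ball [r r0 rW] := near_open oW Wx.
have c : (fun h : R => h^-1 *: ((F \o shift x) (h *: e i) - F x)) @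
    within [set h : R | halfspace (x + h *: e i)] 0^' --> 'D_(e i) F x.
  by apply: cvg_within_filter; exact: dF.
apply: cvg_trans c; apply: near_eq_cvg.
rewrite near_withinE; near=> h => /= hh.
rewrite [h *: e i + x]addrC Ff ?Ff //.
apply: rW; apply: step_ball; near: h; exact: dnbhs0_lt.
Unshelve. all: by end_near. Qed.

Definition rel_open A :=
  A `<=` halfspace /\ forall x, A x -> \forall y \near x, halfspace y -> A y.

Lemma local_extension A f x : rel_open A -> smooth_on A f -> A x ->
  exists W F, [/\ open W, W x, Cinf W F & forall y, W y -> halfspace y -> A y /\ F y = f y].
Proof.
move=> [Ah oA] sf Ax; have [W [F [oW Wx CF Ff]]] := sf x Ax.
have /nbhs_row_ball [r r0 rA] := near_and (near_open oW Wx) (oA x Ax).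
exists (ball x r), F; split.
- exact: ball_open.
- exact: ballxx.
- by apply: Cinf_subset CF => y /rA[].
- move=> y /rA[Wy H] hy; have Ay := H hy; split=> //; exact: Ff.
Qed.

Lemma local_pd A f x : rel_open A -> smooth_on A f -> A x ->
  exists W F, [/\ open W, W x, Cinf W F, (forall y, W y -> halfspace y -> A y /\ F y = f y) &
    forall y i, W y -> halfspace y -> pd i f y = 'D_(e i) F y].
Proof.
move=> oA sf Ax; have [W [F [oW Wx CF WF]]] := local_extension oA sf Ax.
exists W, F; split=> // y i Wy hy; apply: (pd_derive oW) => //.
  by move=> z Wz hz; have [] := WF z Wz hz.
exact: Cinf_derivable CF Wy.
Qed.

Lemma smooth_onI A f : rel_open A -> (forall x, A x -> exists W F, [/\ open W, W x, Cinf W F &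
    forall y, W y -> halfspace y -> A y -> F y = f y]) -> smooth_on A f.
Proof.
move=> [Ah _] H x Ax; have [W [F [oW Wx CF WF]]] := H x Ax.
by exists W, F; split=> // y Wy Ay; apply: WF => //; exact: Ah.
Qed.

Lemma smooth_on_pd A f i : rel_open A -> smooth_on A f -> smooth_on A (pd i f).
Proof.
move=> oA sf; apply: smooth_onI => // x Ax.
have [W [F [oW Wx CF _ WF]]] := local_pd oA sf Ax.
exists W, (fun y => 'D_(e i) F y); split=> //; first exact: Cinf_der.
by move=> y Wy hy _; rewrite WF.
Qed.

Lemma smooth_on_ext A f g : (forall x, A x -> f x = g x) -> smooth_on A f -> smooth_on A g.
Proof.
move=> fg sf x Ax; have [W [F [oW Wx CF WF]]] := sf x Ax.
by exists W, F; split=> // y Wy Ay; rewrite WF // fg.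
Qed.

Lemma smooth_on_sub A B f : B `<=` A -> smooth_on A f -> smooth_on B f.
Proof.
move=> BA sf x Bx; have [W [F [oW Wx CF WF]]] := sf x (BA _ Bx).
by exists W, F; split=> // y Wy By; rewrite WF //; exact: BA.
Qed.

Lemma smooth_on_cst A a : smooth_on A (fun _ => a).
Proof.
move=> x _; exists setT, (fun _ => a); split=> //; first exact: openT.
exact: (Cinf_cst a (@openT _)).
Qed.

Lemma smooth_on2 A f g h : smooth_on A f -> smooth_on A g ->
  (forall W F G, open W -> Cinf W F -> Cinf W G -> (forall y, W y -> A y -> F y = f y) ->
    (forall y, W y -> A y -> G y = g y) ->
    exists2 H, Cinf W H & forall y, W y -> A y -> H y = h y) -> smooth_on A h.
Proof.
move=> sf sg K x Ax.
have [W [F [oW Wx CF WF]]] := sf x Ax; have [V [G [oV Vx CG VG]]] := sg x Ax.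
have [|||||H CH HH] := K (W `&` V) F G.
- exact: openI.
- by apply: Cinf_subset (CF : Cinf W F); exact: subIsetl.
- by apply: Cinf_subset (CG : Cinf V G); exact: subIsetr.
- by move=> y [Wy _]; exact: WF.
- by move=> y [_ Vy]; exact: VG.
by exists (W `&` V), H; split=> //; exact: openI.
Qed.

Lemma smooth_on_add A f g : smooth_on A f -> smooth_on A g -> smooth_on A (fun x => f x + g x).
Proof.
move=> sf sg; apply: (smooth_on2 sf sg) => W F G oW CF CG Ff Gg.
exists (fun x => F x + G x); first exact: Cinf_add.
by move=> y Wy Ay; rewrite Ff ?Gg.
Qed.

Lemma smooth_on_mul A f g : smooth_on A f -> smooth_on A g -> smooth_on A (fun x => f x * g x).
Proof.
move=> sf sg; apply: (smooth_on2 sf sg) => W F G oW CF CG Ff Gg.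
exists (fun x => F x * G x); first exact: Cinf_mul.
by move=> y Wy Ay; rewrite Ff ?Gg.
Qed.

Lemma smooth_on_scale A a f : smooth_on A f -> smooth_on A (fun x => a * f x).
Proof. by move=> sf; apply: smooth_on_mul sf; exact: smooth_on_cst. Qed.

Lemma smooth_on_opp A f : smooth_on A f -> smooth_on A (fun x => - f x).
Proof. by move=> sf; apply: smooth_on_ext (smooth_on_scale (-1) sf) => x _; rewrite mulN1r. Qed.

Lemma smooth_on_sub_fun A f g : smooth_on A f -> smooth_on A g ->
  smooth_on A (fun x => f x - g x).
Proof. by move=> sf sg; apply: smooth_on_add => //; exact: smooth_on_opp. Qed.

Lemma smooth_on_sum A (I : Type) (r : seq I) (P : pred I) (f : I -> rV -> R) :
  (forall t, P t -> smooth_on A (f t)) -> smooth_on A (fun x => \sum_(t <- r | P t) f t x).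
Proof.
move=> sf; elim: r => [|t r IH].
  by apply: smooth_on_ext (@smooth_on_cst A 0) => x _; rewrite big_nil.
have [Pt|nPt] := boolP (P t).
  by apply: smooth_on_ext (smooth_on_add (sf t Pt) IH) => x _; rewrite big_cons Pt.
by apply: smooth_on_ext IH => x _; rewrite big_cons (negbTE nPt).
Qed.

Lemma smooth_on_prod A (I : Type) (r : seq I) (P : pred I) (f : I -> rV -> R) :
  (forall t, P t -> smooth_on A (f t)) -> smooth_on A (fun x => \prod_(t <- r | P t) f t x).
Proof.
move=> sf; elim: r => [|t r IH].
  by apply: smooth_on_ext (@smooth_on_cst A 1) => x _; rewrite big_nil.
have [Pt|nPt] := boolP (P t).
  by apply: smooth_on_ext (smooth_on_mul (sf t Pt) IH) => x _; rewrite big_cons Pt.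
by apply: smooth_on_ext IH => x _; rewrite big_cons (negbTE nPt).
Qed.

Lemma smooth_on_normr_powR A f a : (forall x, A x -> f x != 0) -> smooth_on A f ->
  smooth_on A (fun x => `|f x| `^ a).
Proof.
move=> f0 sf x Ax; have [W [F [oW Wx CF WF]]] := sf x Ax.
have cF := Cinf_contin (CF : Cinf W F) Wx.
have Fx : F x != 0 by rewrite WF ?f0.
have oN : open (W `&` [set y | F y != 0]) :=
  open_preimage_in oW (Cinf_contin (CF : Cinf W F)) (@open_neq _ 0).
exists (W `&` [set y | F y != 0]), (fun y => `|F y| `^ a); split=> //.
  apply: Cinf_normr_powR => //; first by move=> y [].
  exact: (Cinf_subset (@subIsetl _ _ _) (CF : Cinf W F)).
by move=> y [Wy _] Ay; rewrite WF.
Qed.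

Lemma smooth_on_inv A f : (forall x, A x -> f x != 0) -> smooth_on A f ->
  smooth_on A (fun x => (f x)^-1).
Proof.
move=> f0 sf.
apply: smooth_on_ext (smooth_on_mul sf (smooth_on_normr_powR (- 2) f0 sf)) => x Ax.
rewrite powRN powR_mulrn // real_normK ?num_real // expr2 invfM mulrA divff ?mul1r //.
exact: f0.
Qed.

Lemma smooth_on_within_cvg A f x : smooth_on A f -> A x -> f @ within A (nbhs x) --> f x.
Proof.
move=> sf Ax; have [W [F [oW Wx CF WF]]] := sf x Ax.
have cF := Cinf_contin (CF : Cinf W F) Wx; rewrite -WF //.
have c : F @ within A (nbhs x) --> F x by exact: (@cvg_within_filter _ _ _ (nbhs x)).
apply: cvg_trans c; apply: near_eq_cvg.
rewrite near_withinE; apply: near_imp (near_open oW Wx) => y Wy Ay; exact: WF.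
Qed.

Lemma pd_eq A f g i x : rel_open A -> (forall y, A y -> f y = g y) -> smooth_on A f -> A x ->
  pd i f x = pd i g x.
Proof.
move=> oA fg sf Ax; have [W [F [oW Wx CF WF pF]]] := local_pd oA sf Ax.
have hx := oA.1 _ Ax; rewrite pF //; apply/esym/(pd_derive oW) => //.
  by move=> y Wy hy; have [Ay ->] := WF y Wy hy; exact: fg.
exact: Cinf_derivable CF Wx.
Qed.

Lemma pd_cst a i x : halfspace x -> pd i (fun _ => a) x = 0.
Proof.
move=> hx; rewrite (pd_derive (F := cst a) (@openT _)) ?derive_cst //.
Qed.

Section Two.
Variables (A : set rV) (f g : rV -> R) (x : rV).
Hypothesis (oA : rel_open A) (sf : smooth_on A f) (sg : smooth_on A g) (Ax : A x).

Lemma common_extension : exists W F G, [/\ open W, W x, Cinf W F /\ Cinf W G,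
   (forall y, W y -> halfspace y -> F y = f y) & (forall y, W y -> halfspace y -> G y = g y)].
Proof.
have [W [F [oW Wx CF WF]]] := local_extension oA sf Ax.
have [V [G [oV Vx CG VG]]] := local_extension oA sg Ax.
exists (W `&` V), F, G; split=> //; first exact: openI.
- split; first by apply: Cinf_subset CF; exact: subIsetl.
  by apply: Cinf_subset CG; exact: subIsetr.
- by move=> y [Wy _] hy; have [] := WF y Wy hy.
- by move=> y [_ Vy] hy; have [] := VG y Vy hy.
Qed.

Lemma pdD i : pd i (fun y => f y + g y) x = pd i f x + pd i g x.
Proof.
have [W [F [G [oW Wx [CF CG] WF WG]]]] := common_extension; have hx := oA.1 _ Ax.
have dF := Cinf_derivable (i := i) CF Wx; have dG := Cinf_derivable (i := i) CG Wx.
have E y : W y -> halfspace y -> F y + G y = f y + g y by move=> Wy hy; rewrite WF ?WG.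
rewrite (pd_derive oW Wx hx E (Cinf_derivable (i := i) (Cinf_add oW CF CG) Wx)).
by rewrite (Cinf_deriveD _ CF CG Wx) (pd_derive oW Wx hx WF dF) (pd_derive oW Wx hx WG dG).
Qed.

Lemma pdM i : pd i (fun y => f y * g y) x = f x * pd i g x + g x * pd i f x.
Proof.
have [W [F [G [oW Wx [CF CG] WF WG]]]] := common_extension; have hx := oA.1 _ Ax.
have dF := Cinf_derivable (i := i) CF Wx; have dG := Cinf_derivable (i := i) CG Wx.
have E y : W y -> halfspace y -> F y * G y = f y * g y by move=> Wy hy; rewrite WF ?WG.
rewrite (pd_derive oW Wx hx E (Cinf_derivable (i := i) (Cinf_mul oW CF CG) Wx)).
rewrite (Cinf_deriveM _ CF CG Wx) (pd_derive oW Wx hx WF dF) (pd_derive oW Wx hx WG dG).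
by rewrite WF ?WG.
Qed.

Lemma pd_normr_powR i a : f x != 0 ->
  pd i (fun y => `|f y| `^ a) x = a * (`|f x| `^ a * (f x)^-1 * pd i f x).
Proof.
move=> f0; have [W [F [_ [oW Wx [CF _] WF _]]]] := common_extension; have hx := oA.1 _ Ax.
have cF := Cinf_contin CF Wx.
have Fx : F x != 0 by rewrite WF.
have oN : open (W `&` [set y | F y != 0]) :=
  open_preimage_in oW (Cinf_contin CF) (@open_neq _ 0).
have Nx : (W `&` [set y | F y != 0]) x by [].
have CFN : Cinf (W `&` [set y | F y != 0]) F by exact: (Cinf_subset (@subIsetl _ _ _) CF).
rewrite (pd_derive (F := fun y => `|F y| `^ a) oN) //; last first.
- apply: Cinf_derivable Nx; apply: Cinf_normr_powR => //; by move=> y [].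
- by move=> y [Wy _] hy; rewrite WF.
rewrite (pd_derive oW Wx hx WF (Cinf_derivable CF Wx)) -(WF x) //.
have pos y : F y != 0 -> 0 < F y * F y by move=> Fy; rewrite -expr2 exprn_even_gt0.
rewrite (eq_derive (G := fun y => (F y * F y) `^ (a / 2)) _ oN Nx); last first.
  by move=> y _; exact: normr_powR_sqr.
have [_ D] := chain1 (f := fun y => F y * F y) (is_derive1_powR (a / 2) (pos x Fx))
  (Cinf_derivable (i := i) (Cinf_mul oW CF CF) Wx).
rewrite [LHS]D (Cinf_deriveM _ CF CF Wx) normr_powR_sqr powRB ?powRr1 ?ltW ?pos //; last first.
  by apply/implyP => _; rewrite gt_eqF // pos.
by field.
Qed.

End Two.

Lemma pd_sum A (I : Type) (r : seq I) (f : I -> rV -> R) i x : rel_open A ->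
  (forall t, smooth_on A (f t)) -> A x ->
  pd i (fun y => \sum_(t <- r) f t y) x = \sum_(t <- r) pd i (f t) x.
Proof.
move=> oA sf Ax; have hx := oA.1 _ Ax; elim: r => [|t r IH].
  by rewrite big_nil; under eq_fun do rewrite big_nil; exact: pd_cst.
rewrite big_cons -IH; under eq_fun do rewrite big_cons.
by apply: (pdD oA) => //; apply: smooth_on_sum.
Qed.

Lemma family_extension (T : finType) (A : set rV) (f : T -> rV -> R) x : rel_open A ->
  (forall t, smooth_on A (f t)) -> A x ->
  exists (W : set rV) (F : T -> rV -> R), [/\ open W, W x, (forall t, Cinf W (F t)) &
    forall y, W y -> halfspace y -> A y /\ forall t, F t y = f t y].
Proof.
move=> oA sf Ax.
have /choice [WF HWF] : forall t, exists WF : set rV * (rV -> R), [/\ open WF.1, WF.1 x,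
    Cinf WF.1 WF.2 & forall y, WF.1 y -> halfspace y -> A y /\ WF.2 y = f t y].
  by move=> t; have [W [F H]] := local_extension oA (sf t) Ax; exists (W, F).
have N : \forall y \near x, forall t, (WF t).1 y.
  by apply: near_forall => t; have [oW Wx _ _] := HWF t; exact: near_open.
have [r r0 rN] := (nbhs_row_ball _ _).1 (near_and N (oA.2 x Ax)).
exists (ball x r), (fun t => (WF t).2); split.
- exact: ball_open.
- exact: ballxx.
- move=> t; have [_ _ CF _] := HWF t.
  by apply: (Cinf_subset _ CF) => y /rN[H _]; exact: H.
- move=> y /rN[H1 H2] hy; split; first exact: H2.
  by move=> t; have [_ _ _ /(_ y (H1 t) hy)[]] := HWF t.
Qed.

End HalfSpace.

Section HalfSpaceComp.
Variables (R : realType) (n : nat).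
Local Notation rV := 'rV[R]_n.
Local Notation e i := (delta_mx 0 i : rV).
Variables (A B : set rV) (phi : rV -> rV) (f : rV -> R).
Hypothesis (oA : rel_open A) (oB : rel_open B).
Hypothesis (sphi : forall a, smooth_on A (fun y => phi y 0 a)).
Hypothesis (phiAB : forall x, A x -> B (phi x)) (sf : smooth_on B f).

(** An extension [psi] of [phi] may leave the half-space, where [f] carries no information. So [f]
    is extended as well, to an open [V], and [W] is cut down to the preimage of [V]. *)
Lemma comp_extension x : A x -> exists (W V : set rV) (F : rV -> R) (psi : rV -> rV), [/\ open W /\ open V, W x,
    (forall y, W y -> V (psi y)), Cinf V F /\ (forall a, Cinf W (fun y => psi y 0 a)) &
    [/\ (forall y, W y -> halfspace y -> psi y = phi y), V (phi x) &
      (forall y, V y -> halfspace y -> F y = f y)]].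
Proof.
move=> Ax; have [W [psi' [oW Wx Cpsi' HW']]] := family_extension oA sphi Ax.
pose psi y : rV := \row_a psi' a y.
have Cpsi a : Cinf W (fun y => psi y 0 a).
  by apply: Cinf_ext (Cpsi' a) => // y _; rewrite mxE.
have HW y : W y -> halfspace y -> A y /\ psi y = phi y.
  move=> Wy hy; have [Ay E] := HW' y Wy hy; split=> //.
  by apply/rowP => a; rewrite mxE E.
have [V [F [oV Vx CF HV]]] := local_extension oB sf (phiAB Ax).
have [_ Ex] := HW x Wx (oA.1 _ Ax).
have cpsi y : W y -> psi @ y --> psi y.
  by move=> Wy; apply: (@row_cvg _ _ _ (nbhs y)) => a; exact: (Cinf_contin (Cpsi a) Wy).
have oWV : open (W `&` psi @^-1` V).
  exact: open_preimage_in.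
exists (W `&` psi @^-1` V), V, F, psi; split=> //.
- by split=> //=; rewrite Ex.
- by move=> y [].
- by split=> // a; apply: Cinf_subset (Cpsi a) => y [].
- split=> // [y [Wy _] hy|y Vy hy]; first by have [] := HW y Wy hy.
  by have [] := HV y Vy hy.
Qed.

Lemma smooth_on_comp : smooth_on A (f \o phi).
Proof.
apply: smooth_onI => // x Ax.
have [W [V [F [psi [[oW oV] Wx WV [CF Cpsi] [E Vx FV]]]]]] := comp_extension Ax.
exists W, (F \o psi); split=> //; first exact: (Cinf_comp oW oV WV Cpsi CF).
move=> y Wy hy Ay; have Ey := E y Wy hy; have Vy := WV y Wy; rewrite /= Ey.
rewrite Ey in Vy; apply: FV => //; exact: oB.1 _ (phiAB Ay).
Qed.

Lemma pd_comp x i : A x -> pd i (f \o phi) x =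
  \sum_a pd a f (phi x) * pd i (fun y => phi y 0 a) x.
Proof.
move=> Ax; have hx := oA.1 _ Ax.
have [W [V [F [psi [[oW oV] Wx WV [CF Cpsi] [E Vx FV]]]]]] := comp_extension Ax.
have Wn : \forall y \near x, W y /\ (halfspace y -> A y).
  exact: near_and (near_open oW Wx) (oA.2 x Ax).
have [r r0 rW] := (nbhs_row_ball _ _).1 Wn.
have oW' : open (ball x r) by exact: ball_open.
have Wx' : ball x r x by exact: ballxx.
have Vp : V (psi x) := WV x Wx.
have [dc Dc] := chain_rule oV (CF 1%N) Vp (fun a => Cinf_derivable (i := i) (Cpsi a) Wx).
rewrite (pd_derive (F := F \o psi) oW' Wx' hx _ dc); last first.
  move=> y /rW[Wy hA] hy; have Ay := hA hy; rewrite /= E //.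
  by apply: FV; [rewrite -E //; exact: WV|exact: oB.1 _ (phiAB Ay)].
rewrite [LHS]Dc; apply: eq_bigr => a _; rewrite mulrC; congr (_ * _).
  have hp := oB.1 _ (phiAB Ax).
  by rewrite (pd_derive oV Vx hp FV (Cinf_derivable CF Vx)) E.
apply/esym/(pd_derive oW Wx hx) => [y Wy hy|]; first by rewrite E.
exact: (Cinf_derivable (Cpsi a) Wx).
Qed.

End HalfSpaceComp.

(** * Smooth functions, partial derivatives and Jacobians in charts *)

Section Charts.
Variables (R : realType) (n : nat) (M : bmanifold R n).
Local Notation chartM := (chart R n M).
Implicit Types (U V : set M) (c d : chartM) (p q : M) (f g : M -> R).

Definition chart_image c U := coord c @` (U `&` dom c).

Lemma dom_open c : atlas c -> open (dom c).
Proof. by move=> /bm_chart[]. Qed.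

Lemma pointK c p : atlas c -> dom c p -> point c (coord c p) = p.
Proof. by move=> /bm_chart[_ _ H _ _]; exact: H. Qed.

Lemma chart_imageP c U x : atlas c -> chart_image c U x ->
  [/\ U (point c x), dom c (point c x) & coord c (point c x) = x].
Proof. by move=> hc [q [Uq dq] <-]; rewrite pointK. Qed.

Lemma chart_image_mem c U p : U p -> dom c p -> chart_image c U (coord c p).
Proof. by move=> Up dp; exists p. Qed.

Lemma coord_cvgM c p : atlas c -> dom c p -> coord c @ p --> coord c p.
Proof.
move=> hc dp; have [oc _ _ cc _] := bm_chart hc.
have := (subspace_continuousP _ _).1 cc p dp.
by rewrite (within_interior) //; exact: open_nbhs_nbhs.
Qed.

Lemma chart_image_rel_open c U : atlas c -> open U -> rel_open (chart_image c U).
Proof.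
move=> hc oU; have [oc [W oW EW] pc _ cp] := bm_chart hc.
split=> [x [q [Uq dq] <-]|x [q [Uq dq] <-]].
  have : (coord c @` dom c) (coord c q) by exists q.
  by rewrite EW => -[].
have im : (coord c @` dom c) (coord c q) by exists q.
have cvp : point c @ within (coord c @` dom c) (nbhs (coord c q)) --> point c (coord c q).
  exact: (subspace_continuousP _ _).1 cp _ im.
rewrite pc // in cvp.
have Wq : W (coord c q) by move: im; rewrite EW => -[].
have H : \forall y \near coord c q, (coord c @` dom c) y -> U (point c y).
  exact: (cvp U (open_nbhs_nbhs (conj oU Uq))).
apply: near_imp (near_and (near_open oW Wq) H) => y [Wy Hy] hy.
have imy : (coord c @` dom c) y by rewrite EW.
have := Hy imy; case: imy => q' dq' <-; rewrite pc // => Uq'.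
by exists q'.
Qed.

Lemma near_point c U p (Q : set 'rV[R]_n) : atlas c -> open U -> U p -> dom c p ->
  (\forall x \near coord c p, chart_image c U x -> Q x) ->
  \forall q \near p, Q (coord c q).
Proof.
move=> hc oU Up dp HQ.
have H := coord_cvgM hc dp HQ.
have N := near_and (open_nbhs_nbhs (conj oU Up)) (open_nbhs_nbhs (conj (dom_open hc) dp)).
by apply: near_imp (near_and N H) => q [[Uq dq] Hq]; apply: Hq; exact: chart_image_mem.
Qed.

Lemma smooth_in_cvg c U f p : atlas c -> open U -> U p -> dom c p -> smooth_in U c f ->
  f @ p --> f p.
Proof.
move=> hc oU Up dp sf; apply: cvg_at_dist => eps eps0.
have := smooth_on_within_cvg sf (chart_image_mem Up dp).
move=> /cvgrPdist_le /(_ eps eps0); rewrite near_withinE => H.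
have N := near_and (open_nbhs_nbhs (conj oU Up)) (open_nbhs_nbhs (conj (dom_open hc) dp)).
apply: near_imp (near_and N (near_point hc oU Up dp H)) => q [[Uq dq]].
by rewrite /= !pointK.
Qed.

Lemma smooth_in_ext c U f g : atlas c -> (forall q, U q -> dom c q -> f q = g q) ->
  smooth_in U c f -> smooth_in U c g.
Proof.
move=> hc fg; apply: smooth_on_ext => x /(chart_imageP hc)[Ux dx _]; exact: fg.
Qed.

Lemma smooth_in_subset c U V f : V `<=` U -> smooth_in U c f -> smooth_in V c f.
Proof. by move=> VU; apply: smooth_on_sub => x [q [/VU Uq dq] <-]; exists q. Qed.

Lemma smooth_in_cst c U a : smooth_in U c (fun _ => a).
Proof. exact: smooth_on_cst. Qed.

Lemma smooth_in_add c U f g : smooth_in U c f -> smooth_in U c g ->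
  smooth_in U c (fun q => f q + g q).
Proof. exact: smooth_on_add. Qed.

Lemma smooth_in_sub c U f g : smooth_in U c f -> smooth_in U c g ->
  smooth_in U c (fun q => f q - g q).
Proof. exact: smooth_on_sub_fun. Qed.

Lemma smooth_in_opp c U f : smooth_in U c f -> smooth_in U c (fun q => - f q).
Proof. exact: smooth_on_opp. Qed.

Lemma smooth_in_mul c U f g : smooth_in U c f -> smooth_in U c g ->
  smooth_in U c (fun q => f q * g q).
Proof. exact: smooth_on_mul. Qed.

Lemma smooth_in_sum c U (I : Type) (r : seq I) (P : pred I) (f : I -> M -> R) :
  (forall t, P t -> smooth_in U c (f t)) -> smooth_in U c (fun q => \sum_(t <- r | P t) f t q).
Proof. exact: smooth_on_sum. Qed.

Lemma smooth_in_prod c U (I : Type) (r : seq I) (P : pred I) (f : I -> M -> R) :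
  (forall t, P t -> smooth_in U c (f t)) -> smooth_in U c (fun q => \prod_(t <- r | P t) f t q).
Proof. exact: smooth_on_prod. Qed.

Lemma smooth_in_det c U m (A : M -> 'M[R]_m) :
  (forall i j, smooth_in U c (fun q => A q i j)) -> smooth_in U c (fun q => \det (A q)).
Proof.
move=> sA; apply: smooth_in_sum => s _; apply: smooth_in_mul; first exact: smooth_in_cst.
by apply: smooth_in_prod => i _.
Qed.

Lemma smooth_in_normr_powR c U f a : atlas c -> (forall q, U q -> dom c q -> f q != 0) ->
  smooth_in U c f -> smooth_in U c (fun q => `|f q| `^ a).
Proof.
move=> hc f0; apply: smooth_on_normr_powR => x /(chart_imageP hc)[Ux dx _]; exact: f0.
Qed.

Lemma smooth_in_inv c U f : atlas c -> (forall q, U q -> dom c q -> f q != 0) ->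
  smooth_in U c f -> smooth_in U c (fun q => (f q)^-1).
Proof.
move=> hc f0; apply: smooth_on_inv => x /(chart_imageP hc)[Ux dx _]; exact: f0.
Qed.

Lemma smooth_in_dc c U f i : atlas c -> open U -> smooth_in U c f ->
  smooth_in U c (dc c i f).
Proof.
move=> hc oU sf; have oA := chart_image_rel_open hc oU.
apply: smooth_on_ext (smooth_on_pd i oA sf) => x /(chart_imageP hc)[_ _ E].
by rewrite /= /dc E.
Qed.

Section Rules.
Variables (c : chartM) (U : set M) (p : M) (i : 'I_n).
Hypothesis (hc : atlas c) (oU : open U) (Up : U p) (dp : dom c p).
Let oA := chart_image_rel_open hc oU.
Let Ax := chart_image_mem Up dp.

Lemma dc_ext f g : (forall q, U q -> dom c q -> f q = g q) -> smooth_in U c f ->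
  dc c i f p = dc c i g p.
Proof.
move=> fg sf; apply: (pd_eq _ oA) => // x /(chart_imageP hc)[Ux dx _]; exact: fg.
Qed.

Lemma dc_cst a : dc c i (fun _ => a) p = 0.
Proof. by apply: pd_cst; exact: oA.1. Qed.

Lemma dcM f g : smooth_in U c f -> smooth_in U c g ->
  dc c i (fun q => f q * g q) p = f p * dc c i g p + g p * dc c i f p.
Proof. by move=> sf sg; rewrite [LHS](pdM oA sf sg Ax) /= pointK. Qed.

Lemma dcZ a f : smooth_in U c f -> dc c i (fun q => a * f q) p = a * dc c i f p.
Proof. by move=> sf; rewrite dcM // ?dc_cst ?mulr0 ?addr0 //; exact: smooth_in_cst. Qed.

Lemma dc_sum (I : Type) (r : seq I) (f : I -> M -> R) : (forall t, smooth_in U c (f t)) ->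
  dc c i (fun q => \sum_(t <- r) f t q) p = \sum_(t <- r) dc c i (f t) p.
Proof. by move=> sf; exact: (pd_sum r i oA sf Ax). Qed.

Lemma dc_normr_powR f a : smooth_in U c f -> f p != 0 ->
  dc c i (fun q => `|f q| `^ a) p = a * (`|f p| `^ a * (f p)^-1 * dc c i f p).
Proof.
move=> sf f0; have := @pd_normr_powR R n _ (f \o point c) (f \o point c) _ oA sf sf Ax i a.
by rewrite /= pointK //; apply.
Qed.

End Rules.

Lemma transition_smooth c d a : atlas c -> atlas d ->
  smooth_in (dom d) c (fun q => coord d q 0 a).
Proof.
move=> hc hd; have := bm_smooth hc hd a.
by rewrite /smooth_in setIC.
Qed.

Section Change.
Variables (c d : chartM) (U : set M) (f : M -> R).
Hypothesis (hc : atlas c) (hd : atlas d) (oU : open U) (sf : smooth_in U d f).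

Let V := U `&` dom d.
Let oV : open V. Proof. by apply: openI => //; exact: dom_open. Qed.
Let oA := chart_image_rel_open hc oV.
Let oB := chart_image_rel_open hd oU.
Let phi x := coord d (point c x).

Let sphi a : smooth_on (chart_image c V) (fun y => phi y 0 a).
Proof.
apply: smooth_on_sub (transition_smooth a hc hd) => x [q [[Uq ddq] dq] <-].
by exists q.
Qed.

Let phiAB x : chart_image c V x -> chart_image d U (phi x).
Proof. by move=> /(chart_imageP hc)[[Ux ddx] dx _]; exists (point c x). Qed.

Let phiE x : chart_image c V x -> (f \o point d) (phi x) = (f \o point c) x.
Proof. by move=> /(chart_imageP hc)[[Ux ddx] dx _]; rewrite /= /phi pointK. Qed.

Lemma smooth_in_change : smooth_in (U `&` dom d) c f.
Proof.
apply: smooth_on_ext (smooth_on_comp oA oB sphi phiAB sf) => x Ax.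
by rewrite -phiE.
Qed.

Lemma dc_chain i p : U p -> dom c p -> dom d p ->
  dc c i f p = \sum_a dc d a f p * jac c d p a i.
Proof.
move=> Up dp ddp; have Ax : chart_image c V (coord c p) by exact: chart_image_mem.
rewrite /dc -(pd_eq i oA phiE (smooth_on_comp oA oB sphi phiAB sf) Ax).
rewrite (pd_comp oA oB sphi phiAB sf i Ax); apply: eq_bigr => a _.
by rewrite mxE /dc /phi pointK.
Qed.

End Change.

Lemma jac_chain c d e p : atlas c -> atlas d -> atlas e -> dom c p -> dom d p -> dom e p ->
  jac c e p = jac d e p *m jac c d p.
Proof.
move=> hc hd he dp ddp dep; apply/matrixP => a i; rewrite !mxE.
rewrite (dc_chain hc hd (dom_open he) (transition_smooth a hd he)) //.
by apply: eq_bigr => b _; rewrite !mxE.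
Qed.

Lemma jac_id c p : atlas c -> dom c p -> jac c c p = 1%:M.
Proof.
move=> hc dp; apply/matrixP => a i; rewrite !mxE /dc.
have oA := chart_image_rel_open hc (dom_open hc).
have Ax : chart_image c (dom c) (coord c p) by exact: chart_image_mem.
rewrite (pd_eq (g := fun x => x 0 a) i oA _ (transition_smooth a hc hc) Ax).
  have [dx Dx] := derive_coord (coord c p) a i.
  by rewrite (pd_derive (F := fun x => x 0 a) (@openT _)) ?Dx ?[a == i]eq_sym //; exact: oA.1.
by move=> x /(chart_imageP hc)[_ _ /= ->].
Qed.

Lemma jacK c d p : atlas c -> atlas d -> dom c p -> dom d p -> jac d c p *m jac c d p = 1%:M.
Proof. by move=> hc hd dp ddp; rewrite -jac_chain // jac_id. Qed.

Lemma jac_unit c d p : atlas c -> atlas d -> dom c p -> dom d p -> jac c d p \in unitmx.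
Proof. by move=> hc hd dp ddp; have /mulmx1_unit[] := jacK hc hd dp ddp. Qed.

Lemma smooth_in_jac c d a i : atlas c -> atlas d -> smooth_in (dom d) c (fun q => jac c d q a i).
Proof.
move=> hc hd; have oc := dom_open hd.
apply: smooth_in_ext (smooth_in_dc i hc oc (transition_smooth a hc hd)) => // q _ _.
by rewrite mxE.
Qed.

(** * Invariance of the boundary and density of the interior *)

Section Boundary.
Variable i0 : 'I_n.
Hypothesis i00 : val i0 = 0%N.

Lemma coord_ge0 c p : atlas c -> dom c p -> 0 <= coord c p 0 i0.
Proof.
move=> hc dp; have := (chart_image_rel_open hc (dom_open hc)).1 _ (chart_image_mem dp dp).
exact.
Qed.

(** If the coordinate [i0] vanished at [p] in [d] but were positive in [c], then [coord d] in
    direction [i0], which is nonnegative, would have a minimum at a point interior to the half-space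
    of [c]. A whole row of an invertible Jacobian would be zero. *)
Lemma boundaryP c p : atlas c -> dom c p -> bm_boundary p <-> coord c p 0 i0 = 0.
Proof.
move=> hc dp; split=> [[d [hd ddp [i [i1 di]]]]|H]; last by exists c; split=> //; exists i0.
have {i i1 di} dz : coord d p 0 i0 = 0.
  by rewrite -di; congr (coord d p 0 _); apply: val_inj; rewrite /= i00 i1.
apply/eqP; have := coord_ge0 hc dp; rewrite le_eqVlt => /orP[/eqP <- //|cpos].
exfalso.
have oA := chart_image_rel_open hc (dom_open hd).
have Ax : chart_image c (dom d) (coord c p) by exact: chart_image_mem.
have sf := transition_smooth i0 hc hd.
have row0 i : jac c d p i0 i = 0.
  rewrite mxE /dc; have [W [F [oW Wx CF WF pF]]] := local_pd oA sf Ax.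
  have hx := oA.1 _ Ax; rewrite pF //.
  have N : \forall y \near coord c p, W y /\ 0 < y 0 i0.
    apply: near_and; first exact: near_open.
    exact: (cvgr_gt _ (@coord_cvg _ _ (coord c p) i0) 0 cpos).
  have [r r0 rN] := (nbhs_row_ball _ _).1 N.
  have inb (t : R) : t \in `](- r), r[ -> W (coord c p + t *: delta_mx 0 i) /\
      halfspace (coord c p + t *: delta_mx 0 i).
    rewrite in_itv /= -ltr_norml => tr; have [Wt pt] := rN _ (step_ball (coord c p) i tr).
    split=> // k k0; have -> : k = i0 by apply: val_inj; rewrite /= i00 k0.
    exact: ltW.
  pose G (t : R) := F (coord c p + t *: delta_mx 0 i).
  have dG t : t \in `](- r), r[ -> derivable G t 1.
    move=> /inb[Wt _]; have := line_derive (Cinf_derivable (i := i) CF Wt).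
    by move=> [].
  have z0 : 0 \in `](- r), r[ by rewrite in_itv /= oppr_lt0 r0.
  have G0 t : t \in `](- r), r[ -> G 0 <= G t.
    move=> tr; have [W0 h0] := inb _ z0; have [Wt ht] := inb _ tr.
    have [A0 E0] := WF _ W0 h0; have [At Et] := WF _ Wt ht.
    rewrite /G E0 Et /= scale0r addr0 pointK // dz.
    by have [? ? _] := chart_imageP hc At; exact: coord_ge0.
  have rr : - r <= r by lra.
  have [_ D0] := derive1_at_min rr dG z0 G0.
  have Wx' : W (coord c p + 0 *: delta_mx 0 i) by have [] := inb _ z0.
  have [_ D1] := line_derive (Cinf_derivable (i := i) CF Wx').
  by rewrite scale0r addr0 in D1; rewrite -D1; exact: D0.
have := jac_unit hc hd dp ddp; rewrite unitmxE unitfE (expand_det_row _ i0).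
by rewrite big1 ?eqxx // => i _; rewrite row0 mul0r.
Qed.

Lemma interiorP c p : atlas c -> dom c p -> bm_interior p <-> 0 < coord c p 0 i0.
Proof.
move=> hc dp; rewrite /bm_interior /=; split=> [np|p0].
  rewrite lt0r coord_ge0 // andbT; apply/eqP => E.
  by apply: np; apply/(boundaryP hc dp).
by move=> /(boundaryP hc dp) E; rewrite E ltxx in p0.
Qed.

Lemma interior_open : open (bm_interior : set M).
Proof.
rewrite openE => p ip; have [c hc dp] := bm_cover p.
have p0 := (interiorP hc dp).1 ip.
have c0 : (fun q => coord c q 0 i0) @ p --> coord c p 0 i0.
  exact: (@cvg_comp _ _ _ (coord c) (fun y : 'rV[R]_n => y 0 i0) (nbhs p) (nbhs (coord c p))
     _ (coord_cvgM hc dp) (@coord_cvg _ _ (coord c p) i0)).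
have N := near_and (open_nbhs_nbhs (conj (dom_open hc) dp)) (cvgr_gt _ c0 0 p0).
apply: (@near_imp M p (fun q => dom c q /\ 0 < coord c q 0 i0) bm_interior _ (N _)).
by move=> q [dq q0]; apply/(interiorP hc dq).
Qed.

Lemma interior_dense p U : open U -> U p -> exists q, U q /\ bm_interior q.
Proof.
move=> oU Up; have [c hc dp] := bm_cover p.
have [Ah oA] := chart_image_rel_open hc oU.
have Ax := chart_image_mem Up dp.
have [r r0 rA] := (nbhs_row_ball _ _).1 (oA _ Ax).
pose y := coord c p + (r / 2) *: delta_mx 0 i0.
have yb : ball (coord c p) r y by apply: step_ball; rewrite gtr0_norm; lra.
have y0 : 0 < y 0 i0.
  by rewrite /y coord_step eqxx mulr1; have := coord_ge0 hc dp; lra.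
have hy : halfspace y.
  by move=> k k0; have -> : k = i0 by [apply: val_inj; rewrite /= i00 k0]; exact: ltW.
have [Uq dq E] := chart_imageP hc (rA _ yb hy).
by exists (point c y); split=> //; apply/(interiorP hc dq); rewrite E.
Qed.

Lemma interior_filter_proper p : ProperFilter (within bm_interior (nbhs p)).
Proof.
apply: Build_ProperFilter_ex => Q; rewrite /within /= => HQ.
have : nbhs p (interior (fun q => bm_interior q -> Q q)) by exact: nbhs_interior.
rewrite nbhsE => -[V [oV Vp] VQ].
have [q [Vq iq]] := interior_dense oV Vp.
by exists q; have /nbhs_singleton := VQ q Vq; apply.
Qed.

(** Identities that involve the metric are available on the interior only; this is how they reach
    the boundary. *)
Lemma eq_by_density (U : set M) f g p : open U -> U p -> f @ p --> f p -> g @ p --> g p ->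
  (forall q, U q -> bm_interior q -> f q = g q) -> f p = g p.
Proof.
move=> oU Up cf cg fg; have PF := interior_filter_proper p.
have cf' : f @ within bm_interior (nbhs p) --> f p by exact: (@cvg_within_filter _ _ _ (nbhs p)).
have cg' : g @ within bm_interior (nbhs p) --> g p by exact: (@cvg_within_filter _ _ _ (nbhs p)).
apply: (cvg_unique _ _ cg') => //; apply: cvg_trans cf'; apply: near_eq_cvg.
rewrite near_withinE; apply: near_imp (open_nbhs_nbhs (conj oU Up)) => q Uq iq.
exact: fg.
Qed.

End Boundary.

End Charts.

(** * Densities of the metric *)

Section Jacobi.
Variables (R : realType) (n : nat) (M : bmanifold R n).
Variables (c : chart R n M) (U : set M) (p : M) (i : 'I_n).
Hypothesis (hc : atlas c) (oU : open U) (Up : U p) (dp : dom c p).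

Lemma dc_prod (I : eqType) (r : seq I) (f : I -> M -> R) : uniq r ->
  (forall t, smooth_in U c (f t)) ->
  dc c i (fun q => \prod_(t <- r) f t q) p =
  \sum_(t <- r) dc c i (f t) p * \prod_(s <- r | s != t) f s p.
Proof.
move=> + sf; elim: r => [_|t r IH /= /andP[tr ur]].
  by rewrite big_nil; under eq_fun do rewrite big_nil; exact: (dc_cst i hc oU Up dp).
under eq_fun do rewrite big_cons.
rewrite (dcM _ hc oU Up dp) //; last by apply: smooth_in_prod.
rewrite IH // big_cons addrC; congr (_ + _).
  rewrite mulrC; congr (_ * _); rewrite big_cons eqxx /= big_seq [RHS]big_seq_cond.
  by apply: eq_bigl => s; case: (boolP (s \in r)) => //= sr; apply/esym; apply: contraNneq tr => <-.
rewrite mulr_sumr; apply: eq_big_seq => s sr.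
rewrite big_cons; have -> : t != s by apply/eqP => ts; rewrite ts sr in tr.
by rewrite mulrCA.
Qed.

(** Differentiating the factor from row [a] in the Leibniz formula gives the determinant with that
    row replaced by its derivative, and expansion along the row produces the cofactors. *)
Lemma dc_det m (A : M -> 'M[R]_m) : (forall a b, smooth_in U c (fun q => A q a b)) ->
  dc c i (fun q => \det (A q)) p =
  \sum_a \sum_b dc c i (fun q => A q a b) p * cofactor (A p) a b.
Proof.
move=> sA; pose DA : 'M[R]_m := \matrix_(a, b) dc c i (fun q => A q a b) p.
have E : dc c i (fun q => \det (A q)) p =
  \sum_(s : 'S_m) \sum_a (-1) ^+ s * (DA a (s a) * \prod_(b | b != a) A p b (s b)).
  rewrite /determinant (dc_sum _ hc oU Up dp); last first.
    move=> s; apply: smooth_in_mul; first exact: smooth_in_cst.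
    by apply: smooth_in_prod => b _.
  apply: eq_bigr => s _; rewrite (dcZ _ hc oU Up dp); last by apply: smooth_in_prod => b _.
  rewrite dc_prod ?index_enum_uniq // mulr_sumr; apply: eq_bigr => a _.
  by rewrite mxE.
rewrite E exchange_big; apply: eq_bigr => a _.
pose B : 'M[R]_m := \matrix_(k, l) (if k == a then DA k l else A p k l).
have -> : \sum_(s : 'S_m) (-1) ^+ s * (DA a (s a) * \prod_(b | b != a) A p b (s b)) = \det B.
  apply: eq_bigr => s _; congr (_ * _); rewrite [RHS](bigD1 a) //= [B a _]mxE eqxx; congr (_ * _).
  by apply: eq_bigr => b /negbTE ba; rewrite [B b _]mxE ba.
rewrite (expand_det_row _ a); apply: eq_bigr => b _; rewrite !mxE eqxx; congr (_ * _).
rewrite /cofactor; congr (_ * \det _); apply/matrixP => k l; rewrite !mxE.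
by rewrite eq_sym (negbTE (neq_lift a k)).
Qed.

Lemma dc_det_unit m (A : M -> 'M[R]_m) : (forall a b, smooth_in U c (fun q => A q a b)) ->
  A p \in unitmx -> dc c i (fun q => \det (A q)) p =
  \det (A p) * \sum_a \sum_b dc c i (fun q => A q a b) p * invmx (A p) b a.
Proof.
move=> sA Au; rewrite dc_det // mulr_sumr; apply: eq_bigr => a _.
rewrite mulr_sumr; apply: eq_bigr => b _; rewrite /invmx Au !mxE.
have d0 : \det (A p) != 0 by move: Au; rewrite unitmxE unitfE.
by rewrite [in RHS]mulrCA mulVKf.
Qed.

End Jacobi.

(** * Volume, tau and zeta of the metric *)

Section Metric.
Variables (R : realType) (n : nat) (M : bmanifold R n).
Variable (i0 : 'I_n).
Hypothesis i00 : val i0 = 0%N.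
Variables (g : chart R n M -> M -> 'M[R]_n) (nabla : connection M).
Hypothesis (hg : pseudo_metric bm_interior g) (hnabla : levi_civita bm_interior g nabla).
Local Notation IM := (bm_interior : set M).
Let oI : open IM := @interior_open R n M i0 i00.

Section Chart.
Variable c : chart R n M.
Hypothesis hc : atlas c.

Lemma g_smooth a b : smooth_in IM c (fun q => g c q a b).
Proof. by case: hg => H _ _ _; exact: H. Qed.

Lemma g_unit p : IM p -> dom c p -> g c p \in unitmx.
Proof. by case: hg => _ _ H _ Ip dp; exact: H. Qed.

Lemma detg_neq0 p : IM p -> dom c p -> \det (g c p) != 0.
Proof. by move=> Ip dp; have := g_unit Ip dp; rewrite unitmxE unitfE. Qed.

Lemma detg_smooth : smooth_in IM c (fun q => \det (g c q)).
Proof. by apply: smooth_in_det => a b; exact: g_smooth. Qed.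

Lemma volE p : vol g c p = `|\det (g c p)| `^ (2^-1).
Proof. by rewrite /vol -powR12_sqrt. Qed.

Lemma tauE p : tau g c p = `|\det (g c p)| `^ (- n.+1%:R^-1).
Proof.
rewrite /tau volE -powRrM; congr (_ `^ _).
have n1 : n.+1%:R != 0 :> R by rewrite pnatr_eq0.
by move: (n.+1%:R : R) n1 => N n1; field.
Qed.

Lemma vol_gt0 p : IM p -> dom c p -> 0 < vol g c p.
Proof. by move=> Ip dp; rewrite volE powR_gt0 // normr_gt0 detg_neq0. Qed.

Lemma tau_gt0 p : IM p -> dom c p -> 0 < tau g c p.
Proof. by move=> Ip dp; rewrite tauE powR_gt0 // normr_gt0 detg_neq0. Qed.

Lemma tau_neq0 p : IM p -> dom c p -> tau g c p != 0.
Proof. by move=> Ip dp; rewrite lt0r_neq0 // tau_gt0. Qed.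

Lemma vol_smooth : smooth_in IM c (vol g c).
Proof.
apply: (smooth_in_ext (f := fun q => `|\det (g c q)| `^ (2^-1)) hc).
  by move=> q _ _; rewrite volE.
by apply: smooth_in_normr_powR => //; [exact: detg_neq0|exact: detg_smooth].
Qed.

Lemma tau_smooth : smooth_in IM c (tau g c).
Proof.
apply: (smooth_in_ext (f := fun q => `|\det (g c q)| `^ (- n.+1%:R^-1)) hc).
  by move=> q _ _; rewrite tauE.
by apply: smooth_in_normr_powR => //; [exact: detg_neq0|exact: detg_smooth].
Qed.

Lemma invg_smooth a b : smooth_in IM c (fun q => invmx (g c q) a b).
Proof.
apply: (smooth_in_ext (f := fun q => (\det (g c q))^-1 * cofactor (g c q) b a) hc).
  by move=> q Iq dq; rewrite /invmx g_unit // !mxE.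
apply: smooth_in_mul; first by apply: smooth_in_inv => //; [exact: detg_neq0|exact: detg_smooth].
apply: smooth_in_mul; first exact: smooth_in_cst.
apply: smooth_in_det => k l.
apply: (smooth_in_ext (f := fun q => g c q (lift b k) (lift a l)) hc); last exact: g_smooth.
by move=> q _ _; rewrite !mxE.
Qed.

Lemma zeta_smooth a b : smooth_in IM c (fun q => zeta g c q a b).
Proof.
apply: (smooth_in_ext (f := fun q => (tau g c q)^-1 * invmx (g c q) a b) hc).
  by move=> q _ _; rewrite mxE.
apply: smooth_in_mul; last exact: invg_smooth.
exact: (smooth_in_inv hc tau_neq0 tau_smooth).
Qed.

Lemma invg_sym p : IM p -> dom c p -> (invmx (g c p))^T = invmx (g c p).
Proof. by move=> Ip dp; rewrite trmx_inv; case: hg => _ H _ _; rewrite H. Qed.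

Lemma zeta_sym p : IM p -> dom c p -> (zeta g c p)^T = zeta g c p.
Proof. by move=> Ip dp; rewrite /zeta linearZ /= invg_sym. Qed.

Section Point.
Variable p : M.
Hypothesis (Ip : IM p) (dp : dom c p).
Let gu := g_unit Ip dp.

Definition christoffel_mx (i : 'I_n) : 'M[R]_n := \matrix_(l, j) nabla c p l i j.

Let Dg i : 'M[R]_n := \matrix_(a, b) dc c i (fun q => g c q a b) p.
Let Dinv i : 'M[R]_n := \matrix_(a, b) dc c i (fun q => invmx (g c q) a b) p.

Lemma metric_der i : Dg i = (christoffel_mx i)^T *m g c p + g c p *m christoffel_mx i.
Proof.
apply/matrixP => j k; rewrite !mxE; have [_ H] := hnabla.
have := H c p (And3 hc dp Ip) i j k => /eqP; rewrite subr_eq0 => /eqP ->.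
rewrite big_split /=; congr (_ + _); apply: eq_bigr => l _; rewrite !mxE //.
by rewrite mulrC.
Qed.

Lemma trace_invg i : \sum_a \sum_b Dg i a b * invmx (g c p) b a =
  2 * \sum_e nabla c p e i e.
Proof.
transitivity (\tr (Dg i *m invmx (g c p))).
  by apply: eq_bigr => a _; rewrite !mxE.
rewrite metric_der mulmxDl mxtraceD -[_ *m g c p *m _]mulmxA mulmxV // mulmx1 mxtrace_tr.
have -> : \tr (g c p *m christoffel_mx i *m invmx (g c p)) = \tr (christoffel_mx i).
  by rewrite mxtrace_mulC mulmxA mulVmx // mul1mx.
have -> : \tr (christoffel_mx i) = \sum_e nabla c p e i e.
  by apply: eq_bigr => e _; rewrite !mxE.
by ring.
Qed.

Lemma dc_detg i : dc c i (fun q => \det (g c q)) p =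
  2 * \det (g c p) * \sum_e nabla c p e i e.
Proof.
rewrite (dc_det_unit i hc oI Ip dp (A := g c)) //; last exact: g_smooth.
rewrite [2 * _]mulrC -mulrA; congr (_ * _); rewrite -trace_invg.
by apply: eq_bigr => a _; apply: eq_bigr => b _; rewrite !mxE.
Qed.

Lemma dc_detg_powR i a : dc c i (fun q => `|\det (g c q)| `^ a) p =
  2 * a * `|\det (g c p)| `^ a * \sum_e nabla c p e i e.
Proof.
rewrite (dc_normr_powR _ hc oI Ip dp) ?detg_neq0 //; last exact: detg_smooth.
rewrite dc_detg; have d0 := detg_neq0 Ip dp; by field.
Qed.

Lemma dc_vol i : dc c i (vol g c) p = vol g c p * \sum_e nabla c p e i e.
Proof.
rewrite (dc_ext (g := fun q => `|\det (g c q)| `^ (2^-1)) i hc oI Ip dp) //; last exact: vol_smooth.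
  by rewrite dc_detg_powR -volE divff ?mul1r // pnatr_eq0.
by move=> q _ _; rewrite volE.
Qed.

Lemma dc_tau i : dc c i (tau g c) p = - 2 * wconn nabla c p i * tau g c p.
Proof.
rewrite (dc_ext (g := fun q => `|\det (g c q)| `^ (- n.+1%:R^-1)) i hc oI Ip dp) //.
- by rewrite dc_detg_powR -tauE /wconn; ring.
- by move=> q _ _; rewrite tauE.
- exact: tau_smooth.
Qed.

Lemma invg_der i : Dinv i = - (christoffel_mx i *m invmx (g c p) +
  invmx (g c p) *m (christoffel_mx i)^T).
Proof.
have H : Dinv i *m g c p + invmx (g c p) *m Dg i = 0.
  apply/matrixP => a b; rewrite !mxE -big_split /=.
  transitivity (dc c i (fun q => \sum_k invmx (g c q) a k * g c q k b) p).
    rewrite (dc_sum _ hc oI Ip dp) => [|k].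
      apply: eq_bigr => k _.
      rewrite (dcM _ hc oI Ip dp (invg_smooth a k) (g_smooth k b)) !mxE [RHS]addrC.
      by congr (_ + _); exact: mulrC.
    by apply: smooth_in_mul; [exact: invg_smooth|exact: g_smooth].
  rewrite (dc_ext (g := fun _ => (1%:M : 'M[R]_n) a b) i hc oI Ip dp) ?(dc_cst i hc oI Ip dp) //.
    by move=> q Iq dq; rewrite -(mulVmx (g_unit Iq dq)) mxE.
  by apply: smooth_in_sum => k _; apply: smooth_in_mul; [exact: invg_smooth|exact: g_smooth].
move/eqP: H; rewrite addr_eq0 => /eqP /(congr1 (mulmx^~ (invmx (g c p)))).
rewrite -mulmxA mulmxV // mulmx1 metric_der => ->.
rewrite mulmxDr !mulmxA mulVmx // mul1mx mulNmx mulmxDl -!mulmxA mulmxV // mulmx1.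
by rewrite addrC.
Qed.

(** The inverse metric is parallel, and by [dc_tau] the density tau of weight 2 is parallel too,
    hence so is its inverse of weight -2. *)
Lemma zeta_parallel i a b : nabla_bivector (- 2) nabla (zeta g) c p i a b = 0.
Proof.
have t0 := lt0r_neq0 (tau_gt0 Ip dp).
have := congr1 (fun A : 'M[R]_n => A a b) (invg_der i); rewrite !mxE => Di.
rewrite /nabla_bivector.
rewrite (dc_ext (g := fun q => (tau g c q)^-1 * invmx (g c q) a b) i hc oI Ip dp); last first.
- exact: zeta_smooth.
- by move=> q _ _; rewrite mxE.
have si : smooth_in IM c (fun q => (tau g c q)^-1).
  exact: (smooth_in_inv hc tau_neq0 tau_smooth).
have Dti : dc c i (fun q => (tau g c q)^-1) p = 2 * wconn nabla c p i * (tau g c p)^-1.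
  have E := dcM i hc oI Ip dp tau_smooth si.
  have E1 : dc c i (fun q => tau g c q * (tau g c q)^-1) p = 0.
    rewrite (dc_ext (g := fun _ => 1) i hc oI Ip dp) ?(dc_cst i hc oI Ip dp) //.
      by move=> q Iq dq; rewrite (divff (tau_neq0 Iq dq)).
    by apply: smooth_in_mul => //; exact: tau_smooth.
  rewrite E1 dc_tau in E; apply: (mulfI t0); move: E => /eqP; rewrite eq_sym addr_eq0 => /eqP ->.
  by field.
rewrite (dcM _ hc oI Ip dp si (invg_smooth a b)) Dti Di big_split /=.
have -> : \sum_e nabla c p a i e * zeta g c p e b =
    (tau g c p)^-1 * \sum_j christoffel_mx i a j * invmx (g c p) j b.
  by rewrite mulr_sumr; apply: eq_bigr => e _; rewrite !mxE mulrCA.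
have -> : \sum_e nabla c p b i e * zeta g c p a e =
    (tau g c p)^-1 * \sum_j invmx (g c p) a j * (christoffel_mx i)^T j b.
  by rewrite mulr_sumr; apply: eq_bigr => e _; rewrite !mxE mulrCA [nabla _ _ _ _ _ * _]mulrC.
by rewrite /zeta mxE; ring.
Qed.

(** The determinant is tau^(-n) det g^(-1), and |det g|^(-1) = tau^(n+1). *)
Lemma det_zeta : `|\det (zeta g c p)| = tau g c p.
Proof.
rewrite /zeta detZ det_inv normrM [X in X * _]ger0_norm; last first.
  by rewrite exprn_ge0 // invr_ge0 (ltW (tau_gt0 Ip dp)).
rewrite normfV.
have d0 : 0 < `|\det (g c p)| by rewrite normr_gt0 detg_neq0.
have t0 := lt0r_neq0 (tau_gt0 Ip dp).
have E : `|\det (g c p)|^-1 = tau g c p ^+ n.+1.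
  rewrite tauE -powR_mulrn ?powR_ge0 // -powRrM mulNr mulVf ?pnatr_eq0 // powRN powRr1 //.
by rewrite E exprS mulrCA exprVn mulVf ?mulr1 // expf_neq0.
Qed.

End Point.
End Chart.

Lemma g_transform c d p : at_overlap IM c d p ->
  g c p = (jac c d p)^T *m g d p *m jac c d p.
Proof. by case: hg => _ _ _; exact. Qed.

Lemma detg_transform c d p : at_overlap IM c d p ->
  `|\det (g c p)| = `|\det (jac c d p)| ^+ 2 * `|\det (g d p)|.
Proof.
move=> H; rewrite (g_transform H) !det_mulmx det_tr !normrM; ring.
Qed.

Lemma vol_transform c d p : at_overlap IM c d p -> vol g c p = `|\det (jac c d p)| * vol g d p.
Proof.
move=> H; rewrite !volE (detg_transform H) powRM ?sqr_ge0 // -powR_mulrn // -powRrM.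
by rewrite divff ?pnatr_eq0 // powRr1.
Qed.

Lemma tau_transform c d p : at_overlap IM c d p ->
  tau g c p = (wfactor 2 c d p)^-1 * tau g d p.
Proof.
move=> H; rewrite {1 2}/tau (vol_transform H) powRM // ?sqrtr_ge0 //.
by rewrite powRN.
Qed.

Lemma zeta_transform c d p : at_overlap IM c d p ->
  zeta g d p = wfactor (- 2) c d p *: (jac c d p *m zeta g c p *m (jac c d p)^T).
Proof.
move=> H; have [[hc dp Ip] [hd ddp _]] := H.
have Ju := jac_unit hc hd dp ddp; have Jtu : (jac c d p)^T \in unitmx by rewrite unitmx_tr.
have gdu := g_unit hd Ip ddp.
rewrite /zeta -scalemxAr -scalemxAl scalerA (tau_transform H) (g_transform H).
have -> : jac c d p *m invmx ((jac c d p)^T *m g d p *m jac c d p) *m (jac c d p)^T =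
    invmx (g d p).
  apply: (can_inj (mulKmx gdu)); rewrite mulmxV //.
  apply: (can_inj (mulKmx Jtu)); rewrite mulmx1 !mulmxA.
  set A := _ *m jac c d p; have Au : A \in unitmx by rewrite /A !unitmx_mul Jtu gdu Ju.
  by rewrite mulmxV // mul1mx.
congr (_ *: _); rewrite invfM invrK mulrA -[LHS]mul1r; congr (_ * _).
rewrite /wfactor mulNr powRN mulVf // gt_eqF // powR_gt0 // normr_gt0.
by move: Ju; rewrite unitmxE unitfE.
Qed.

Lemma nabla_preserves_volume : preserves_volume IM nabla.
Proof.
exists (vol g); split.
- split=> [c hc|c d p H]; first exact: vol_smooth.
  have [[hc dp Ip] [hd ddp _]] := H.
  have Ju := jac_unit hc hd dp ddp.
  have n0 : `|\det (jac c d p)| != 0.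
    by move: Ju; rewrite unitmxE unitfE normr_eq0.
  rewrite (vol_transform H) mulrA /wfactor mulNr divff ?pnatr_eq0 // powRN powRr1 //.
  by rewrite mulVf // mul1r.
- by move=> c p [hc dp Ip]; exact: vol_gt0.
- move=> c p [hc dp Ip] i; rewrite /nabla_density dc_vol // /wconn.
  have n1 : n.+1%:R != 0 :> R by rewrite pnatr_eq0.
  by move: (n.+1%:R : R) n1 => N n1; field.
Qed.

End Metric.

(** * Extension of zeta *)

Section LocalCinf.
Variables (R : realType) (n : nat).
Local Notation rV := 'rV[R]_n.
Local Notation e i := (delta_mx 0 i : rV).

Lemma Cinf_local (B : set rV) (f : rV -> R) : open B ->
  (forall x, B x -> exists (W : set rV) (F : rV -> R), [/\ open W, W x, Cinf W F &
    forall y, W y -> F y = f y]) -> Cinf B f.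
Proof.
move=> oB H k; elim: k f H => [|k IH] f H; split=> //.
- move=> x /H[W [F [oW Wx CF Ff]]].
  exact: (Cinf_contin (Cinf_ext oW Ff CF) Wx).
- move=> x /H[W [F [oW Wx CF Ff]]].
  exact: (Cinf_contin (Cinf_ext oW Ff CF) Wx).
move=> i; split=> [x /H[W [F [oW Wx CF Ff]]]|].
  exact: (Cinf_derivable (Cinf_ext oW Ff CF) Wx).
apply: IH => x /H[W [F [oW Wx CF Ff]]].
exists W, (fun y => 'D_(e i) F y); split=> //; first exact: Cinf_der.
by move=> y Wy; exact: (eq_derive _ oW Wy Ff).
Qed.

Lemma smooth_on_Cinf (A B : set rV) (f : rV -> R) : open B -> B `<=` A -> smooth_on A f ->
  Cinf B f.
Proof.
move=> oB BA sf; apply: Cinf_local => // x Bx.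
have [W [F [oW Wx CF Ff]]] := sf x (BA _ Bx).
exists (W `&` B), F; split=> //; first exact: openI.
- exact: (Cinf_subset (@subIsetl _ _ _) (CF : Cinf W F)).
- by move=> y [Wy By]; apply: Ff => //; exact: BA.
Qed.

End LocalCinf.

Section ProjShift.
Variables (R : realType) (n : nat) (M : bmanifold R n).
Implicit Types (G : connection M) (Y : chart R n M -> M -> 'rV[R]_n).

Definition proj_shift G Y : connection M := fun c p k i j =>
  G c p k i j + Y c p 0 i * (k == j)%:R + Y c p 0 j * (k == i)%:R.

(** The trace of the projective change is (n+1) Y, which the normalisation of [wconn] reduces to Y.
    Any prescribed trace is therefore reached by exactly one projective change. *)
Lemma wconn_shift G Y d q i : wconn (proj_shift G Y) d q i = wconn G d q i + Y d q 0 i.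
Proof.
rewrite /wconn /proj_shift !big_split /=.
have -> : \sum_(e < n) Y d q 0 i * (e == e)%:R = n%:R * Y d q 0 i.
  under eq_bigr do rewrite eqxx mulr1.
  by rewrite sumr_const card_ord mulr_natl.
rewrite (sum_delta (fun e => Y d q 0 e)).
have n1 : n%:R + 1 != 0 :> R by rewrite natr1 pnatr_eq0.
rewrite -[n.+1%:R]natr1; by field.
Qed.

End ProjShift.

(** * The equation for zeta and the extension obtained from it *)

Section ZetaExtension.
Variables (R : realType) (n : nat) (M : bmanifold R n).
Hypothesis hn : (2 <= n)%N.
Variable (i0 : 'I_n).
Hypothesis i00 : val i0 = 0%N.
Variables (g : chart R n M -> M -> 'M[R]_n) (nabla : connection M).
Hypothesis (hg : pseudo_metric bm_interior g) (hnabla : levi_civita bm_interior g nabla).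
Variables (G0 : connection M) (Y : chart R n M -> M -> 'rV[R]_n).
Hypothesis (hG0 : affine setT G0) (hY : one_form bm_interior Y).
Local Notation IM := (bm_interior : set M).
Hypothesis G0E : forall c p, at_pt IM c p -> forall k i j,
  G0 c p k i j = proj_shift nabla Y c p k i j.
Let oI : open IM := @interior_open R n M i0 i00.

Lemma wconnE c p i : at_pt IM c p -> wconn G0 c p i = wconn nabla c p i + Y c p 0 i.
Proof.
move=> H; rewrite -wconn_shift /wconn; congr (_ * _).
by apply: eq_bigr => e _; rewrite G0E.
Qed.

(** Built from [G0] alone, hence smooth up to the boundary. *)
Definition zeta_coef c i j k r s q : R :=
  - G0 c q j i r * (s == k)%:R - G0 c q k i s * (r == j)%:R +
  2 * wconn G0 c q i * (r == j)%:R * (s == k)%:R.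

Definition zeta_mu c k q : R := \sum_e zeta g c q k e * Y c q 0 e.

(** Parallelism for nabla is rewritten with [G0]. The change of the connection produces 2 Y_i
    zeta^jk and that of the weight -2 density part produces the opposite term; what survives of Y is
    contracted with zeta. *)
Lemma zeta_system c p i j k : at_pt IM c p ->
  dc c i (fun q => zeta g c q j k) p =
  \sum_r \sum_s zeta_coef c i j k r s p * zeta g c p r s +
  (i == j)%:R * zeta_mu c k p + (i == k)%:R * zeta_mu c j p.
Proof.
move=> H; have [hc dp Ip] := H.
have sym a b : zeta g c p a b = zeta g c p b a.
  by rewrite -{1}(zeta_sym hg hc Ip dp) mxE.
have := zeta_parallel i00 hg hnabla hc Ip dp i j k; rewrite /nabla_bivector => /eqP.
rewrite -addrA addr_eq0 => /eqP ->.
have S1 : \sum_r \sum_s zeta_coef c i j k r s p * zeta g c p r s =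
   - (\sum_r G0 c p j i r * zeta g c p r k) - (\sum_s G0 c p k i s * zeta g c p j s) +
   2 * wconn G0 c p i * zeta g c p j k.
  transitivity (\sum_r (- (G0 c p j i r * zeta g c p r k) +
     (- \sum_s G0 c p k i s * zeta g c p r s + 2 * wconn G0 c p i * zeta g c p r k) * (r == j)%:R)).
    apply: eq_bigr => r _; rewrite /zeta_coef.
    rewrite -[- (G0 c p j i r * zeta g c p r k)]
      (sum_delta (fun s => - (G0 c p j i r * zeta g c p r s)) k).
    rewrite -[2 * wconn G0 c p i * zeta g c p r k]
      (sum_delta (fun s => 2 * wconn G0 c p i * zeta g c p r s) k).
    rewrite -sumrN -big_split /= mulr_suml -big_split /=; apply: eq_bigr => s _; ring.
  rewrite big_split /= (sum_delta (fun r => - \sum_s G0 c p k i s * zeta g c p r s +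
     2 * wconn G0 c p i * zeta g c p r k)) sumrN; ring.
have S2 : \sum_e (nabla c p j i e * zeta g c p e k + nabla c p k i e * zeta g c p j e) =
   \sum_r G0 c p j i r * zeta g c p r k + \sum_s G0 c p k i s * zeta g c p j s
   - 2 * Y c p 0 i * zeta g c p j k - (i == j)%:R * zeta_mu c k p - (i == k)%:R * zeta_mu c j p.
  rewrite /zeta_mu -big_split /= !mulr_sumr.
  have -> : 2 * Y c p 0 i * zeta g c p j k =
      \sum_e (Y c p 0 i * zeta g c p e k * (e == j)%:R) +
      \sum_e (Y c p 0 i * zeta g c p j e * (e == k)%:R).
    by rewrite (sum_delta (fun e => Y c p 0 i * zeta g c p e k))
      (sum_delta (fun e => Y c p 0 i * zeta g c p j e)); ring.
  rewrite -!big_split /= -!sumrB; apply: eq_bigr => e _; rewrite !G0E // /proj_shift.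
  rewrite [e == j]eq_sym [e == k]eq_sym [i == j]eq_sym [i == k]eq_sym [zeta g c p k e]sym; ring.
rewrite S1 S2 wconnE //; ring.
Qed.

Lemma zeta_local_extension c p : atlas c -> dom c p -> bm_boundary p ->
  exists2 d, 0 < d & forall a b, exists2 G, Cinf (ball (coord c p) d) G &
    forall q, dom c q -> IM q -> ball (coord c p) d (coord c q) ->
      G (coord c q) = zeta g c q a b.
Proof.
move=> hc dp bp; pose x0 := coord c p.
have x00 : x0 0 i0 = 0 by apply/(boundaryP i00 hc dp).
have oA := chart_image_rel_open hc (@openT M).
have Ax : chart_image c setT x0 by exact: chart_image_mem.
have sG (t : 'I_n * 'I_n * 'I_n) :
    smooth_on (chart_image c setT) ((fun q => G0 c q t.1.1 t.1.2 t.2) \o point c).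
  by case: hG0 => H _ _; exact: H.
have [W [F [oW Wx CF WF]]] := family_extension oA sG Ax.
have [r r0 rW] := (nbhs_row_ball _ _).1 (near_open oW Wx).
(* Half the radius: the coefficients have to be smooth on the closed ball of radius [d]. *)
pose d := r / 2; have d0 : 0 < d by rewrite divr_gt0.
have inW x : `|x0 - x| <= d -> W x.
  move=> xd; apply: rW; rewrite -ball_normE /ball_ /=; apply: le_lt_trans xd _.
  rewrite /d; lra.
have boxW : hbox i0 x0 d `<=` W := hbox_sub inW.
have box_half x : hbox i0 x0 d x -> halfspace x.
  by move=> [_ px] k k0; have -> : k = i0 by [apply: val_inj; rewrite /= i00 k0]; exact: ltW.
have box_im x : hbox i0 x0 d x -> [/\ dom c (point c x), coord c (point c x) = x & IM (point c x)].
  move=> bx; have [Ax' _] := WF x (boxW x bx) (box_half x bx).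
  have [_ dx E] := chart_imageP hc Ax'; split=> //.
  by apply/(interiorP i00 hc dx); rewrite E; case: bx.
have box_A : hbox i0 x0 d `<=` chart_image c IM.
  by move=> x /box_im[dx E Ix]; exists (point c x).
have oB := @hbox_open R n i0 x0 d.
have oAI := chart_image_rel_open hc oI.
pose z j k (x : 'rV[R]_n) := zeta g c (point c x) j k.
pose mu k (x : 'rV[R]_n) := zeta_mu c k (point c x).
pose wF i x := n.+1%:R^-1 * \sum_e F (e, i, e) x.
pose a i j k r s x := - F (j, i, r) x * (s == k)%:R - F (k, i, s) x * (r == j)%:R +
  2 * wF i x * (r == j)%:R * (s == k)%:R.
have sz j k : smooth_on (chart_image c IM) (z j k) by exact: (zeta_smooth hg hc j k).
have Cz j k : Cinf (hbox i0 x0 d) (z j k) by exact: smooth_on_Cinf box_A (sz j k).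
have Cmu k : Cinf (hbox i0 x0 d) (mu k).
  have S : smooth_in IM c (zeta_mu c k).
    apply: smooth_in_sum => e _; apply: smooth_in_mul; first exact: (zeta_smooth hg hc k e).
    by case: hY => H _; exact: H.
  exact: smooth_on_Cinf box_A S.
have Ca i j k r' s : Cinf W (a i j k r' s).
  have CwF : Cinf W (wF i).
    apply: Cinf_mul => //; first exact: Cinf_cst.
    by apply: Cinf_sum => // e _; exact: CF.
  apply: Cinf_add => //; last first.
    by do 3! (apply: Cinf_mul => //; last exact: Cinf_cst); rewrite //; exact: Cinf_cst.
  apply: Cinf_sub => //; last by apply: Cinf_mul => //; exact: Cinf_cst.
  by apply: Cinf_mul => //; [apply: Cinf_opp|exact: Cinf_cst].
have zs i j k x : hbox i0 x0 d x -> 'D_(delta_mx 0 i) (z j k) x =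
    \sum_r \sum_s a i j k r s x * z r s x + (i == j)%:R * mu k x + (i == k)%:R * mu j x.
  move=> bx; have [dx E Ix] := box_im x bx.
  have hx := box_half x bx.
  have [_ FG] := WF x (boxW x bx) hx.
  transitivity (dc c i (fun q => zeta g c q j k) (point c x)).
    rewrite /dc E; apply/esym/(pd_derive oB) => //.
    exact: Cinf_derivable (Cz j k) bx.
  rewrite (zeta_system i j k (And3 hc dx Ix)); congr (_ + _ + _).
  apply: eq_bigr => r' _; apply: eq_bigr => s _; congr (_ * _).
  rewrite /zeta_coef /a /wF /wconn !FG /=.
  by under [in RHS]eq_bigr do rewrite FG.
exists d => // j k.
have [G CG GE] := prolongation_extension hn d0 x00 oW inW Cz Cmu Ca zs j k.
exists G => // q dq Iq qb; rewrite GE //; last by apply/(interiorP i00 hc dq).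
by rewrite /z pointK.
Qed.

(** As limits from the interior are unique, the local extensions agree and nothing has to be
    glued. *)
Definition zeta_ext (c : chart R n M) (q : M) : 'M[R]_n :=
  \matrix_(a, b) lim ((fun q' => zeta g c q' a b) @ within IM (nbhs q)).

Lemma zeta_ext_cont c q (f : M -> R) a b (U : set M) : open U -> U q -> f @ q --> f q ->
  (forall q', U q' -> IM q' -> f q' = zeta g c q' a b) -> zeta_ext c q a b = f q.
Proof.
move=> oU Uq cf fz; rewrite mxE; have PF := interior_filter_proper i00 q.
apply: cvg_lim => //.
have cf' : f @ within IM (nbhs q) --> f q by exact: (@cvg_within_filter _ _ _ (nbhs q)).
apply: cvg_trans cf'; apply: near_eq_cvg.
rewrite near_withinE; apply: near_imp (open_nbhs_nbhs (conj oU Uq)) => q' Uq' Iq'.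
by rewrite fz.
Qed.

Lemma zeta_ext_interior c q : at_pt IM c q -> zeta_ext c q = zeta g c q.
Proof.
move=> [hc dq Iq]; apply/matrixP => a b.
apply: (@zeta_ext_cont c q (fun q => zeta g c q a b) a b setT) => //; first exact: openT.
exact: (smooth_in_cvg hc oI Iq dq (zeta_smooth hg hc a b)).
Qed.

Lemma zeta_ext_smooth c a b : atlas c -> smooth_in setT c (fun q => zeta_ext c q a b).
Proof.
move=> hc _ [p [_ dp] <-].
have oA := chart_image_rel_open hc (@openT M).
have [bp|ip] := pselect (bm_boundary p); last first.
  have Ip : IM p by [].
  have [W [F [oW Wx CF Ff]]] :=
    local_extension (chart_image_rel_open hc oI) (zeta_smooth hg hc a b)
      (chart_image_mem Ip dp).
  exists W, F; split=> // y Wy Ay.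
  have [Iy E] := Ff y Wy (oA.1 _ Ay).
  have [Iy' dy _] := chart_imageP hc Iy.
  by rewrite E /= zeta_ext_interior.
have [d d0 H] := zeta_local_extension hc dp bp.
have [G CG GE] := H a b.
exists (ball (coord c p) d), G; split=> //; [exact: ball_open|exact: ballxx|].
move=> y By /(chart_imageP hc)[_ dy E]; rewrite /=.
have cc := coord_cvgM hc dy.
have oV : open (dom c `&` coord c @^-1` ball (coord c p) d).
  apply: (open_preimage_in (dom_open hc)) => //; last exact: ball_open.
  by move=> q; exact: coord_cvgM.
apply/esym; rewrite (@zeta_ext_cont c (point c y) (G \o coord c) a b _ oV) /= ?E //.
- rewrite E in cc.
  exact: (@cvg_comp _ _ _ (coord c) G (nbhs (point c y)) (nbhs y) _ cc (Cinf_contin CG By)).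
- by move=> q [dq Bq] Iq; exact: GE.
Qed.

Lemma zeta_ext_cvg c a b p : atlas c -> dom c p ->
  (fun q => zeta_ext c q a b) @ p --> zeta_ext c p a b.
Proof. by move=> hc dp; exact: (smooth_in_cvg hc (@openT M) I dp (zeta_ext_smooth a b hc)). Qed.

Lemma zeta_extends : zeta_extension g zeta_ext.
Proof.
split; last by move=> c p H; exact: zeta_ext_interior.
split=> [c a b hc|c p [hc dp _]|c d p [[hc dp _] [hd ddp _]]].
- exact: zeta_ext_smooth.
- apply/matrixP => a b; rewrite mxE.
  apply: (eq_by_density (f := fun q => zeta_ext c q b a) (g := fun q => zeta_ext c q a b)
    i00 (dom_open hc) dp); [exact: zeta_ext_cvg|exact: zeta_ext_cvg|].
  move=> q dq Iq; rewrite zeta_ext_interior //.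
  by rewrite -{1}(zeta_sym hg hc Iq dq) mxE.
apply/matrixP => a b.
have oU : open (dom c `&` dom d) by apply: openI; exact: dom_open.
pose rhs q := wfactor (- 2) c d q *
  \sum_k (\sum_l jac c d q a l * zeta_ext c q l k) * jac c d q b k.
have rhsE q : rhs q =
    (wfactor (- 2) c d q *: (jac c d q *m zeta_ext c q *m (jac c d q)^T)) a b.
  rewrite mxE; congr (_ * _); rewrite mxE; apply: eq_bigr => k _.
  by rewrite !mxE; congr (_ * _); apply: eq_bigr => l _; rewrite mxE.
rewrite -rhsE.
apply: (eq_by_density (f := fun q => zeta_ext d q a b) (g := rhs) i00 oU) => //.
- exact: zeta_ext_cvg.
- apply: (smooth_in_cvg hc (dom_open hd) ddp dp).
  apply: smooth_in_mul.
    apply: smooth_in_normr_powR => //.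
      move=> q ddq dq; have := jac_unit hc hd dq ddq; by rewrite unitmxE unitfE.
    by apply: smooth_in_det => k l; exact: smooth_in_jac.
  apply: smooth_in_sum => k _; apply: smooth_in_mul; last exact: smooth_in_jac.
  apply: smooth_in_sum => l _; apply: smooth_in_mul; first exact: smooth_in_jac.
  by apply: (smooth_in_subset (@subsetT _ _)); exact: zeta_ext_smooth.
- move=> q [dq ddq] Iq; rewrite rhsE !zeta_ext_interior //.
  by rewrite (zeta_transform hg (conj (And3 hc dq Iq) (And3 hd ddq Iq))).
Qed.

End ZetaExtension.

(** * Connections that are trace free in a chart *)

Section Connections.
Variables (R : realType) (n : nat) (M : bmanifold R n).
Implicit Types (U V : set M) (G D : connection M) (Y : chart R n M -> M -> 'rV[R]_n).

Lemma affine_subset U V G : V `<=` U -> affine U G -> affine V G.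
Proof.
move=> VU [H1 H2 H3]; split=> [c k i j hc|c p k i j [hc dp /VU Up]|c d p [[hc dp /VU Up] [hd ddp _]]].
- exact: smooth_in_subset VU (H1 _ _ _ _ hc).
- exact: H2.
- by move=> l i j; exact: H3.
Qed.

Lemma one_form_opp U Y : one_form U Y -> one_form U (fun c p => - Y c p).
Proof.
move=> [H1 H2]; split=> [c a hc|c d p H]; last by rewrite (H2 _ _ _ H) mulNmx.
apply: (smooth_in_ext (f := fun q => - Y c q 0 a) hc); first by move=> q _ _; rewrite mxE.
by apply: smooth_in_opp; exact: H1.
Qed.

Lemma proj_shift_affine U G Y : affine U G -> one_form U Y -> affine U (proj_shift G Y).
Proof.
move=> [H1 H2 H3] [Y1 Y2]; split=> [c k i j hc|c p k i j H|c d p H l i j].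
- apply: smooth_in_add; last by apply: smooth_in_mul; [exact: Y1|exact: smooth_in_cst].
  by apply: smooth_in_add; [exact: H1|apply: smooth_in_mul; [exact: Y1|exact: smooth_in_cst]].
- by rewrite /proj_shift (H2 _ _ _ _ _ H); ring.
have E (i' : 'I_n) : Y c p 0 i' = \sum_a Y d p 0 a * jac c d p a i'.
  by rewrite (Y2 _ _ _ H) mxE.
transitivity (\sum_k jac c d p l k * G c p k i j +
    (Y c p 0 i * jac c d p l j + Y c p 0 j * jac c d p l i)).
  rewrite -(sum_delta (fun k => Y c p 0 i * jac c d p l k) j).
  rewrite -(sum_delta (fun k => Y c p 0 j * jac c d p l k) i) -!big_split /=.
  by apply: eq_bigr => k _; rewrite /proj_shift; ring.
rewrite (H3 _ _ _ H) addrAC; congr (_ + _).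
rewrite !E !mulr_suml -(sum_delta (fun b => \sum_a Y d p 0 a * jac c d p a i * jac c d p b j) l).
rewrite -(sum_delta (fun a => \sum_b Y d p 0 b * jac c d p b j * jac c d p a i) l).
under [X in _ + (X + _)]eq_bigr do rewrite mulr_suml.
rewrite [X in _ + (X + _)]exchange_big /= -!big_split /=; apply: eq_bigr => a _.
rewrite mulr_suml -!big_split /=; apply: eq_bigr => b _; rewrite /proj_shift.
by rewrite [l == a]eq_sym [l == b]eq_sym; ring.
Qed.

Lemma proj_shift_class U G Y : affine U G -> one_form U Y -> proj_class U G (proj_shift G Y).
Proof. by move=> HG HY; split; [exact: proj_shift_affine|exists Y]. Qed.

Lemma proj_class_refl U G : affine U G -> proj_class U G G.
Proof.
move=> HG; split=> //; exists (fun _ _ => 0) => [|c p _ k i j]; last by rewrite !mxE !mul0r !addr0.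
split=> [c a hc|c d p _]; last by rewrite mul0mx.
by apply: (smooth_in_ext (f := fun _ => 0) hc); [move=> q _ _; rewrite mxE|exact: smooth_in_cst].
Qed.

Section Frame.
Variables (c0 : chart R n M) (U : set M).
Hypothesis (hc0 : atlas c0) (oU : open U) (Ud : U `<=` dom c0).

Lemma smooth_fun_chart (f : M -> R) : smooth_in U c0 f -> smooth_fun U f.
Proof.
move=> sf d hd; apply: smooth_in_subset (smooth_in_change hd hc0 oU sf).
by move=> q Uq; split=> //; exact: Ud.
Qed.

Lemma smooth_in_jac_frame d a i : atlas d -> smooth_in U d (fun q => jac d c0 q a i).
Proof. by move=> hd; apply: smooth_in_subset Ud _; exact: smooth_in_jac. Qed.

(** The form whose components in the chart [c0] are [h], carried to every other chart by the
    Jacobian. *)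
Definition frame_form (h : M -> 'rV[R]_n) (d : chart R n M) q : 'rV[R]_n := h q *m jac d c0 q.

Lemma frame_form_one_form (h : M -> 'rV[R]_n) :
  (forall a, smooth_in U c0 (fun q => h q 0 a)) -> one_form U (frame_form h).
Proof.
move=> sh; split=> [d a hd|d e p [[hd dp Up] [he ep _]]].
  apply: (smooth_in_ext (f := fun q => \sum_k h q 0 k * jac d c0 q k a) hd).
    by move=> q _ _; rewrite mxE.
  apply: smooth_in_sum => k _; apply: smooth_in_mul; last exact: smooth_in_jac_frame.
  exact: (smooth_fun_chart (sh k)).
by rewrite /frame_form (jac_chain hd he hc0) ?mulmxA //; exact: Ud.
Qed.

Lemma frame_form_id h q : U q -> frame_form h c0 q = h q.
Proof. by move=> Uq; rewrite /frame_form jac_id ?mulmx1 //; exact: Ud. Qed.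

Lemma det_jac_frame d q : atlas d -> dom d q -> U q -> \det (jac d c0 q) != 0.
Proof.
move=> hd dq Uq; have := jac_unit hd hc0 dq (Ud Uq); by rewrite unitmxE unitfE.
Qed.

Section Volume.
Variable G : connection M.
Hypothesis HG : affine U G.

(** Contraction of the transformation law with the inverse Jacobian; the inhomogeneous term becomes
    the logarithmic derivative of the determinant of the Jacobian. *)
Lemma trace_transform d p i : atlas d -> dom d p -> U p ->
  \sum_k G d p k i k = \sum_a (\sum_l G c0 p l a l) * jac d c0 p a i +
  \sum_l \sum_j dc d i (fun q => jac d c0 q l j) p * invmx (jac d c0 p) j l.
Proof.
move=> hd dp Up; have [_ _ H3] := HG; set J := jac d c0 p.
have Ju : J \in unitmx by exact: jac_unit hd hc0 dp (Ud Up).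
have H l j := H3 d c0 p (conj (And3 hd dp Up) (And3 hc0 (Ud Up) Up)) l i j.
have inv1 (k j : 'I_n) : \sum_l invmx J j l * J l k = (j == k)%:R.
  have /matrixP/(_ j k) := mulVmx Ju; by rewrite !mxE.
have inv2 (l b : 'I_n) : \sum_j J b j * invmx J j l = (b == l)%:R.
  have /matrixP/(_ b l) := mulmxV Ju; by rewrite !mxE.
transitivity (\sum_j \sum_l invmx J j l * \sum_k J l k * G d p k i j).
  apply: eq_bigr => j _; under eq_bigr do rewrite mulr_sumr.
  rewrite exchange_big /= -(sum_delta (fun k => G d p k i j) j); apply: eq_bigr => k _.
  by rewrite [k == j]eq_sym -inv1 mulr_sumr; apply: eq_bigr => l _; ring.
under eq_bigr do under eq_bigr do rewrite H mulrDr.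
under eq_bigr do rewrite big_split /=.
rewrite big_split /=; congr (_ + _); last first.
  rewrite exchange_big; apply: eq_bigr => l _; apply: eq_bigr => j _; rewrite mulrC.
  congr (_ * _); apply: (dc_ext i hd oU Up dp) => [q _ _|]; first by rewrite mxE.
  by apply: smooth_in_subset Ud _; apply: smooth_in_dc => //; [exact: dom_open|exact: transition_smooth].
under [RHS]eq_bigr do rewrite mulr_suml.
rewrite exchange_big /= [RHS]exchange_big /=; apply: eq_bigr => l _.
under eq_bigr do rewrite mulr_sumr.
rewrite exchange_big /=; apply: eq_bigr => a _.
under eq_bigr do rewrite mulr_sumr.
rewrite exchange_big /= -(sum_delta (fun b => G c0 p l a b * J a i) l); apply: eq_bigr => b _.
by rewrite -inv2 mulr_sumr; apply: eq_bigr => j _; ring.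
Qed.

Lemma trace_free_preserves_volume :
  (forall p i, U p -> wconn G c0 p i = 0) -> preserves_volume U G.
Proof.
(* The coordinate volume of [c0], equal to 1 in [c0]. In another chart its logarithmic derivative is
   the inhomogeneous term of [trace_transform], which is the whole trace of [G] there. *)
move=> w0; exists (fun d q => `|\det (jac d c0 q)|).
have n1 : n.+1%:R != 0 :> R by rewrite pnatr_eq0.
have sJ d : atlas d -> smooth_in U d (fun q => \det (jac d c0 q)).
  by move=> hd; apply: smooth_in_det => a b; exact: smooth_in_jac_frame.
have absE (x : R) : `|x| = `|x| `^ 1 by rewrite powRr1.
have sA d : atlas d -> smooth_in U d (fun q => `|\det (jac d c0 q)|).
  move=> hd; apply: (smooth_in_ext (f := fun q => `|\det (jac d c0 q)| `^ 1) hd) => [q _ _|].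
    by rewrite -absE.
  apply: smooth_in_normr_powR => [//|q Uq dq|]; [exact: det_jac_frame|exact: sJ].
split=> [|d p [hd dp Up]|d p [hd dp Up] i].
- split=> // d e p [[hd dp Up] [he ep _]].
  rewrite /wfactor mulNr divff // powRN powRr1 // (jac_chain hd he hc0 dp ep (Ud Up)).
  rewrite det_mulmx normrM mulrC mulfK // normr_eq0.
  by have := jac_unit hd he dp ep; rewrite unitmxE unitfE.
- by rewrite normr_gt0 det_jac_frame.
rewrite /nabla_density.
have d0 := det_jac_frame hd dp Up.
rewrite (dc_ext (g := fun q => `|\det (jac d c0 q)| `^ 1) i hd oU Up dp); last 2 first.
- by move=> q _ _; rewrite -absE.
- exact: sA.
rewrite (dc_normr_powR i hd oU Up dp 1 (sJ d hd) d0).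
rewrite (dc_det_unit i hd oU Up dp); last 2 first.
- by move=> a b; exact: smooth_in_jac_frame.
- exact: jac_unit hd hc0 dp (Ud Up).
rewrite -absE /wconn (trace_transform i hd dp Up).
have -> : \sum_a (\sum_l G c0 p l a l) * jac d c0 p a i = 0.
  apply: big1 => a _; have /eqP := w0 p a Up.
  by rewrite /wconn mulf_eq0 invr_eq0 (negbTE n1) => /eqP ->; rewrite mul0r.
set S := \sum_a \sum_b _; move: (n.+1%:R : R) n1 => N n1; by field; rewrite n1.
Qed.

End Volume.

Definition trace_form G q : 'rV[R]_n := \row_i - wconn G c0 q i.

Lemma smooth_in_wconn G V d i : affine V G -> atlas d -> smooth_in V d (fun q => wconn G d q i).
Proof.
move=> [H _ _] hd; apply: smooth_in_mul; first exact: smooth_in_cst.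
by apply: smooth_in_sum => e _; exact: H.
Qed.

(** The representative that preserves the coordinate volume of [c0]. Unlike nabla it can be smooth
    up to the boundary, and the formula for L may be evaluated with it. *)
Definition trace_free G := proj_shift G (frame_form (trace_form G)).

Lemma trace_form_one_form G : affine U G -> one_form U (frame_form (trace_form G)).
Proof.
move=> HG; apply: frame_form_one_form => a.
apply: (smooth_in_ext (f := fun q => - wconn G c0 q a) hc0); first by move=> q _ _; rewrite mxE.
by apply: smooth_in_opp; exact: smooth_in_wconn.
Qed.

Lemma trace_free_affine G : affine U G -> affine U (trace_free G).
Proof. by move=> HG; apply: proj_shift_affine => //; exact: trace_form_one_form. Qed.

Lemma trace_free_class G : affine U G -> proj_class U G (trace_free G).
Proof. by move=> HG; apply: proj_shift_class => //; exact: trace_form_one_form. Qed.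

Lemma wconn_trace_free G q i : U q -> wconn (trace_free G) c0 q i = 0.
Proof. by move=> Uq; rewrite wconn_shift frame_form_id // mxE subrr. Qed.

Lemma trace_free_volume G : affine U G -> preserves_volume U (trace_free G).
Proof.
by move=> HG; apply: trace_free_preserves_volume => [|p i Up];
  [exact: trace_free_affine|exact: wconn_trace_free].
Qed.

End Frame.
End Connections.

(** * The cotractor form *)

Section DegenerateForms.
Variable F : fieldType.

Lemma rank_drop_row m n (A : 'M[F]_(m.+1, n)) : (\rank A <= m)%N ->
  exists i, \rank (row' i A) = \rank A.
Proof.
move=> rA; have /row_freePn[i Ai] : ~~ row_free A by rewrite /row_free neq_ltn ltnS rA.
exists i; apply: eqmx_rank; apply/andP; split; first by rewrite row'Esub rowsub_sub.
apply/row_subP => k; have [l ->|-> //] := unliftP i k.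
have -> : row (lift i l) A = row l (row' i A) by apply/rowP => j; rewrite !mxE.
exact: row_sub.
Qed.

(** Deleting a row that depends on the others, and then such a column, leaves an invertible minor,
    which up to sign is an entry of the adjugate. *)
Lemma rank_adj_neq0 n (A : 'M[F]_n.+1) : \rank A = n -> \adj A != 0.
Proof.
move=> rA; have [i ri] : exists i, \rank (row' i A) = n.
  by have [|i E] := @rank_drop_row n n.+1 A; [rewrite rA|exists i; rewrite E rA].
have [j rj] : exists j, \rank (row' j (row' i A)^T) = n.
  have [|j H] := @rank_drop_row n n (row' i A)^T; first by rewrite mxrank_tr ri.
  by exists j; rewrite H mxrank_tr.
apply/eqP => /matrixP/(_ j i); rewrite !mxE /cofactor => /eqP.
rewrite mulf_eq0 signr_eq0 /= -det_tr; apply/negP.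
have -> : (row' i (col' j A))^T = row' j (row' i A)^T by apply/matrixP => k l; rewrite !mxE.
by rewrite -unitfE -unitmxE -row_free_unit /row_free rj.
Qed.

Section Pullback.
Variables (n : nat) (z : 'M[F]_n) (w : 'I_n -> F) (N : 'M[F]_(1 + n)).
Local Notation o := (lshift n (0 : 'I_1)).

(* Matrix of (xi, mu) |-> mu + w xi, and the vector (1, -w) spanning its kernel. *)
Definition pull_coef (a : 'I_n) (i : 'I_(1 + n)) : F :=
  (rshift 1 a == i)%:R + w a * (o == i)%:R.

Definition kernel_coef (i : 'I_(1 + n)) : F :=
  (o == i)%:R - \sum_a w a * (rshift 1 a == i)%:R.

Hypotheses (zu : z \in unitmx) (zs : z^T = z).
Hypothesis NE : forall i j, N i j = \sum_a \sum_b z a b * pull_coef a i * pull_coef b j.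

Let B : 'M[F]_(n, 1 + n) := \matrix_(a, i) pull_coef a i.

Let NB : N = B^T *m z *m B.
Proof.
apply/matrixP => i j; rewrite NE !mxE exchange_big; apply: eq_bigr => b _.
by rewrite !mxE mulr_suml; apply: eq_bigr => a _; rewrite !mxE; ring.
Qed.

Let mulBT (x : 'rV[F]_(1 + n)) a : (x *m B^T) 0 a = x 0 (rshift 1 a) + w a * x 0 o.
Proof.
rewrite -(sum_delta (x 0) (rshift 1 a)) -(sum_delta (x 0) o) mulr_sumr -big_split mxE /=.
by apply: eq_bigr => i _; rewrite !mxE /pull_coef ![_ == i]eq_sym; ring.
Qed.

Let mulBr (y : 'rV[F]_n) a : (y *m B) 0 (rshift 1 a) = y 0 a.
Proof.
rewrite mxE (bigD1 a) //= [B a _]mxE /pull_coef eqxx eq_lrshift mulr0 addr0 mulr1.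
rewrite big1 ?addr0 // => b ba.
by rewrite [B b _]mxE /pull_coef eq_lrshift mulr0 addr0 (inj_eq (@rshift_inj 1 n)) (negbTE ba) mulr0.
Qed.

Lemma kernel_o : kernel_coef o = 1.
Proof.
rewrite /kernel_coef eqxx big1 ?subr0 // => a _.
by rewrite eq_sym eq_lrshift mulr0.
Qed.

Lemma kernel_rshift a : kernel_coef (rshift 1 a) = - w a.
Proof.
rewrite /kernel_coef eq_lrshift sub0r (bigD1 a) //= eqxx mulr1 big1 ?addr0 // => b ba.
by rewrite (inj_eq (@rshift_inj 1 n)) (negbTE ba) mulr0.
Qed.

Let kerB (x : 'rV[F]_(1 + n)) : x *m N = 0 -> forall i, x 0 i = x 0 o * kernel_coef i.
Proof.
move=> xN.
have xB : x *m B^T = 0.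
  have : x *m B^T *m z = 0.
    apply/rowP => a; rewrite -mulBr -!mulmxA [B^T *m _]mulmxA -NB xN.
    by rewrite !mxE.
  by move=> /(congr1 (mulmx^~ (invmx z))); rewrite mulmxK // mul0mx.
move=> i; case: (split_ordP i) => k ->; last first.
  have := mulBT x k; rewrite xB mxE kernel_rshift => /eqP; rewrite eq_sym addr_eq0 => /eqP ->.
  by ring.
by rewrite (_ : lshift n k = o) ?kernel_o ?mulr1 // ord1.
Qed.

Let N_sym : N^T = N.
Proof. by rewrite NB !trmx_mul trmxK zs mulmxA. Qed.

Let detN : \det N = 0.
Proof.
apply/eqP/det0P; exists (\row_i kernel_coef i).
  by apply/eqP => /rowP/(_ o); rewrite !mxE kernel_o => /eqP; rewrite oner_eq0.
rewrite NB !mulmxA (_ : _ *m B^T = 0) ?mul0mx //; apply/rowP => a.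
by rewrite mulBT !mxE kernel_rshift kernel_o; ring.
Qed.

(** As det N = 0, the rows of the adjugate are killed by N, so they are multiples of the vector
    spanning its kernel; symmetry gives the same for the columns. *)
Lemma adj_pullback i j : \adj N i j = \adj N o o * kernel_coef i * kernel_coef j.
Proof.
have adjr k l : \adj N k l = \adj N k o * kernel_coef l.
  have := @kerB (row k (\adj N)); rewrite !mxE -row_mul mul_adj_mx detN.
  move=> /(_ _ l); rewrite !mxE; apply; apply/rowP => t.
  by rewrite !mxE mul0rn.
have adjs k l : \adj N k l = \adj N l k by rewrite -{1}N_sym -trmx_adj mxE.
by rewrite adjr adjs adjr.
Qed.

End Pullback.

Lemma adj_corner n (N : 'M[F]_(1 + n)) (z : 'M[F]_n) :
  (forall a b, N (rshift 1 a) (rshift 1 b) = z a b) ->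
  \adj N (lshift n 0) (lshift n 0) = \det z.
Proof.
move=> H; rewrite !mxE /cofactor /= addn0 expr0 mul1r; congr (\det _).
have lr k : lift (lshift n (0 : 'I_1)) k = rshift 1 k by apply: val_inj.
by apply/matrixP => a b; rewrite !mxE -H -!lr.
Qed.

End DegenerateForms.

(** * Tensoriality of the covariant derivative *)

Section CovariantDerivative.
Variables (R : realType) (n : nat) (M : bmanifold R n).
Variables (U : set M) (G : connection M) (X Z : chart R n M -> M -> 'rV[R]_n).
Hypotheses (oU : open U) (HG : affine U G) (HX : vector_field U X) (HZ : vector_field U Z).

Lemma vector_field_smooth (V : chart R n M -> M -> 'rV[R]_n) c a :
  vector_field U V -> atlas c -> smooth_in U c (fun q => V c q 0 a).
Proof. by case=> H _ hc; exact: H. Qed.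

Lemma vector_fieldE (V : chart R n M -> M -> 'rV[R]_n) c d p l : vector_field U V ->
  at_overlap U c d p -> V d p 0 l = \sum_j jac c d p l j * V c p 0 j.
Proof.
case=> _ H /H ->; rewrite mxE; apply: eq_bigr => j _; by rewrite !mxE mulrC.
Qed.

(** Differentiating the components of [Z] in a new chart brings in second derivatives of the
    transition functions; the inhomogeneous term in the transformation law of [G] compensates for
    them. *)
Lemma cov_deriv_vector_field : vector_field U (cov_deriv G X Z).
Proof.
have [G1 _ G3] := HG; split=> [c k hc|c d p H].
  apply: (smooth_in_ext (f := fun q => \sum_i dc c i (fun q => Z c q 0 k) q * X c q 0 i +
    \sum_i \sum_j G c q k i j * X c q 0 i * Z c q 0 j) hc); first by move=> q _ _; rewrite mxE.
  apply: smooth_in_add; apply: smooth_in_sum => i _.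
    apply: smooth_in_mul; last exact: vector_field_smooth.
    by apply: smooth_in_dc => //; exact: vector_field_smooth.
  apply: smooth_in_sum => j _; apply: smooth_in_mul; last exact: vector_field_smooth.
  by apply: smooth_in_mul; [exact: G1|exact: vector_field_smooth].
have [[hc dp Up] [hd ddp _]] := H; pose J := jac c d p.
have oV : open (U `&` dom d) by apply: openI => //; exact: dom_open.
have Vp : (U `&` dom d) p by [].
have dZ l i : dc c i (fun q => Z d q 0 l) p =
    \sum_j (J l j * dc c i (fun q => Z c q 0 j) p +
      Z c p 0 j * dc c i (dc c j (fun q => coord d q 0 l)) p).
  have sJ j : smooth_in (U `&` dom d) c (fun q => jac c d q l j).
    by apply: smooth_in_subset (@subIsetr _ _ _) _; exact: smooth_in_jac.
  have sZ j : smooth_in (U `&` dom d) c (fun q => Z c q 0 j).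
    by apply: smooth_in_subset (@subIsetl _ _ _) _; exact: vector_field_smooth.
  rewrite -(dc_ext (f := fun q => \sum_j jac c d q l j * Z c q 0 j) i hc oV Vp dp); last 2 first.
  - by move=> q [Uq ddq] dq; rewrite -(vector_fieldE _ HZ).
  - by apply: smooth_in_sum => j _; apply: smooth_in_mul.
  rewrite (dc_sum _ hc oV Vp dp) => [|j]; last exact: smooth_in_mul.
  apply: eq_bigr => j _; rewrite (dcM _ hc oV Vp dp (sJ j) (sZ j)); congr (_ + _ * _).
  by apply: (dc_ext i hc oV Vp dp) (sJ j) => q _ _; rewrite mxE.
apply/rowP => l; rewrite [LHS]mxE [RHS]mxE.
transitivity (\sum_i X c p 0 i * dc c i (fun q => Z d q 0 l) p +
    \sum_i \sum_j X c p 0 i * Z c p 0 j *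
      \sum_a \sum_b G d p l a b * J a i * J b j).
  congr (_ + _).
    transitivity (\sum_a \sum_i dc d a (fun q => Z d q 0 l) p * J a i * X c p 0 i).
      apply: eq_bigr => a _; rewrite (vector_fieldE a HX H) mulr_sumr.
      by apply: eq_bigr => i _; rewrite mulrA.
    rewrite exchange_big; apply: eq_bigr => i _.
    rewrite (dc_chain hc hd oU) //; last exact: vector_field_smooth.
    by rewrite mulr_sumr; apply: eq_bigr => a _; rewrite mulrC.
  transitivity (\sum_a \sum_b \sum_i \sum_j
      X c p 0 i * Z c p 0 j * (G d p l a b * J a i * J b j)).
    apply: eq_bigr => a _; apply: eq_bigr => b _.
    rewrite (vector_fieldE a HX H) (vector_fieldE b HZ H) mulr_sumr [RHS]exchange_big /=.
    apply: eq_bigr => j _; rewrite mulr_sumr mulr_suml.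
    by apply: eq_bigr => i _; rewrite /J; ring.
  under eq_bigr do rewrite exchange_big.
  rewrite exchange_big; apply: eq_bigr => i _.
  under eq_bigr do rewrite exchange_big.
  rewrite exchange_big; apply: eq_bigr => j _.
  by rewrite mulr_sumr; apply: eq_bigr => a _; rewrite mulr_sumr.
transitivity (\sum_k J l k * (\sum_i dc c i (fun q => Z c q 0 k) p * X c p 0 i +
    \sum_i \sum_j G c p k i j * X c p 0 i * Z c p 0 j)); last first.
  by apply: eq_bigr => k _; rewrite !mxE mulrC.
under [RHS]eq_bigr do rewrite mulrDr.
rewrite [RHS]big_split /=.
have -> : \sum_k J l k * (\sum_i \sum_j G c p k i j * X c p 0 i * Z c p 0 j) =
    \sum_i \sum_j X c p 0 i * Z c p 0 j * \sum_k J l k * G c p k i j.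
  under eq_bigr do rewrite mulr_sumr.
  rewrite exchange_big; apply: eq_bigr => i _.
  under eq_bigr do rewrite mulr_sumr.
  rewrite exchange_big; apply: eq_bigr => j _.
  by rewrite mulr_sumr; apply: eq_bigr => k _; ring.
have -> : \sum_k J l k * (\sum_i dc c i (fun q => Z c q 0 k) p * X c p 0 i) =
    \sum_i \sum_j X c p 0 i * (J l j * dc c i (fun q => Z c q 0 j) p).
  rewrite exchange_big; apply: eq_bigr => k _; rewrite mulr_sumr.
  by apply: eq_bigr => i _; ring.
rewrite -!big_split /=; apply: eq_bigr => i _; rewrite dZ mulr_sumr -!big_split /=.
apply: eq_bigr => j _; rewrite (G3 _ _ _ H l i j) /J; ring.
Qed.

End CovariantDerivative.

(** * Sign of a function without zeros in the interior *)

Section Sign.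
Variables (R : realType) (n : nat) (M : bmanifold R n) (i0 : 'I_n).
Hypothesis i00 : val i0 = 0%N.

(** Interior points of a coordinate ball around [p] lie in a half box (or in the part of the ball
    with positive first coordinate), which is convex in the chart; a sign change along a segment
    would force a zero. Zeros on the boundary are allowed. *)
Lemma constant_sign (c : chart R n M) (V : set M) (f : M -> R) p : atlas c -> open V -> V p ->
  dom c p -> smooth_in V c f -> (forall q, V q -> bm_interior q -> f q != 0) ->
  exists U, [/\ open U, U p, U `<=` V `&` dom c &
    forall q q', U q -> U q' -> bm_interior q -> bm_interior q' -> 0 < f q * f q'].
Proof.
move=> hc oV Vp dp sf f0; pose x0 := coord c p.
have oA := chart_image_rel_open hc oV.
have [W [F [oW Wx CF WF]]] := local_extension oA sf (chart_image_mem Vp dp).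
have [r r0 rW] := (nbhs_row_ball _ _).1 (near_open oW Wx).
have half (x : 'rV[R]_n) : 0 <= x 0 i0 -> halfspace x.
  by move=> px k k0; have -> : k = i0 by apply: val_inj; rewrite /= i00 k0.
have FE y : dom c y -> ball x0 r (coord c y) -> V y /\ F (coord c y) = f y.
  move=> dy /rW Wy; have [Ay ->] := WF _ Wy (half _ (coord_ge0 i00 hc dy)).
  by have [Vy _ _] := chart_imageP hc Ay; rewrite pointK // in Vy *; rewrite /= pointK.
have F0 y : hbox i0 x0 r y -> W y /\ F y != 0.
  move=> [/rW Wy py]; have [Ay ->] := WF _ Wy (half _ (ltW py)); split=> //.
  have [Vy dy E] := chart_imageP hc Ay; apply: f0 => //.
  by apply/(interiorP i00 hc dy); rewrite E.
exists (dom c `&` coord c @^-1` ball x0 r); split.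
- apply: (open_preimage_in (dom_open hc)); last exact: ball_open.
  by move=> q; exact: coord_cvgM.
- by split=> //; exact: ballxx.
- by move=> q [dq Bq]; split=> //; have [] := FE q dq Bq.
move=> q q' [dq Bq] [dq' Bq'] Iq Iq'.
have hq : hbox i0 x0 r (coord c q) by split=> //; apply/(interiorP i00 hc dq).
have hq' : hbox i0 x0 r (coord c q') by split=> //; apply/(interiorP i00 hc dq').
pose phi (t : R) := coord c q + t *: (coord c q' - coord c q).
have hphi (t : R) : 0 <= t <= 1 -> hbox i0 x0 r (phi t) by exact: hbox_convex.
have cphi : continuous phi.
  move=> t; apply: (@cvgD _ _ _ (nbhs t)); first exact: cvg_cst.
  by apply: (@cvgZr_tmp _ _ _ (nbhs t)).
rewrite ltNge; apply/negP => fneg.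
have cF : {within `[0, 1], continuous (F \o phi)}.
  apply: continuous_in_subspaceT => t; rewrite inE /= in_itv /= => /hphi /F0[Wt _].
  exact: (@cvg_comp _ _ _ phi F (nbhs t) (nbhs (phi t)) _ (cphi t) (Cinf_contin CF Wt)).
have [] := IVT (v := 0) ler01 cF; last first.
  by move=> t; rewrite in_itv /= => /hphi /F0[_ /eqP].
have phi0 : phi 0 = coord c q by rewrite /phi scale0r addr0.
have phi1 : phi 1 = coord c q' by rewrite /phi scale1r addrC subrK.
have := (F0 _ hq).2; have := (F0 _ hq').2; rewrite /= phi0 phi1.
rewrite (FE q dq Bq).2 (FE q' dq' Bq').2 ge_min le_max => fq'0 fq0.
case: (ltgtP (f q) 0) fq0 => // fq _; case: (ltgtP (f q') 0) fq'0 => // fq' _; move: fneg.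
  by rewrite leNgt nmulr_rgt0 // fq'.
by rewrite leNgt pmulr_rgt0 // fq'.
Qed.

End Sign.

(** * The form L, its adjugate and the defining function *)

Section Cotractor.
Variables (R : realType) (n : nat) (M : bmanifold R n).
Variable (i0 : 'I_n).
Hypothesis i00 : val i0 = 0%N.
Variables (g : chart R n M -> M -> 'M[R]_n) (nabla : connection M).
Hypothesis (hg : pseudo_metric bm_interior g) (hnabla : levi_civita bm_interior g nabla).
Hypothesis hflat : scalar_flat bm_interior g nabla.
Variables (G0 : connection M) (Y : chart R n M -> M -> 'rV[R]_n) (P : set (connection M)).
Hypothesis (hG0 : affine setT G0) (PG0 : P G0) (hY : one_form bm_interior Y).
Local Notation IM := (bm_interior : set M).
Hypothesis G0E : forall c p, at_pt IM c p -> forall k i j,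
  G0 c p k i j = proj_shift nabla Y c p k i j.
Hypothesis hnoext : forall p, bm_boundary p -> ~ connection_extends_near nabla p.
Variables (z : chart R n M -> M -> 'M[R]_n) (L : cotractor_form M).
Hypothesis (hz : zeta_extension g z) (hL : is_L P z L).
Let oI : open IM := @interior_open R n M i0 i00.

Lemma nabla_class : proj_class IM G0 nabla.
Proof.
split; first by case: hnabla.
exists (fun c p => - Y c p); first exact: one_form_opp.
by move=> c p H k i j; rewrite (G0E H) /proj_shift !mxE; ring.
Qed.

Lemma z_smooth c a b : atlas c -> smooth_in setT c (fun q => z c q a b).
Proof. by case: hz => -[H _ _] _; exact: H. Qed.

Lemma z_interior c p : at_pt IM c p -> z c p = zeta g c p.
Proof. by case: hz => _; exact. Qed.

Lemma z_sym c p : atlas c -> dom c p -> (z c p)^T = z c p.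
Proof. by case: hz => -[_ H _] _ hc dp; exact: H. Qed.

Lemma z_parallel c p i a b : at_pt IM c p -> nabla_bivector (- 2) nabla z c p i a b = 0.
Proof.
move=> H; have [hc dp Ip] := H; rewrite -(zeta_parallel i00 hg hnabla hc Ip dp i a b).
rewrite /nabla_bivector z_interior //; congr (_ + _ + _).
apply: (dc_ext i hc oI Ip dp) => [q Iq dq|]; first by rewrite z_interior.
by apply: smooth_in_subset (z_smooth a b hc).
Qed.

Lemma div_zeta_interior c p : at_pt IM c p -> div_zeta nabla z c p = 0.
Proof.
move=> H; apply/rowP => a; rewrite !mxE big1 // => b _; exact: z_parallel.
Qed.

(** For nabla, which preserves [vol g], the component lambda and the derivative part of rho vanish
    since zeta is parallel; the curvature part of rho is a multiple of the scalar curvature. *)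
Lemma L_interior c p j j' : at_pt IM c p -> L c p j j' =
  \sum_a \sum_b z c p a b * split_mu nabla c p j a * split_mu nabla c p j' b.
Proof.
move=> H; have [hc dp Ip] := H.
rewrite (hL oI PG0 nabla_class (nabla_preserves_volume i00 hg hnabla) H) /L_formula.
have l0 a : lambda nabla z c p a = 0 by rewrite /lambda div_zeta_interior // mxE mulr0 oppr0.
rewrite [X in _ + X + _]big1 ?addr0 => [|a _]; last by rewrite l0 mul0r.
suff -> : rho nabla z c p = 0 by rewrite !mul0r addr0.
rewrite /rho [X in _ * X + _](_ : _ = 0); last first.
  transitivity (((n%:R - 1)^-1 * (tau g c p)^-1) *
      \sum_b \sum_d invmx (g c p) b d * ricci nabla c p b d); last by rewrite hflat // mulr0.
  rewrite mulr_sumr; apply: eq_bigr => a _; rewrite mulr_sumr; apply: eq_bigr => b _.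
  by rewrite z_interior // /zeta mxE /schouten; ring.
rewrite big1 ?mulr0 ?addr0 // => a _; rewrite /nabla_vector div_zeta_interior // mxE mulr0 addr0.
rewrite big1 ?addr0 => [|e _]; last by rewrite mxE mulr0.
rewrite -(dc_cst a hc oI Ip dp 0); apply/esym/(dc_ext a hc oI Ip dp).
  by move=> q Iq dq; rewrite div_zeta_interior ?mxE.
exact: smooth_in_cst.
Qed.

Definition Lmx c q : 'M[R]_(1 + n) := \matrix_(i, j) L c q (delta_mx 0 i) (delta_mx 0 j).

Lemma delta_rsub (i : 'I_(1 + n)) a :
  rsubmx (delta_mx 0 i : 'rV[R]_(1 + n)) 0 a = (rshift 1 a == i)%:R.
Proof. by rewrite !mxE. Qed.

Lemma delta_lsub (i : 'I_(1 + n)) :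
  lsubmx (delta_mx 0 i : 'rV[R]_(1 + n)) 0 0 = (lshift n (0 : 'I_1) == i)%:R.
Proof. by rewrite !mxE. Qed.

Lemma Lmx_interior c p i j : at_pt IM c p -> Lmx c p i j =
  \sum_a \sum_b z c p a b * pull_coef (wconn nabla c p) a i * pull_coef (wconn nabla c p) b j.
Proof.
move=> H; rewrite mxE L_interior //; apply: eq_bigr => a _; apply: eq_bigr => b _.
by rewrite /split_mu !delta_rsub !delta_lsub.
Qed.

Section Frame.
Variable c : chart R n M.
Hypothesis hc : atlas c.
Local Notation Gt := (trace_free c G0).
Local Notation U := (dom c).
Let oU := dom_open hc.
Let G0U : affine U G0. Proof. exact: affine_subset hG0. Qed.
Let idU : U `<=` U. Proof. by []. Qed.
Let GtU : affine U Gt. Proof. exact: (trace_free_affine hc oU). Qed.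

Lemma L_frame p : U p -> L c p = L_formula Gt z c p.
Proof.
move=> dp; have := hL oU PG0 (trace_free_class hc oU idU G0U) (trace_free_volume hc oU idU G0U).
by apply.
Qed.

Lemma split_mu_frame p i a : U p -> split_mu Gt c p (delta_mx 0 i) a = (rshift 1 a == i)%:R.
Proof.
move=> dp; rewrite /split_mu (wconn_trace_free hc idU) // mul0r addr0; exact: delta_rsub.
Qed.

Lemma LmxE p i j : U p -> Lmx c p i j =
  \sum_a \sum_b z c p a b * (rshift 1 a == i)%:R * (rshift 1 b == j)%:R +
  \sum_a lambda Gt z c p a * ((rshift 1 a == i)%:R * (lshift n (0 : 'I_1) == j)%:R +
    (rshift 1 a == j)%:R * (lshift n (0 : 'I_1) == i)%:R) +
  rho Gt z c p * (lshift n (0 : 'I_1) == i)%:R * (lshift n (0 : 'I_1) == j)%:R.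
Proof.
move=> dp; rewrite mxE L_frame // /L_formula /split_xi !delta_lsub.
congr (_ + _ + _); apply: eq_bigr => a _; last by rewrite !split_mu_frame.
by apply: eq_bigr => b _; rewrite !split_mu_frame.
Qed.

Lemma Lmx_rshift p a b : U p -> Lmx c p (rshift 1 a) (rshift 1 b) = z c p a b.
Proof.
move=> dp; rewrite LmxE // !eq_lrshift !mulr0 addr0 [X in _ + X]big1 ?addr0; last first.
  by move=> e _; rewrite !mulr0 addr0 mulr0.
rewrite -(sum_delta (z c p a) b) -(sum_delta (fun a => \sum_s z c p a s * (s == b)%:R) a).
apply: eq_bigr => k _; rewrite mulr_suml; apply: eq_bigr => l _.
by rewrite !(inj_eq (@rshift_inj 1 n)); ring.
Qed.

Let zU a b : smooth_in U c (fun q => z c q a b).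
Proof. exact: smooth_in_subset (z_smooth a b hc). Qed.

Let Gts k i j : smooth_in U c (fun q => Gt c q k i j).
Proof. by case: GtU => H _ _; exact: H. Qed.

Let ws i : smooth_in U c (fun q => wconn Gt c q i).
Proof. exact: smooth_in_wconn. Qed.

Let dcs f i : smooth_in U c f -> smooth_in U c (dc c i f).
Proof. exact: smooth_in_dc. Qed.

Lemma div_zeta_smooth a : smooth_in U c (fun q => div_zeta Gt z c q 0 a).
Proof.
apply: (smooth_in_ext (f := fun q => \sum_b nabla_bivector (- 2) Gt z c q b a b) hc).
  by move=> q _ _; rewrite mxE.
apply: smooth_in_sum => b _; apply: smooth_in_add.
  apply: smooth_in_add; first exact: dcs.
  by apply: smooth_in_sum => e _; apply: smooth_in_add; apply: smooth_in_mul.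
by apply: smooth_in_mul => //; apply: smooth_in_mul => //; exact: smooth_in_cst.
Qed.

(** Read off from the formula for the trace-free representative, whose ingredients are all smooth up
    to the boundary. *)
Lemma Lmx_smooth i j : smooth_in U c (fun q => Lmx c q i j).
Proof.
have cst := @smooth_in_cst R n M c U.
apply: smooth_in_ext (fun q _ dq => esym (LmxE i j dq)) _ => //.
apply: smooth_in_add.
  apply: smooth_in_add.
    apply: smooth_in_sum => a _; apply: smooth_in_sum => b _.
    by do 2! apply: smooth_in_mul => //.
  apply: smooth_in_sum => a _; apply: smooth_in_mul => //.
  apply: smooth_in_opp; apply: smooth_in_mul => //; exact: div_zeta_smooth.
do 2! apply: smooth_in_mul => //.
apply: smooth_in_add; apply: smooth_in_mul => //; apply: smooth_in_sum => a _.
  apply: smooth_in_sum => b _; apply: smooth_in_mul => //; apply: smooth_in_mul => //.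
  apply: smooth_in_sum => e _; apply: smooth_in_add.
    by apply: smooth_in_sub; exact: dcs.
  by apply: smooth_in_sum => e' _; apply: smooth_in_sub; apply: smooth_in_mul.
apply: smooth_in_add.
  apply: smooth_in_add; first by apply: dcs; exact: div_zeta_smooth.
  by apply: smooth_in_sum => e _; apply: smooth_in_mul => //; exact: div_zeta_smooth.
apply: smooth_in_mul; last exact: div_zeta_smooth.
by apply: smooth_in_mul.
Qed.

Definition Ladj i j q : R := \adj (Lmx c q) i j.
Local Notation o := (lshift n (0 : 'I_1)).
Local Notation w q := (wconn nabla c q).

Lemma Ladj_smooth i j : smooth_in U c (Ladj i j).
Proof.
apply: (smooth_in_ext (f := fun q => cofactor (Lmx c q) j i) hc).
  by move=> q _ _; rewrite /Ladj mxE.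
apply: smooth_in_mul; first exact: smooth_in_cst.
apply: smooth_in_det => k l.
apply: (smooth_in_ext (f := fun q => Lmx c q (lift j k) (lift i l)) hc); last exact: Lmx_smooth.
by move=> q _ _; rewrite !mxE.
Qed.

Lemma Ladj_corner q : U q -> Ladj o o q = \det (z c q).
Proof. by move=> dq; apply: adj_corner => a b; exact: Lmx_rshift. Qed.

Lemma Ladj_interior i j q : U q -> IM q ->
  Ladj i j q = Ladj o o q * kernel_coef (wconn nabla c q) i * kernel_coef (wconn nabla c q) j.
Proof.
move=> dq Iq; apply: (@adj_pullback _ _ (z c q)).
- rewrite z_interior // unitmxE unitfE -normr_eq0 det_zeta //.
  exact: (tau_neq0 hg hc Iq dq).
- exact: z_sym.
- by move=> k l; exact: Lmx_interior.
Qed.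

(** Clear from [Ladj_interior] on the interior, where the kernel vector is defined; at the boundary
    only these polynomial relations between the entries survive. *)
Lemma Ladj_rank1 i j k l q : U q -> Ladj i j q * Ladj k l q = Ladj i k q * Ladj j l q.
Proof.
move=> dq; have sm i' j' k' l' : smooth_in U c (fun q => Ladj i' j' q * Ladj k' l' q).
  by apply: smooth_in_mul; exact: Ladj_smooth.
apply: (eq_by_density (f := fun q => Ladj i j q * Ladj k l q)
  (g := fun q => Ladj i k q * Ladj j l q) i00 oU dq).
- exact: (smooth_in_cvg hc oU dq dq (sm _ _ _ _)).
- exact: (smooth_in_cvg hc oU dq dq (sm _ _ _ _)).
move=> q' dq' Iq'.
rewrite (Ladj_interior i j) // (Ladj_interior k l) // (Ladj_interior i k) // (Ladj_interior j l) //.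
ring.
Qed.

Lemma Ladj_corner_norm q : U q -> IM q -> `|Ladj o o q| = tau g c q.
Proof. by move=> dq Iq; rewrite Ladj_corner // z_interior // det_zeta. Qed.

(** The trace form of [G0] is minus the sum of that of nabla and Y, so Y drops out and nabla is
    shifted by minus its own density form in the chart [c]. *)
Lemma trace_free_interior d q k i j : atlas d -> dom d q -> dom c q -> IM q ->
  trace_free c G0 d q k i j = nabla d q k i j -
    (\sum_a w q a * jac d c q a i) * (k == j)%:R - (\sum_a w q a * jac d c q a j) * (k == i)%:R.
Proof.
move=> hd dq cq Iq.
have E (i' : 'I_n) : frame_form c (trace_form c G0) d q 0 i' =
    - (\sum_a w q a * jac d c q a i') - Y d q 0 i'.
  case: hY => _ /(_ d c q (conj (And3 hd dq Iq) (And3 hc cq Iq))) ->.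
  rewrite !mxE -!sumrN -big_split /=; apply: eq_bigr => a _.
  by rewrite mxE (wconnE G0E) //; ring.
by rewrite /trace_free {1}/proj_shift !E G0E // /proj_shift; ring.
Qed.

Lemma boundary_corner p : dom c p -> bm_boundary p -> Ladj o o p = 0.
Proof.
move=> dp bp; apply/eqP/negP => /negP T0; apply: (hnoext bp).
set T := Ladj o o in T0 *.
pose W := dom c `&` T @^-1` [set x | x != 0].
have oW : open W.
  apply: open_preimage_in => //.
  by move=> q dq; exact: (smooth_in_cvg hc oU dq dq (Ladj_smooth o o)).
have Wc : W `<=` dom c by move=> q [].
have sT : smooth_in W c T by apply: smooth_in_subset Wc _; exact: Ladj_smooth.
(* Smooth near [p], and equal to the density form of nabla on the interior: there |T| is tau, whose
   logarithmic derivative is - 2 w, whatever the sign of T. Shifting the trace-free representative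
   by it recovers nabla. *)
pose h q : 'rV[R]_n := \row_i - (2^-1 * ((T q)^-1 * dc c i T q)).
have GU : affine W (trace_free c G0).
  by apply: trace_free_affine => //; exact: affine_subset hG0.
exists W, (proj_shift (trace_free c G0) (frame_form c h)); split=> //.
  apply: proj_shift_affine => //; apply: frame_form_one_form => // a.
  apply: (smooth_in_ext (f := fun q => - (2^-1 * ((T q)^-1 * dc c a T q))) hc).
    by move=> q _ _; rewrite mxE.
  apply: smooth_in_opp; apply: smooth_in_mul; first exact: smooth_in_cst.
  by apply: smooth_in_mul; [apply: smooth_in_inv => // q []|exact: smooth_in_dc].
move=> d q [hd ddq [[cq Tq] Iq]].
have hw i : h q 0 i = w q i.
  rewrite mxE.
  have Vq : (W `&` IM) q by [].
  have oV : open (W `&` IM) by apply: openI.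
  have sTV : smooth_in (W `&` IM) c T by apply: smooth_in_subset (@subIsetl _ _ _) sT.
  have := dc_normr_powR i hc oV Vq cq 1 sTV Tq.
  rewrite (dc_ext (g := tau g c) i hc oV Vq cq); last 2 first.
  - by move=> q' [[dq' _] Iq'] _; rewrite powRr1 // Ladj_corner_norm.
  - by apply: smooth_in_normr_powR => // q' [[]].
  rewrite (dc_tau i00 hg hnabla hc Iq cq) powRr1 // Ladj_corner_norm // mul1r.
  have t0 := tau_neq0 hg hc Iq cq.
  move=> E; have -> : (T q)^-1 * dc c i T q = - 2 * w q i.
    by apply: (mulfI t0); rewrite mulrA -E; ring.
  by field.
have FE (i : 'I_n) : frame_form c h d q 0 i = \sum_a w q a * jac d c q a i.
  by rewrite mxE; apply: eq_bigr => a _; rewrite hw.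
apply/funext => k; apply/funext => i; apply/funext => j.
by rewrite /proj_shift trace_free_interior // !FE; ring.
Qed.

(** * A smooth square root of tau *)

Section Defining.
Variable a : 'I_n.
Local Notation Aa := (Ladj (rshift 1 a) (rshift 1 a)).
Local Notation V := (dom c `&` Aa @^-1` [set x | x != 0]).

(** On the interior A_0a = - A_00 w_a and A_aa = A_00 w_a^2, so this is a square root of |A_00| up
    to sign; the quotient is visibly smooth up to the boundary where A_aa is nonzero. *)
Definition defining q : R := Ladj o (rshift 1 a) q * `|Aa q| `^ (- 2^-1).
Local Notation s := defining.

Let oV : open V.
Proof.
apply: open_preimage_in => //.
by move=> q dq; exact: (smooth_in_cvg hc oU dq dq (Ladj_smooth _ _)).
Qed.
Let Vc : V `<=` dom c. Proof. by move=> q []. Qed.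

Lemma defining_smooth : smooth_in V c s.
Proof.
apply: smooth_in_mul; first by apply: smooth_in_subset Vc _; exact: Ladj_smooth.
apply: smooth_in_normr_powR => // [q []//|].
by apply: smooth_in_subset Vc _; exact: Ladj_smooth.
Qed.

Lemma defining_sqr q : V q -> s q * s q = `|Ladj o o q|.
Proof.
move=> [dq Aq].
have -> : s q * s q = `|Ladj o (rshift 1 a) q * Ladj o (rshift 1 a) q| *
    (`|Aa q| `^ (- 2^-1)) ^+ 2.
  by rewrite normrM -[in RHS]expr2 real_normK ?num_real // /s; ring.
rewrite Ladj_rank1 // normrM -powR_mulrn ?powR_ge0 // -powRrM mulNr mulVf ?pnatr_eq0 // powRN powRr1 //.
by rewrite mulfK // normr_eq0.
Qed.

Lemma defining_neq0 q : V q -> IM q -> s q != 0.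
Proof.
move=> Vq Iq; have := defining_sqr Vq; rewrite Ladj_corner_norm //; last by case: Vq.
move=> E; apply/eqP => s0; have := tau_neq0 hg hc Iq (Vc Vq).
by rewrite -E s0 mul0r eqxx.
Qed.

Lemma defining_boundary q : V q -> bm_boundary q -> s q = 0.
Proof.
move=> Vq bq; have := defining_sqr Vq; rewrite boundary_corner ?normr0 //; last by case: Vq.
by move/eqP; rewrite mulf_eq0 orbb => /eqP.
Qed.

Lemma defining_dc b q : V q -> IM q -> dc c b s q = - w q b * s q.
Proof.
move=> Vq Iq; have dq := Vc Vq.
have oW : open (V `&` IM) by apply: openI.
have Wq : (V `&` IM) q by [].
have sW : smooth_in (V `&` IM) c s.
  by apply: smooth_in_subset (@subIsetl _ _ _) _; exact: defining_smooth.
have := dcM b hc oW Wq dq sW sW.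
rewrite (dc_ext (g := tau g c) b hc oW Wq dq); last 2 first.
- by move=> q' [Vq' Iq'] dq'; rewrite defining_sqr // Ladj_corner_norm.
- exact: smooth_in_mul.
rewrite (dc_tau i00 hg hnabla hc Iq dq) -Ladj_corner_norm // -defining_sqr // => E.
apply: (mulfI (defining_neq0 Vq Iq)).
have {}E : s q * dc c b s q + s q * dc c b s q = 2 * (s q * (- w q b * s q)).
  by rewrite -E; ring.
lra.
Qed.

(** On the interior (d_a s)^4 = w_a^4 tau^2 = A_aa^2, and this persists on the boundary by
    continuity. Fourth powers remove the absolute value and the sign. *)
Lemma defining_dc_neq0 q : V q -> dc c a s q != 0.
Proof.
move=> Vq; have dq := Vc Vq.
have ss : smooth_in V c (dc c a s) by apply: smooth_in_dc => //; exact: defining_smooth.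
have s4 : smooth_in V c (fun q => dc c a s q * dc c a s q * (dc c a s q * dc c a s q)).
  by do 2! apply: smooth_in_mul => //.
have AA : smooth_in V c (fun q => Aa q * Aa q).
  by apply: smooth_in_subset Vc _; apply: smooth_in_mul; exact: Ladj_smooth.
have E : dc c a s q * dc c a s q * (dc c a s q * dc c a s q) = Aa q * Aa q.
  apply: (eq_by_density (f := fun q => dc c a s q * dc c a s q * (dc c a s q * dc c a s q))
    (g := fun q => Aa q * Aa q) i00 oV Vq).
  - exact: (smooth_in_cvg hc oV Vq dq s4).
  - exact: (smooth_in_cvg hc oV Vq dq AA).
  move=> q' Vq' Iq'; have dq' := Vc Vq'.
  have -> : dc c a s q' * dc c a s q' * (dc c a s q' * dc c a s q') =
      w q' a ^+ 4 * (s q' * s q') ^+ 2.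
    by rewrite defining_dc //; ring.
  rewrite defining_sqr // real_normK ?num_real // (Ladj_interior (rshift 1 a) (rshift 1 a)) //.
  by rewrite kernel_rshift; ring.
apply/eqP => s0; move/eqP: E; rewrite s0 !mul0r eq_sym mulf_eq0 orbb.
by case: Vq => _ /negP.
Qed.

End Defining.

(** By the rank one relations A_ij^2 = A_ii A_jj, so an adjugate with zero diagonal would vanish,
    against the rank. The corner being zero, the nonzero diagonal entry is one of the others. *)
Lemma defining_index p : \rank (Lmx c p) = n -> dom c p -> Ladj o o p = 0 ->
  exists a, Ladj (rshift 1 a) (rshift 1 a) p != 0.
Proof.
move=> rp dp Aoo; apply: contrapT => /forallNP H.
have diag i : Ladj i i p = 0.
  case: (split_ordP i) => k ->; first by rewrite (_ : k = 0) // ord1.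
  by apply/eqP/negP => /negP; exact: H.
have /eqP := rank_adj_neq0 rp; apply; apply/matrixP => i j; rewrite [RHS]mxE.
have := Ladj_rank1 i j i j dp; rewrite !diag mul0r => /eqP.
by rewrite mulf_eq0 orbb => /eqP.
Qed.

End Frame.

Hypothesis hrank : forall c p, at_pt setT c p -> form_rank L c p = n.

Lemma compact_order1 : projectively_compact 1 nabla.
Proof.
move=> p bp; have [c hc dp] := bm_cover p.
have Aoo := boundary_corner hc dp bp.
have [a Aa] := defining_index hc (hrank (And3 hc dp I)) dp Aoo.
pose A := Ladj c (rshift 1 a) (rshift 1 a); pose s := defining c a.
pose V := dom c `&` A @^-1` [set x | x != 0].
have oV : open V.
  apply: open_preimage_in (dom_open hc) _ (@open_neq R 0) => q dq.
  exact: (smooth_in_cvg hc (dom_open hc) dq dq (Ladj_smooth hc _ _)).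
have Vp : V p by [].
have sV : smooth_in V c s by exact: defining_smooth.
have sn0 q : V q -> IM q -> s q != 0 by exact: defining_neq0.
have [U [oU Up UV sgn]] := constant_sign i00 hc oV Vp dp sV sn0.
have {}UV : U `<=` V by move=> q /UV[].
have Uc : U `<=` dom c by move=> q /UV[].
have [q0 [Uq0 Iq0]] := interior_dense i00 oU Up.
(* The constant [s q0] corrects the sign: [s] keeps one sign on the interior points of [U], so the
   product is positive there. *)
pose r q := s q0 * s q.
have sU : smooth_in U c s by exact: smooth_in_subset UV sV.
have sr : smooth_in U c r by apply: smooth_in_mul; [exact: smooth_in_cst|].
have fr := smooth_fun_chart hc oU Uc sr.
have s0 : s q0 != 0 by apply: sn0 => //; exact: UV.
have rpos q : U q -> IM q -> 0 < r q by move=> Uq Iq; exact: sgn.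
have rbd q : U q -> bm_boundary q -> r q = 0.
  by move=> Uq bq; rewrite /r [s q]defining_boundary ?mulr0 //; exact: UV.
have dcr i q : U q -> dc c i r q = s q0 * dc c i s q.
  by move=> Uq; exact: (dcZ i hc oU Uq (Uc _ Uq)).
(* On the interior dr / r is minus the density form of nabla in the chart [c], expressed in an
   arbitrary chart [d]. *)
have dr d q i : atlas d -> dom d q -> U q -> IM q ->
    dc d i r q / r q = - \sum_b wconn nabla c q b * jac d c q b i.
  move=> hd dq Uq Iq; have r0 : r q != 0 by rewrite gt_eqF ?rpos.
  rewrite (dc_chain hd hc oU sr i Uq dq (Uc _ Uq)).
  apply: (mulIf r0); rewrite divfK // -sumrN mulr_suml; apply: eq_bigr => b _.
  have ds : dc c b s q = - wconn nabla c q b * s q := defining_dc hc b (UV _ Uq) Iq.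
  rewrite (dcr b q Uq) ds /r.
  by move: (s q0) (s q) => x y; ring.
exists U, r; split=> //.
  split=> // [q Uq|q Uq|d q [hd dq [Uq bq]]].
  - have [bq|Iq] := pselect (bm_boundary q); first by rewrite rbd.
    exact/ltW/rpos.
  - split=> [r0|]; last exact: rbd.
    by apply: contrapT => Iq; have := rpos q Uq Iq; rewrite r0 ltxx.
  - apply: contrapT => /forallNP H.
    have /eqP : dc c a r q = 0.
      rewrite (dc_chain hc hd oU (fr d hd)) ?big1 //; last exact: Uc.
      by move=> b _; have /contrapT -> := H b; rewrite mul0r.
    rewrite dcr // mulf_eq0 (negbTE s0) /=; apply/negP.
    by apply: defining_dc_neq0 => //; exact: UV.
move=> mu xi hmu hxi.
have GU : affine U (trace_free c G0).
  by apply: trace_free_affine => //; exact: affine_subset hG0.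
(* With alpha = 1 the modified connection is nabla + dr / r, that is the representative that is
   trace free in [c], which is smooth up to the boundary. *)
exists (cov_deriv (trace_free c G0) mu xi); first exact: cov_deriv_vector_field.
move=> d q [hd dq [Uq Iq]]; apply/rowP => k; rewrite !mxE mul1r.
rewrite -!addrA; congr (_ + _).
pose psi i := dc d i r q / r q.
have psiE i : psi i = - \sum_a wconn nabla c q a * jac d c q a i := dr d q i hd dq Uq Iq.
have TE i j : trace_free c G0 d q k i j =
    nabla d q k i j + psi i * (k == j)%:R + psi j * (k == i)%:R.
  have := trace_free_interior hc k i j hd dq (Uc _ Uq) Iq; rewrite !psiE => ->.
  by rewrite !mulNr.
have -> : dir_deriv d r q (mu d q) / r q = \sum_i psi i * mu d q 0 i.
  by rewrite /dir_deriv mulr_suml; apply: eq_bigr => i _; rewrite /psi; ring.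
have -> : dir_deriv d r q (xi d q) / r q = \sum_i psi i * xi d q 0 i.
  by rewrite /dir_deriv mulr_suml; apply: eq_bigr => i _; rewrite /psi; ring.
clearbody psi.
(* The two correction terms become double sums against Kronecker deltas, to be compared with the
   Christoffel terms summand by summand. *)
rewrite -(sum_delta (fun j => (\sum_i psi i * mu d q 0 i) * xi d q 0 j) k).
rewrite -(sum_delta (fun i => (\sum_j psi j * xi d q 0 j) * mu d q 0 i) k).
under [X in _ = _ + (X + _)]eq_bigr do rewrite mulr_suml mulr_suml.
rewrite [X in _ = _ + (X + _)]exchange_big /= -!big_split /=; apply: eq_bigr => i _.
rewrite !mulr_suml -!big_split /=; apply: eq_bigr => j _.
by rewrite TE [k == j]eq_sym [k == i]eq_sym; ring.
Qed.

End Cotractor.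

Theorem corollary1p3 (R : realType) (n : nat) (hn : (2 <= n)%N)
  (M : bmanifold R n) (hor : orientable M) (hconn : connected [set: M])
  (g : chart R n M -> M -> 'M[R]_n) (hg : pseudo_metric bm_interior g)
  (nabla : connection M) (hnabla : levi_civita bm_interior g nabla)
  (hflat : scalar_flat bm_interior g nabla)
  (hnoext : forall p : M, bm_boundary p -> ~ connection_extends_near nabla p)
  (P : set (connection M)) (hP : proj_extension nabla P) :
  (exists z, zeta_extension g z) /\
  (forall z L, zeta_extension g z -> is_L P z L ->
     (forall c p, at_pt setT c p -> form_rank L c p = n) ->
     projectively_compact 1 nabla).
Proof.
have [[G0 hG0 EP] Psub] := hP.
have PG0 : P G0 by rewrite EP; exact: proj_class_refl.
have [_ [Y hY G0E]] := Psub _ PG0.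
have n0 : (0 < n)%N by exact: ltn_trans hn.
pose i0 := Ordinal n0; have i00 : val i0 = 0%N by [].
split; first by exists (zeta_ext g); exact: (zeta_extends hn i00 hg hnabla hG0 hY G0E).
move=> z L hz hL hrank.
exact: (compact_order1 i00 hg hnabla hflat hG0 PG0 hY G0E hnoext hz hL hrank).
Qed.
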